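(* Let $g=(g_1,\dots,g_m)\in\mathbb R[X]^m$ such that $M(g)$ is Archimedean and suppose that $S(g)$ has nonempty interior near its convex boundary. Suppose that $g_i$ is strictly quasiconcave on $(\operatorname{convbd}S(g))\cap Z(g_i)$ for each $i\in\{1,\dots,m\}$. Then there exists $d\in\mathbb N$ such that for all $\ell\in\mathbb R[X]_1$ with $\ell\ge0$ on $S(g)$, we have $\ell\in M_d(g)$.
   Context: $\mathbb N=\{1,2,\dots\}$, $\mathbb N_0=\mathbb N\cup\{0\}$, $n,m\in\mathbb N_0$. $\mathbb R[X]=\mathbb R[X_1,\dots,X_n]$, and $\mathbb R[X]_1$ is the space of polynomials of degree at most $1$. For $g=(g_1,\dots,g_m)\in\mathbb R[X]^m$ set $g_0:=1$ and $S(g):=\{x\in\mathbb R^n\mid g_1(x)\ge0,\dots,g_m(x)\ge0\}$. For $d\in\mathbb N_0$, $$M_d(g):=\Big\{\sum_{i=0}^m\sum_j p_{ij}^2g_i\ \Big|\ p_{ij}\in\mathbb R[X],\ \deg(p_{ij}^2g_i)\le d\Big\}$$ (the inner sums are finite of arbitrary length; $\deg 0:=-\infty$), and $M(g):=\bigcup_{d\in\mathbb N_0}M_d(g)$. $M(g)$ is called Archimedean if for every $p\in\mathbb R[X]$ there is $N\in\mathbb N$ with $N+p\in M(g)$ and $N-p\in M(g)$. For $S\subseteq\mathbb R^n$, the convex boundary is $\operatorname{convbd}S:=S\cap\partial\operatorname{conv}S$ (boundary of the convex hull in $\mathbb R^n$), and $S$ has nonempty interior near its convex boundary if $\operatorname{convbd}S\subseteq\overline{S^\circ}$.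 $Z(p):=\{x\in\mathbb R^n\mid p(x)=0\}$. A polynomial $p\in\mathbb R[X]$ is strictly quasiconcave at $x\in\mathbb R^n$ if for all $v\in\mathbb R^n\setminus\{0\}$: $(\nabla p(x))^Tv=0$ implies $v^T(\operatorname{Hess}p)(x)v<0$; it is strictly quasiconcave on a set if it is so at each point of the set. *)

(* Defs.v *)
From HB Require Import structures.
From mathcomp Require Import all_boot all_order all_algebra.
From mathcomp Require Import all_classical all_reals all_analysis.
(* The notations of mpoly clash with those of MathComp-Analysis. *)
From mathcomp Require Import -(notations) mpoly.
Set Implicit Arguments.
Unset Strict Implicit.
Unset Printing Implicit Defensive.

Import Order.TTheory GRing.Theory Num.Theory.
Import numFieldNormedType.Exports.

Local Open Scope classical_set_scope.
Local Open Scope ring_scope.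

Notation "{ 'mpoly' T [ n ] }" := (mpoly.mpoly n T) : type_scope.

Section QuadraticModule.
Context {R : realType} {n m : nat}.
Implicit Types (p q : {mpoly R[n]}) (g : 'I_m -> {mpoly R[n]}).
Implicit Types (x v : 'rV[R]_n) (S : set 'rV[R]_n).

Definition peval p x : R := meval (fun i => x 0 i) p.

Definition zero_set p : set 'rV[R]_n := [set x | peval p x = 0].

Definition basic_semialg g : set 'rV[R]_n :=
  [set x | forall i, 0 <= peval (g i) x].

(* [mpoly.msize p] is [deg p + 1], and [0] for [p = 0], so that
   [deg p <= d], with [deg 0 = -oo], reads [mpoly.msize p <= d.+1]. *)
Definition deg_le (d : nat) p : bool := (mpoly.msize p <= d.+1)%N.

(* The family [g_0 = 1, g_1, ..., g_m]; the index [i : 'I_m] of [g] stands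
   for [i + 1]. *)
Definition with_one g (i : 'I_m.+1) : {mpoly R[n]} := oapp g 1 (unlift 0 i).

Definition trunc_quad_module (d : nat) g : set {mpoly R[n]} :=
  [set f | exists s : 'I_m.+1 -> seq {mpoly R[n]},
    (forall i, {in s i, forall p, deg_le d (p ^+ 2 * with_one g i)}) /\
    f = \sum_(i < m.+1) \sum_(p <- s i) p ^+ 2 * with_one g i].

Definition quad_module g : set {mpoly R[n]} :=
  \bigcup_d trunc_quad_module d g.

Definition quad_archimedean g : Prop :=
  forall p, exists N : nat, [/\ (0 < N)%N,
    quad_module g (N%:R + p) & quad_module g (N%:R - p)].

Definition conv_hull S : set 'rV[R]_n :=
  smallest (@convex_set R 'rV[R]_n) S.

Definition boundary S : set 'rV[R]_n := closure S `\` S°.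

Definition convbd S : set 'rV[R]_n := S `&` boundary (conv_hull S).

Definition interior_near_convbd S : Prop := convbd S `<=` closure S°.

Definition gradient p x : 'rV[R]_n := \row_i peval (mderiv i p) x.

Definition hessian p x : 'M[R]_n :=
  \matrix_(i, j) peval (mderiv j (mderiv i p)) x.

Definition strictly_quasiconcave_at p x : Prop :=
  forall v, v != 0 ->
    gradient p x *m v^T = 0 -> (v *m hessian p x *m v^T) 0 0 < 0.

Definition strictly_quasiconcave_on p S : Prop :=
  forall x, S x -> strictly_quasiconcave_at p x.

End QuadraticModule.

(* Main.v *)
Require Import Defs.
From HB Require Import structures.
From mathcomp Require Import all_boot all_order all_algebra.
From mathcomp Require Import all_classical all_reals all_analysis.
From mathcomp Require Import -(notations) mpoly.
From mathcomp Require Import ring lra zify.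
Set Implicit Arguments.
Unset Strict Implicit.
Unset Printing Implicit Defensive.

Import Order.TTheory GRing.Theory Num.Theory.
Import numFieldNormedType.Exports.

Local Open Scope classical_set_scope.
Local Open Scope ring_scope.

(** * Why one degree suffices

Write S for the set of common nonnegativity of the g_i and M_d for the
truncated quadratic modules.  Up to scaling, only the affine forms l whose
coefficient vector has norm 1 matter.  They make up a compact set, so it is
enough to find, for every form l0 >= 0 on S, one degree that serves all forms
l near l0 that are nonnegative on S ([uniform_certificate_near]).

Families.  Such a statement concerns a family of polynomials indexed along a
filter: [umod f] says that eventually all members of f lie in M_d for one d.
These families are closed under sums and under multiplication by squares of
bounded degree, and a uniform Putinar theorem holds for them: a family of
bounded degree with bounded coefficients that stays above a positive constant
on S is in [umod] ([umod_pos]).  Positivity being settled in this way, the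
proof is about the zeros of l0 on S.

Zeros.  If l0 has nonzero linear part, its zeros on S lie on the convex
boundary.  Let x be such a zero and let p_N = g_i (1 - g_i / beta)^(2N), where
beta is an upper bound of the g_i on S.  It belongs to the quadratic module, it
vanishes with the same gradient as g_i at the zeros of g_i, and it is at most
beta / N on S.  At a zero of g_i its Hessian is that of g_i minus a
multiple of the square of the gradient, so that strict quasiconcavity makes it
negative definite for large N ([local_penalty]).  This has three consequences.
Since x is not isolated in S, the active constraints have a common direction of
increase at x, so that the minimum eps of l on S near x is attained at a point
y with bounded Lagrange multipliers lam ([kkt], [local_multipliers]).  The
difference l - eps - sum lam_i p_N grows quadratically at y on S near x.
And the zeros of l0 on S are isolated, hence finite in number: x_1, ..., x_K, with
minimisers y_1, ..., y_K that depend on l ([local_data]).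

Certificates.  Let w = prod_k |X - y_k|^2 and f = l - delta w; by quadratic
growth, f >= 0 on S if delta is small.  For every k and every tau > 0 the
family f + tau |X - y_k|^2 is in [umod] ([point_certificate]): subtracting
eps + sum lam_i p_N leaves a quadratic form in X - y_k with polynomial
coefficients, whose matrix at y_k is positive semidefinite and which is
nonnegative on S, by quadratic growth near x_k and because p_N is small
elsewhere.  Such forms are treated in [quadratic_form_umod].
Next, [merge_certificates] replaces |X - y_k|^2 by products over several
points, using the identity 1 = z^2 + c^2 + z^2 c for c = 1 - z^2, until
f + tau w is in [umod] for every tau > 0.  With tau = delta this is l itself.
*)

(** * Archimedean quadratic modules and their characters *)

Section AbstractQuadraticModule.
Context {R : realType} {A : comAlgType R}.
Implicit Types (a b p f h s : A) (P Q : set A) (c r : R).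

Definition qmodule Q :=
  [/\ Q 1, forall f h, Q f -> Q h -> Q (f + h) & forall p f, Q f -> Q (p ^+ 2 * f)].

Definition sos : set A := [set s | exists l : seq A, s = \sum_(x <- l) x ^+ 2].

Lemma sos0 : sos 0.
Proof. by exists [::]; rewrite big_nil. Qed.

Lemma sos_sqr p : sos (p ^+ 2).
Proof. by exists [:: p]; rewrite big_seq1. Qed.

Lemma sosD s1 s2 : sos s1 -> sos s2 -> sos (s1 + s2).
Proof. by move=> [l1 ->] [l2 ->]; exists (l1 ++ l2); rewrite big_cat. Qed.

Lemma sos_sqrM p s : sos s -> sos (p ^+ 2 * s).
Proof.
move=> [l ->]; exists (map (fun x => p * x) l).
by rewrite big_map mulr_sumr; apply: eq_bigr => x _; rewrite exprMn.
Qed.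

Section QmoduleTheory.
Variables (Q : set A) (Qqm : qmodule Q).

Lemma qm1 : Q 1. Proof. by case: Qqm. Qed.
Lemma qmD f h : Q f -> Q h -> Q (f + h). Proof. by case: Qqm => _ + _; apply. Qed.
Lemma qm_sqrM p f : Q f -> Q (p ^+ 2 * f). Proof. by case: Qqm => _ _; apply. Qed.
Lemma qm_sqr p : Q (p ^+ 2). Proof. by rewrite -[X in Q X]mulr1; apply/qm_sqrM/qm1. Qed.
Lemma qm0 : Q 0. Proof. by have := qm_sqr 0; rewrite expr0n. Qed.

Lemma qm_scale c f : 0 <= c -> Q f -> Q (c *: f).
Proof.
move=> c0 Qf; have := qm_sqrM (Num.sqrt c)%:A Qf.
by rewrite expr2 -scalerAl mul1r -scalerAl -scalerAl mul1r scalerA -expr2 sqr_sqrtr.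
Qed.

Lemma qm_const c : 0 <= c -> Q c%:A.
Proof. by move=> c0; apply: qm_scale => //; exact: qm1. Qed.

Lemma qm_sosM s f : sos s -> Q f -> Q (s * f).
Proof.
move=> [l ->] Qf; rewrite mulr_suml.
by elim/big_rec: _ => [|x y _ Qy]; [exact: qm0 | apply: qmD => //; exact: qm_sqrM].
Qed.

Lemma qm_sos s : sos s -> Q s.
Proof. by move=> ss; rewrite -[s]mulr1; apply: qm_sosM => //; exact: qm1. Qed.

End QmoduleTheory.

Definition qm_adjoin Q a : set A :=
  [set f | exists q s, [/\ Q q, sos s & f = q + s * a]].

Lemma qm_adjoin_qmodule Q a : qmodule Q -> qmodule (qm_adjoin Q a).
Proof.
move=> Qqm; split.
- by exists 1, 0; split; [exact: qm1|exact: sos0|rewrite mul0r addr0].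
- move=> _ _ [q1 [s1 [Q1 S1 ->]]] [q2 [s2 [Q2 S2 ->]]].
  exists (q1 + q2), (s1 + s2); split; [exact: qmD|exact: sosD|ring].
- move=> p _ [q [s [Qq Ss ->]]]; exists (p ^+ 2 * q), (p ^+ 2 * s).
  by split; [exact: qm_sqrM|exact: sos_sqrM|ring].
Qed.

Lemma sub_qm_adjoin Q a : Q `<=` qm_adjoin Q a.
Proof. by move=> q Qq; exists q, 0; split=> //; [exact: sos0|rewrite mul0r addr0]. Qed.

Lemma qm_adjoin_mem Q a : qmodule Q -> qm_adjoin Q a a.
Proof.
move=> Qqm; exists 0, 1; split; [exact: qm0| |by rewrite add0r mul1r].
by rewrite -[1](expr1n _ 2); exact: sos_sqr.
Qed.

Definition proper_qm Q := qmodule Q /\ ~ Q (-1).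

(** If a maximal P contained neither a nor - a, then -1 = q1 + s1 a = q2 - s2 a
with q1, q2 in P and sums of squares s1, s2.  Eliminating a gives - s1 in P,
hence s1 a in P because 4 s1 a = (a + 1)^2 s1 + (a - 1)^2 (- s1), and so -1
is in P. *)
Lemma maximal_proper_qm Q : proper_qm Q ->
  exists P, [/\ proper_qm P, Q `<=` P & forall a, P a \/ P (- a)].
Proof.
move=> [Qqm Qn1].
pose Good := [set P | proper_qm P /\ Q `<=` P].
have [P [goodP maxP]] : exists P, Good P /\ forall P', P `<=` P' -> Good P' -> P' `<=` P.
  have [|P [PP maxP]] := @Zorn_bigcup A (fun P => P = set0 \/ Good P).
    move=> F FP Ftot.
    have [[P0 [FP0 goodP0]]|noP] := pselect (exists P, F P /\ Good P); last first.
      left; rewrite -subset0 => a [P FPa Pa].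
      by have [P0|gP] := FP _ FPa; [rewrite P0 in Pa|apply: noP; exists P].
    have FG P a : F P -> P a -> Good P.
      by move=> /FP[->|].
    right; split; last first.
      by move=> q Qq; exists P0 => //; exact: goodP0.2.
    split; last by move=> [P FPP Pn1]; have [[_ +] _] := FG _ _ FPP Pn1; apply.
    split.
    - by exists P0 => //; apply: qm1; exact: goodP0.1.1.
    - move=> f h [P1 F1 P1f] [P2 F2 P2h].
      have [P12|P21] := Ftot _ _ F1 F2.
        by exists P2 => //; apply: qmD => //; [exact: (FG _ _ F2 P2h).1.1|exact: P12].
      by exists P1 => //; apply: qmD => //; [exact: (FG _ _ F1 P1f).1.1|exact: P21].
    - move=> p f [P FPP Pf]; exists P => //; apply: qm_sqrM => //.
      exact: (FG _ _ FPP Pf).1.1.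
  have goodP : Good P.
    case: PP => // P0; exfalso; apply: (maxP Q); last by right; split.
    rewrite P0 properEneq; split; last by move=> ?.
    by apply/eqP/nesym => Q0; have := qm1 Qqm; rewrite Q0.
  exists P; split=> // P' PP' goodP'; apply: contrapT => P'P.
  by apply: (maxP P'); [split|right].
case: goodP => [[Pqm Pn1] QP].
exists P; split=> // a.
have adj b : ~ P b -> exists q s, [/\ P q, sos s & -1 = q + s * b].
  move=> nPb; apply: contrapT => nadj; apply: nPb.
  apply: (maxP (qm_adjoin P b)); first exact: sub_qm_adjoin.
    split; first by split=> //; exact: qm_adjoin_qmodule.
    by apply: subset_trans QP _; exact: sub_qm_adjoin.
  exact: qm_adjoin_mem.
have [|/adj[q1 [s1 [Pq1 S1 e1]]]] := pselect (P a); first by left.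
have [|/adj[q2 [s2 [Pq2 S2 e2]]]] := pselect (P (- a)); first by right.
have PNs1 : P (- s1).
  have -> : - s1 = s2 * q1 + s1 * q2 + s2.
    have -> : s2 * q1 + s1 * q2 + s2 =
       s2 * (q1 + s1 * a) + s1 * (q2 + s2 * - a) + s2 by ring.
    by rewrite -e1 -e2; ring.
  by apply: qmD; [|apply: qmD; [|exact: qm_sosM|exact: qm_sosM]|exact: qm_sos].
have Ps1a : P (s1 * a).
  have -> : s1 * a = 4%:R^-1 *: ((a + 1) ^+ 2 * s1 + (a - 1) ^+ 2 * - s1).
    have -> : (a + 1) ^+ 2 * s1 + (a - 1) ^+ 2 * - s1 = 4%:R * (s1 * a) by ring.
    by rewrite mulr_natl -(scaler_nat 4 (s1 * a)) scalerA mulVf ?scale1r ?pnatr_eq0.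
  apply: qm_scale => //.
  apply: qmD => //; apply: qm_sqrM => //; exact: qm_sos.
by exfalso; apply: Pn1; rewrite e1; exact: qmD.
Qed.

Definition qm_archimedean Q := forall a, exists N : nat, Q (N%:R - a).

Section State.
Variable P : set A.
Hypotheses (Pproper : proper_qm P) (Parch : qm_archimedean P).
Hypothesis Ptotal : forall a, P a \/ P (- a).

Let Pqm : qmodule P := Pproper.1.

(** The supremum of the reals below a modulo P: the value at a of the character
that a maximal proper module defines. *)
Definition state a : R := sup [set r | P (a - r%:A)].

Lemma qm_const_ge0 c : P c%:A -> 0 <= c.
Proof.
move=> Pc; rewrite leNgt; apply/negP => c0; apply: Pproper.2.
have -> : (-1 : A) = (- c)^-1 *: c%:A.
  by rewrite scalerA invrN mulNr mulVf ?lt_eqF// scaleN1r.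
by apply: qm_scale => //; rewrite invr_ge0 oppr_ge0 ltW.
Qed.

Let has_sup_state a : has_sup [set r | P (a - r%:A)].
Proof.
split.
  have [N PN] := Parch (- a); exists (- N%:R) => /=.
  by move: PN; rewrite !opprK scaleNr opprK scaler_nat addrC.
have [N PN] := Parch a; exists N%:R => r /= Pr.
rewrite -subr_ge0; apply: qm_const_ge0.
by rewrite scalerBl scaler_nat; have := qmD Pqm PN Pr; rewrite addrA subrK.
Qed.

Lemma state_ge a r : P (a - r%:A) -> r <= state a.
Proof. by move=> Pr; apply: ub_le_sup => //; exact: (has_sup_state a).2. Qed.

Lemma state_gt a r : r < state a -> P (a - r%:A).
Proof.
rewrite -subr_gt0 => /sup_adherent/(_ (has_sup_state a))[s /= Ps].
rewrite -/(state a) subKr => rs.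
have -> : a - r%:A = (a - s%:A) + (s - r)%:A by rewrite scalerBl addrA subrK.
by apply: qmD => //; apply: qm_const => //; rewrite subr_ge0 ltW.
Qed.

Lemma state_lt a r : state a < r -> P (r%:A - a).
Proof.
move=> ar; have [/state_ge|] := Ptotal (a - r%:A); first by rewrite leNgt ar.
by rewrite opprB.
Qed.

Lemma state_le a r : P (r%:A - a) -> state a <= r.
Proof.
move=> Pr; apply/ler_addgt0Pr => e e0; rewrite leNgt; apply/negP => /state_gt Pa.
have := qmD Pqm Pr Pa; rewrite addrA subrK -scalerBl => /qm_const_ge0.
by rewrite opprD addrA subrr add0r oppr_ge0 leNgt e0.
Qed.

Lemma state_ge0 a : P a -> 0 <= state a.
Proof. by move=> Pa; apply: state_ge; rewrite scale0r subr0. Qed.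

Lemma state_const c : state c%:A = c.
Proof.
by apply/eqP; rewrite eq_le state_ge ?state_le// subrr; exact: qm0.
Qed.

Lemma stateD a b : state (a + b) = state a + state b.
Proof.
apply/eqP; rewrite eq_le; apply/andP; split; apply/ler_addgt0Pr => e e0.
  have [/state_lt Pa /state_lt Pb] : state a < state a + e / 2 /\ state b < state b + e / 2.
    by split; lra.
  apply: state_le.
  have -> : (state a + state b + e)%:A - (a + b) =
    ((state a + e / 2)%:A - a) + ((state b + e / 2)%:A - b).
    by rewrite [e in LHS]splitr !scalerDl; ring.
  exact: qmD.
have [/state_gt Pa /state_gt Pb] : state a - e / 2 < state a /\ state b - e / 2 < state b.
  by split; lra.
rewrite -lerBlDr; apply: state_ge.
have -> : (a + b) - (state a + state b - e)%:A =
  (a - (state a - e / 2)%:A) + (b - (state b - e / 2)%:A).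
  by rewrite [e in LHS]splitr !(scalerDl, scalerBl, opprD, scaleNr); ring.
exact: qmD.
Qed.

Lemma state0 : state 0 = 0.
Proof. by have := state_const 0; rewrite scale0r. Qed.

Lemma stateN a : state (- a) = - state a.
Proof. by apply/eqP; rewrite -addr_eq0 addrC -stateD subrr state0. Qed.

(** Multiplicativity comes from this case: if both e - a and e + a are in P, then
2 e (e^2 - a^2) = (e - a)^2 (e + a) + (e + a)^2 (e - a) is in P. *)
Let state_sqr0 a : state a = 0 -> state (a ^+ 2) = 0.
Proof.
move=> a0; apply/eqP; rewrite eq_le state_ge0 ?andbT; last exact: qm_sqr.
suff H e : 0 < e -> state (a ^+ 2) <= e ^+ 2.
  apply/ler_addgt0Pr => e e0; rewrite add0r.
  by rewrite -(sqr_sqrtr (ltW e0)) H// sqrtr_gt0.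
move=> e0; apply: state_le.
have P1 : P (e%:A - a) by apply: state_lt; rewrite a0.
have P2 : P (e%:A + a) by rewrite -[a]opprK; apply: state_lt; rewrite stateN a0 oppr0.
have -> : (e ^+ 2)%:A - a ^+ 2 =
  (2 * e)^-1 *: ((e%:A - a) ^+ 2 * (e%:A + a) + (e%:A + a) ^+ 2 * (e%:A - a)).
  have -> : (e%:A - a) ^+ 2 * (e%:A + a) + (e%:A + a) ^+ 2 * (e%:A - a) =
    (2%:R * e%:A) * (e%:A ^+ 2 - a ^+ 2) by ring.
  have -> : 2%:R * e%:A = (2 * e)%:A :> A by rewrite mulr_natl -scaler_nat scalerA.
  rewrite -scalerAl mul1r scalerA mulVf ?scale1r; last by rewrite mulf_neq0 ?gt_eqF.
  by rewrite expr2 [in RHS]expr2 -scalerAl mul1r scalerA.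
apply: qm_scale => //; first by rewrite invr_ge0 mulr_ge0 ?ltW.
by apply: qmD => //; exact: qm_sqrM.
Qed.

Let state_scale0 c a : 0 < c -> state a = 0 -> state (c *: a) = 0.
Proof.
have half b : 0 < c -> state b = 0 -> state (c *: b) <= 0.
  move=> c0 b0; apply/ler_addgt0Pr => e e0; rewrite add0r; apply: state_le.
  have -> : e%:A - c *: b = c *: ((e / c)%:A - b).
    by rewrite scalerBr scalerA mulrCA divff ?gt_eqF// mulr1.
  by apply: qm_scale => //; [exact: ltW|apply: state_lt; rewrite b0 divr_gt0].
move=> c0 a0; apply/eqP; rewrite eq_le half//= -oppr_le0 -stateN -scalerN.
by apply: half => //; rewrite stateN a0 oppr0.
Qed.

Lemma state_scale c a : state (c *: a) = c * state a.
Proof.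
wlog c0 : c / 0 < c.
  move=> H; have [c0|c0|->] := ltgtP c 0; last by rewrite scale0r state0 mul0r.
    have Hc := H (- c); by rewrite -[c in LHS]opprK scaleNr stateN Hc ?oppr_gt0// mulNr opprK.
  exact: H.
have {1}-> : a = (a - (state a)%:A) + (state a)%:A by rewrite subrK.
rewrite scalerDr stateD scalerA state_const state_scale0 ?add0r//.
by rewrite stateD stateN state_const subrr.
Qed.

Lemma state_sqr a : state (a ^+ 2) = state a ^+ 2.
Proof.
set b := a - (state a)%:A.
have b0 : state b = 0 by rewrite stateD stateN state_const subrr.
have -> : a ^+ 2 = b ^+ 2 + (2 * state a) *: a - (state a ^+ 2)%:A.
  have -> : (state a ^+ 2)%:A = (state a)%:A ^+ 2 :> A.
    by rewrite expr2 [RHS]expr2 -scalerAl mul1r scalerA.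
  have -> : (2 * state a) *: a = 2%:R * ((state a)%:A * a) :> A.
    by rewrite [RHS]mulr_natl -scalerAl mul1r -(scaler_nat 2 (state a *: a)) scalerA.
  by rewrite /b; ring.
by rewrite !stateD stateN state_const state_scale state_sqr0//; ring.
Qed.

Lemma stateM a b : state (a * b) = state a * state b.
Proof.
have H : state ((a + b) ^+ 2) = state (a ^+ 2 + b ^+ 2 + 2 *: (a * b)).
  by congr state; rewrite scaler_nat; ring.
by move: H; rewrite !(stateD, state_scale, state_sqr) => H; nra.
Qed.

End State.

Definition is_character (phi : A -> R) :=
  [/\ forall a b, phi (a + b) = phi a + phi b, forall c a, phi (c *: a) = c * phi a,
      phi 1 = 1 & forall a b, phi (a * b) = phi a * phi b].

(** No proper quadratic module contains Q and - f, since a maximal one would give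
a character that is nonnegative on Q and nonpositive at f.  Hence s f - 1 is
in Q for a sum of squares s.  With it, f + r in Q implies f + r - 1 / N in Q
for a fixed N, and r decreases to 0 in finitely many steps. *)
Theorem archimedean_positivstellensatz Q f :
  qmodule Q -> qm_archimedean Q ->
  (forall phi, is_character phi -> (forall q, Q q -> 0 <= phi q) -> 0 < phi f) ->
  Q f.
Proof.
move=> Qqm Qarch fpos.
have [s [Ss Qsf]] : exists s, sos s /\ Q (s * f - 1).
  have [[q [s [Qq Ss e]]]|nQ'] := pselect (qm_adjoin Q (- f) (-1)).
    exists s; split=> //; suff -> : s * f - 1 = q by [].
    by rewrite e; ring.
  have [|P [Pproper QP Ptot]] := @maximal_proper_qm (qm_adjoin Q (- f)).
    by split=> //; exact: qm_adjoin_qmodule.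
  have QsubP : Q `<=` P by apply: subset_trans QP; exact: sub_qm_adjoin.
  have Parch : qm_archimedean P by move=> a; have [N QN] := Qarch a; exists N; apply: QsubP.
  have := fpos (state P); rewrite ltNge => H.
  exfalso; apply/negP: (state_ge0 Pproper Parch (QP _ (qm_adjoin_mem (- f) Qqm))).
  rewrite stateN// oppr_ge0; apply: H.
    split; [exact: stateD|exact: state_scale| |exact: stateM].
    by have := state_const Pproper Parch 1; rewrite scale1r.
  by move=> q Qq; apply: state_ge0 => //; exact: QsubP.
have [r0 Qr0] := Qarch (- f); rewrite opprK in Qr0.
have [N0 QN0] := Qarch (s ^+ 2 * f + r0%:R *: s ^+ 2).
pose N := N0.+1%:R : R; have N0gt : 0 < N by rewrite ltr0n.
(* N^2 (f + r - 1 / N) = (N - s)^2 (f + r) + 2 N (s f - 1) + remainder, where N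
is chosen so that the remainder is in Q for all r between 0 and r0. *)
have step r : 0 <= r <= r0%:R -> Q (f + r%:A) -> Q (f + (r - N^-1)%:A).
  move=> /andP[rge0 rle] Qr.
  have -> : f + (r - N^-1)%:A = (N ^- 2) *:
    ((N%:A - s) ^+ 2 * (f + r%:A) + ((2 * N) *: (s * f - 1) +
     ((N0%:R - (s ^+ 2 * f + r0%:R *: s ^+ 2)) + ((r0%:R - r) *: s ^+ 2 + (1 +
     (2 * N * r) *: s))))).
    have -> : (N0%:R : A) = N%:A - 1 by rewrite /N -natr1 scalerDl scale1r scaler_nat addrK.
    apply: (@scalerI _ _ (N ^+ 2)); first by rewrite expf_neq0// gt_eqF.
    rewrite scalerA divff ?scale1r ?expf_neq0 ?gt_eqF//.
    have NN : N ^+ 2 / N = N by rewrite expr2 mulfK ?gt_eqF.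
    rewrite scalerDr scalerA mulrBr NN.
    have al (c : R) (a : A) : c *: a = c%:A * a by rewrite -scalerAl mul1r.
    have aM (c d : R) : (c * d)%:A = c%:A * d%:A :> A by rewrite -scalerAl mul1r scalerA.
    rewrite !scalerBl ![_ *: s ^+ 2]al ![_ *: s]al ![_ *: f]al ![_ *: (s * f - 1)]al !aM.
    have -> : (2 : R)%:A = 2%:R :> A by rewrite scaler_nat.
    by ring.
  apply: qm_scale; [by []|by rewrite invr_ge0 exprn_ge0 ?ltW|].
  apply: qmD => //; first exact: qm_sqrM.
  apply: qmD => //; first by apply: qm_scale; rewrite ?mulr_ge0 ?(ltW N0gt).
  apply: qmD => //; apply: qmD => //.
    by apply: qm_scale; rewrite ?subr_ge0//; exact: qm_sqr.
  apply: qmD => //; first exact: qm1.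
  by apply: qm_scale; rewrite ?mulr_ge0 ?(ltW N0gt)//; exact: qm_sos.
have descent k : Q f \/ Q (f + (r0%:R - k%:R / N)%:A).
  elim: k => [|k [|IH]]; [right|by left|].
    by rewrite mul0r subr0 scaler_nat addrC.
  have [rge0|rlt0] := leP 0 (r0%:R - k%:R / N); last first.
    left; have -> : f = (f + (r0%:R - k%:R / N)%:A) + (- (r0%:R - k%:R / N))%:A.
      by rewrite scaleNr addrK.
    by apply: qmD => //; apply: qm_const => //; rewrite oppr_ge0 ltW.
  right; rewrite -natr1 mulrDl mul1r opprD addrA; apply: step => //.
  by rewrite rge0 lerBlDr lerDl divr_ge0 ?(ltW N0gt).
have [//|] := descent (r0 * N0.+1)%N.
by rewrite natrM mulfK ?gt_eqF// subrr scale0r addr0.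
Qed.

End AbstractQuadraticModule.

(** * Truncated quadratic modules and Putinar's theorem *)

Section QuadModule.
Context {R : realType} {n m : nat}.
Implicit Types (p q f : {mpoly R[n]}) (g : 'I_m -> {mpoly R[n]}).
Implicit Types (x v : 'rV[R]_n).

Lemma pevalD p q x : peval (p + q) x = peval p x + peval q x.
Proof. exact: mevalD. Qed.
Lemma pevalB p q x : peval (p - q) x = peval p x - peval q x.
Proof. exact: mevalB. Qed.
Lemma pevalN p x : peval (- p) x = - peval p x.
Proof. exact: mevalN. Qed.
Lemma pevalM p q x : peval (p * q) x = peval p x * peval q x.
Proof. exact: mevalM. Qed.
Lemma pevalZ c p x : peval (c *: p) x = c * peval p x.
Proof. exact: mevalZ. Qed.
Lemma peval0 x : peval 0 x = 0.
Proof. exact: meval0. Qed.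
Lemma peval1 x : peval 1 x = 1.
Proof. exact: meval1. Qed.
Lemma pevalC c x : peval (mpolyC n c) x = c.
Proof. exact: mevalC. Qed.
Lemma pevalXn p k x : peval (p ^+ k) x = peval p x ^+ k.
Proof. by elim: k => [|k IH]; rewrite ?expr0 ?peval1// !exprS pevalM IH. Qed.
Lemma peval_sum I (r : seq I) (P : pred I) (F : I -> {mpoly R[n]}) x :
  peval (\sum_(i <- r | P i) F i) x = \sum_(i <- r | P i) peval (F i) x.
Proof. exact: (big_morph (fun p => peval p x) (fun p q => pevalD p q x) (peval0 x)). Qed.
Lemma peval_prod I (r : seq I) (P : pred I) (F : I -> {mpoly R[n]}) x :
  peval (\prod_(i <- r | P i) F i) x = \prod_(i <- r | P i) peval (F i) x.
Proof. exact: (big_morph (fun p => peval p x) (fun p q => pevalM p q x) (peval1 x)). Qed.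

Definition pvar (i : 'I_n) : {mpoly R[n]} := mpolyX R (mnm1 i).

Lemma peval_var i x : peval (pvar i) x = x 0 i.
Proof. exact: mevalXU. Qed.

Definition peval_simp := (pevalD, pevalB, pevalN, pevalM, pevalZ, peval0, peval1,
  pevalC, pevalXn, peval_var).

Lemma character_peval (phi : {mpoly R[n]} -> R) : is_character phi ->
  exists x, forall p, phi p = peval p x.
Proof.
move=> [phiD phiZ phi1 phiM].
have phi0 : phi 0 = 0 by have := phiZ 0 0; rewrite scale0r mul0r.
exists (\row_i phi (pvar i)) => p.
rewrite {1}(mpolyE p) (big_morph phi phiD phi0) /peval mevalE.
apply: eq_bigr => mu _; rewrite phiZ; congr (_ * _).
rewrite mpolyXE_id (big_morph phi phiM phi1); apply: eq_bigr => i _.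
rewrite mxE -/(pvar i); elim: (mu i) => [|k IH]; first by rewrite !expr0.
by rewrite !exprS phiM IH.
Qed.

Lemma deg_leW d e p : (d <= e)%N -> deg_le d p -> deg_le e p.
Proof. by move=> de /leq_trans; apply. Qed.

Lemma deg_leM d e p q : deg_le d p -> deg_le e q -> deg_le (d + e) (p * q).
Proof.
rewrite /deg_le => dp eq; have [->|/eqP p0] := eqVneq p 0.
  by rewrite mul0r msize0.
have [->|/eqP q0] := eqVneq q 0; first by rewrite mulr0 msize0.
by rewrite msizeM; [|exact/eqP|exact/eqP]; rewrite -ltnS;
  case: (mmeasure _ p) dp; case: (mmeasure _ q) eq; lia.
Qed.

Lemma deg_leC d c : deg_le d (mpolyC n c : {mpoly R[n]}).
Proof. by rewrite /deg_le msizeC; case: (c != 0). Qed.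

Lemma trunc_quad_moduleW g d e f : (d <= e)%N ->
  trunc_quad_module d g f -> trunc_quad_module e g f.
Proof.
move=> de [s [ds ->]]; exists s; split=> // i p /ds; exact: deg_leW.
Qed.

Lemma trunc_quad_moduleD g d f q :
  trunc_quad_module d g f -> trunc_quad_module d g q -> trunc_quad_module d g (f + q).
Proof.
move=> [s [ds ->]] [t [dt ->]]; exists (fun i => s i ++ t i); split.
  by move=> i p; rewrite mem_cat => /orP[/ds|/dt].
by rewrite -big_split /=; apply: eq_bigr => i _; rewrite big_cat.
Qed.

Lemma trunc_quad_module_sqrM g d e p f : deg_le e p ->
  trunc_quad_module d g f -> trunc_quad_module (d + e.*2) g (p ^+ 2 * f).
Proof.
move=> ep [s [ds ->]]; exists (fun i => [seq p * q | q <- s i]); split.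
  move=> i _ /mapP[q /ds dq ->]; rewrite exprMn -mulrA addnC -addnn.
  by apply: deg_leM => //; rewrite expr2; exact: deg_leM.
rewrite mulr_sumr; apply: eq_bigr => i _; rewrite big_map mulr_sumr.
by apply: eq_bigr => q _; rewrite exprMn mulrA.
Qed.

Lemma trunc_quad_module1 g : trunc_quad_module 0 g 1.
Proof.
exists (fun i => if i == ord0 then [:: 1] else [::]); split.
  move=> i p; case: eqP => // ->; rewrite inE => /eqP ->.
  by rewrite /with_one unlift_none /= expr1n mulr1 -mpolyC1 deg_leC.
rewrite (bigD1 ord0)//= big_seq1 big1; last by move=> i /negPf ->; rewrite big_nil.
by rewrite /with_one unlift_none /= expr1n mulr1 addr0.
Qed.

Lemma quad_module_gen g i : quad_module g (g i).
Proof.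
exists (mmeasure (@mdeg n) (g i)) => //.
exists (fun j => if j == lift ord0 i then [:: 1] else [::]); split.
  move=> j p; case: eqP => // ->; rewrite inE => /eqP ->.
  by rewrite /with_one liftK /= expr1n mul1r /deg_le leqnSn.
rewrite (bigD1 (lift ord0 i))//= eqxx big_seq1 big1; last by move=> j /negPf ->; rewrite big_nil.
by rewrite /with_one liftK /= expr1n mul1r addr0.
Qed.

Lemma quad_module_qmodule g : qmodule (quad_module g).
Proof.
split.
- by exists 0%N => //; exact: trunc_quad_module1.
- move=> f q [d _ df] [e _ eq]; exists (maxn d e) => //.
  by apply: trunc_quad_moduleD; [apply: trunc_quad_moduleW df|apply: trunc_quad_moduleW eq];
    rewrite ?leq_maxl ?leq_maxr.
- move=> p f [d _ df]; exists (d + (mmeasure (@mdeg n) p).*2)%N => //.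
  by apply: trunc_quad_module_sqrM => //; rewrite /deg_le leqnSn.
Qed.

Lemma quad_module_ge0 g f x : quad_module g f -> basic_semialg g x -> 0 <= peval f x.
Proof.
move=> [d _ [s [_ ->]]] gx; rewrite peval_sum; apply: sumr_ge0 => i _.
rewrite peval_sum; apply: sumr_ge0 => p _; rewrite pevalM pevalXn mulr_ge0 ?sqr_ge0//.
by rewrite /with_one; case: unliftP => [j|] _ /=; [exact: gx|rewrite peval1].
Qed.

(** The characters of the polynomial ring are the evaluations at points, and those
that are nonnegative on the quadratic module are the points of S. *)
Theorem putinar g f : quad_archimedean g ->
  (forall x, basic_semialg g x -> 0 < peval f x) -> quad_module g f.
Proof.
move=> garch fpos; apply: archimedean_positivstellensatz.
- exact: quad_module_qmodule.
- by move=> p; have [N [_ _ H]] := garch p; exists N.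
- move=> phi /character_peval[x phix] phi0; rewrite phix; apply: fpos => i.
  by rewrite -phix; apply: phi0; exact: quad_module_gen.
Qed.

End QuadModule.

(** * Families of polynomials and uniform membership *)

Section Families.
Context {R : realType} {n m : nat} (g : 'I_m -> {mpoly R[n]}).
Context {T : Type} (F : set_system T) {FF : Filter F}.
Implicit Types (f h p : T -> {mpoly R[n]}) (c : T -> R).

(** One degree for all members far enough along the filter.  Such families in turn
form a quadratic module in the ring of families. *)
Definition umod f := exists d, \forall t \near F, trunc_quad_module d g (f t).

Definition bscal c := exists C : R, \forall t \near F, `|c t| <= C.

(** Families with bounded degree and bounded coefficients.  They are generated as a
ring, which gives an induction principle that needs no coefficients. *)
Inductive bfam : (T -> {mpoly R[n]}) -> Prop :=
| bfam_scal c : bscal c -> bfam (fun t => mpolyC n (c t))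
| bfam_var i : bfam (fun _ => pvar i)
| bfamD f h : bfam f -> bfam h -> bfam (fun t => f t + h t)
| bfamM f h : bfam f -> bfam h -> bfam (fun t => f t * h t).

Definition bdeg f := exists e, \forall t \near F, deg_le e (f t).

Lemma bscal_cst (r : R) : bscal (fun=> r).
Proof. by exists `|r|; exact: nearW. Qed.

Lemma bscalD c1 c2 : bscal c1 -> bscal c2 -> bscal (fun t => c1 t + c2 t).
Proof.
move=> [C1 B1] [C2 B2]; exists (C1 + C2); apply: filterS2 B1 B2 => t b1 b2.
by rewrite (le_trans (ler_normD _ _))// lerD.
Qed.

Lemma bscalM c1 c2 : bscal c1 -> bscal c2 -> bscal (fun t => c1 t * c2 t).
Proof.
move=> [C1 B1] [C2 B2]; exists (C1 * C2); apply: filterS2 B1 B2 => t b1 b2.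
by rewrite normrM ler_pM.
Qed.

Lemma bfam_cst_scal (r : R) : bfam (fun=> mpolyC n r).
Proof. exact/bfam_scal/bscal_cst. Qed.

Lemma bfam1 : bfam (fun=> 1).
Proof. by rewrite -mpolyC1; exact: bfam_cst_scal. Qed.

Lemma bfam0 : bfam (fun=> 0).
Proof. by rewrite -mpolyC0; exact: bfam_cst_scal. Qed.

Lemma bfamZ c f : bscal c -> bfam f -> bfam (fun t => c t *: f t).
Proof.
move=> bc bf; have -> : (fun t => c t *: f t) = (fun t => mpolyC n (c t) * f t).
  by apply/funext => t; rewrite mul_mpolyC.
by apply: bfamM => //; exact: bfam_scal.
Qed.

Lemma bfamN f : bfam f -> bfam (fun t => - f t).
Proof.
move=> bf; have -> : (fun t => - f t) = (fun t => -1 *: f t).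
  by apply/funext => t; rewrite scaleN1r.
by apply: bfamZ => //; exact: bscal_cst.
Qed.

Lemma bfamB f h : bfam f -> bfam h -> bfam (fun t => f t - h t).
Proof. by move=> bf bh; apply: bfamD => //; exact: bfamN. Qed.

Lemma bfamX f k : bfam f -> bfam (fun t => f t ^+ k).
Proof.
move=> bf; elim: k => [|k IH]; first exact: bfam1.
have -> : (fun t => f t ^+ k.+1) = (fun t => f t * f t ^+ k).
  by apply/funext => t; rewrite exprS.
exact: bfamM.
Qed.

Lemma bfam_sum I (r : seq I) (P : pred I) (f : I -> T -> {mpoly R[n]}) :
  (forall i, P i -> bfam (f i)) -> bfam (fun t => \sum_(i <- r | P i) f i t).
Proof.
move=> bf; elim: r => [|i r IH].
  by under eq_fun do rewrite big_nil; exact: bfam0.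
under eq_fun do rewrite big_cons.
by case Pi: (P i) => //; apply: bfamD => //; exact: bf.
Qed.

Lemma bfam_prod I (r : seq I) (P : pred I) (f : I -> T -> {mpoly R[n]}) :
  (forall i, P i -> bfam (f i)) -> bfam (fun t => \prod_(i <- r | P i) f i t).
Proof.
move=> bf; elim: r => [|i r IH].
  by under eq_fun do rewrite big_nil; exact: bfam1.
under eq_fun do rewrite big_cons.
by case Pi: (P i) => //; apply: bfamM => //; exact: bf.
Qed.

Lemma bfam_cst (q : {mpoly R[n]}) : bfam (fun=> q).
Proof.
rewrite (mpolyE q); apply: (@bfam_sum _ _ _ (fun mu _ => mcoeff mu q *: mpolyX R mu)).
move=> mu _; apply: (@bfamZ (fun=> mcoeff mu q)); first exact: bscal_cst.
rewrite mpolyXE_id; apply: (@bfam_prod _ _ _ (fun i _ => pvar i ^+ mu i)).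
by move=> i _; apply: bfamX; exact: bfam_var.
Qed.

Lemma bfam_bdeg f : bfam f -> bdeg f.
Proof.
elim=> [c _|i|f1 f2 _ [d1 D1] _ [d2 D2]|f1 f2 _ [d1 D1] _ [d2 D2]].
- by exists 0%N; apply: nearW => t; exact: deg_leC.
- by exists 1%N; apply: nearW => t; rewrite /deg_le msizeX mdeg1.
- exists (maxn d1 d2); apply: filterS2 D1 D2 => t; rewrite /deg_le => e1 e2.
  by rewrite (leq_trans (msizeD_le _ _))// geq_max (leq_trans e1) ?ltnS ?leq_maxl//
    (leq_trans e2)// ltnS leq_maxr.
- by exists (d1 + d2)%N; apply: filterS2 D1 D2 => t; exact: deg_leM.
Qed.

Lemma bfam_normal_form f : bfam f ->
  exists (I : finType) (mu : I -> multinom n) (c : I -> T -> R),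
    (forall i, bscal (c i)) /\ forall t, f t = \sum_i c i t *: mpolyX R (mu i).
Proof.
elim=> [c bc|i|f1 f2 _ [I [mu [c [bc e1]]]] _ [J [nu [d [bd e2]]]]|
        f1 f2 _ [I [mu [c [bc e1]]]] _ [J [nu [d [bd e2]]]]].
- exists unit, (fun=> mnm0), (fun=> c); split=> // t.
  by rewrite (big_pred1 tt) /= ?mpolyX0 ?alg_mpolyC//; case.
- exists unit, (fun=> mnm1 i), (fun _ _ => 1); split=> [_|t]; first exact: bscal_cst.
  by rewrite (big_pred1 tt) ?scale1r//; case.
- exists (I + J)%type, (fun u => match u with inl i => mu i | inr j => nu j end),
    (fun u => match u with inl i => c i | inr j => d j end).
  by split=> [[]|t]//; rewrite big_sumType /= e1 e2.
- exists (I * J)%type, (fun u => mnm_add (mu u.1) (nu u.2)), (fun u t => c u.1 t * d u.2 t).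
  split=> [u|t]; first exact: bscalM.
  rewrite e1 e2 big_distrlr /= pair_bigA /=; apply: eq_bigr => u _.
  by rewrite mpolyXD -scalerAl -scalerAr scalerA.
Qed.

Lemma bfam_bounded (D : set 'rV[R]_n) (B : R) f : (forall x i, D x -> `|x 0 i| <= B) ->
  bfam f -> exists2 C : R, 0 < C &
    \forall t \near F, forall x, D x -> `|peval (f t) x| <= C.
Proof.
move=> DB; elim=> [c [C bc]|i|f1 f2 _ [C1 C10 B1] _ [C2 C20 B2]|f1 f2 _ [C1 C10 B1] _ [C2 C20 B2]].
- exists (`|C| + 1); first by rewrite ltr_wpDl.
  apply: filterS bc => t ct x _; rewrite pevalC (le_trans ct)//.
  by rewrite (le_trans (ler_norm C))// lerDl.
- exists (`|B| + 1); first by rewrite ltr_wpDl.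
  apply: nearW => t x Dx; rewrite peval_var (le_trans (DB _ _ Dx))//.
  by rewrite (le_trans (ler_norm B))// lerDl.
- exists (C1 + C2); first exact: addr_gt0.
  apply: filterS2 B1 B2 => t b1 b2 x Dx.
  by rewrite pevalD (le_trans (ler_normD _ _))// lerD ?b1 ?b2.
- exists (C1 * C2); first exact: mulr_gt0.
  apply: filterS2 B1 B2 => t b1 b2 x Dx.
  by rewrite pevalM normrM ler_pM// ?b1 ?b2.
Qed.

Lemma bfam_scal_peval f (y : T -> 'rV[R]_n) : (forall i, bscal (fun t => y t 0 i)) ->
  bfam f -> bscal (fun t => peval (f t) (y t)).
Proof.
move=> y_bounded; elim=> [c bc|i|f1 f2 _ b1 _ b2|f1 f2 _ b1 _ b2].
- by under eq_fun do rewrite pevalC.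
- by under eq_fun do rewrite peval_var; exact: y_bounded.
- by under eq_fun do rewrite pevalD; exact: bscalD.
- by under eq_fun do rewrite pevalM; exact: bscalM.
Qed.

Lemma umod_near f h : (\forall t \near F, f t = h t) -> umod f -> umod h.
Proof. by move=> fh [d df]; exists d; apply: filterS2 fh df => t ->. Qed.

Lemma umod_eq f h : (forall t, f t = h t) -> umod f -> umod h.
Proof. by move=> fh; apply: umod_near; exact: nearW. Qed.

Lemma umodD f h : umod f -> umod h -> umod (fun t => f t + h t).
Proof.
move=> [d df] [e eh]; exists (maxn d e); apply: filterS2 df eh => t df eh.
by apply: trunc_quad_moduleD; [apply: trunc_quad_moduleW df|apply: trunc_quad_moduleW eh];
  rewrite ?leq_maxl ?leq_maxr.
Qed.

Lemma umod_sqrM p f : bdeg p -> umod f -> umod (fun t => p t ^+ 2 * f t).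
Proof.
move=> [e ep] [d df]; exists (d + e.*2)%N; apply: filterS2 ep df => t.
exact: trunc_quad_module_sqrM.
Qed.

Lemma umodZ c f : (\forall t \near F, 0 <= c t) -> umod f -> umod (fun t => c t *: f t).
Proof.
move=> c0 [d df]; exists (d + 0.*2)%N; apply: filterS2 c0 df => t c0 df.
rewrite -(sqr_sqrtr c0) -mul_mpolyC rmorphXn.
by apply: trunc_quad_module_sqrM => //; exact: deg_leC.
Qed.

Lemma umod1 : umod (fun=> 1).
Proof. by exists 0%N; apply: nearW => t; exact: trunc_quad_module1. Qed.

Lemma umod_sqr p : bdeg p -> umod (fun t => p t ^+ 2).
Proof.
by move=> bp; apply: umod_eq (umod_sqrM bp umod1) => t; rewrite mulr1.
Qed.

Lemma umod0 : umod (fun=> 0).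
Proof.
apply: umod_eq (umodZ (c := fun=> 0) _ umod1); last exact: nearW.
by move=> t; rewrite scale0r.
Qed.

Lemma umod_sum I (r : seq I) (P : pred I) (f : I -> T -> {mpoly R[n]}) :
  (forall i, P i -> umod (f i)) -> umod (fun t => \sum_(i <- r | P i) f i t).
Proof.
move=> uf; elim: r => [|i r IH].
  by under eq_fun do rewrite big_nil; exact: umod0.
under eq_fun do rewrite big_cons.
by case Pi: (P i) => //; apply: umodD => //; exact: uf.
Qed.

Lemma umod_cst (q : {mpoly R[n]}) : quad_module g q -> umod (fun=> q).
Proof. by move=> [d _ dq]; exists d; exact: nearW. Qed.

Section Archimedean.
Hypothesis garch : quad_archimedean g.

(** Rounding the coefficients to a finite grid leaves finitely many positive
polynomials, each of which has a degree by Putinar's theorem.  The rounding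
error is absorbed by the constant delta / 2, since N + X^mu and N - X^mu are in
the module for some N. *)
Lemma umod_pos f (delta : R) : bfam f -> 0 < delta ->
  (\forall t \near F, forall x, basic_semialg g x -> delta <= peval (f t) x) ->
  umod f.
Proof.
move=> /bfam_normal_form[I [mu [c [bc fE]]]] delta0 fpos.
have /choice[N NP] i : exists N : R, [/\ 0 <= N,
    quad_module g (mpolyC n N + mpolyX R (mu i)) & quad_module g (mpolyC n N - mpolyX R (mu i))].
  have [N [_ H1 H2]] := garch (mpolyX R (mu i)).
  by exists N%:R; rewrite mpolyC_nat; split.
have /choice[C CP] : forall i, exists C, \forall t \near F, `|c i t| <= C by [].
pose C0 := \sum_i `|C i|.
have cC : \forall t \near F, forall i, `|c i t| <= C0.
  apply: filter_forall => i; apply: filterS (CP i) => t ct.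
  rewrite (le_trans ct)// (le_trans (ler_norm _))// /C0 (bigD1 i)//= lerDl.
  exact: sumr_ge0.
have N0 : 0 <= \sum_i N i by apply: sumr_ge0 => i _; case: (NP i).
(* The mesh is so small that rounding changes values on S by at most delta / 4. *)
pose eta := delta / 4 / (1 + \sum_i N i).
have eta0 : 0 < eta by rewrite !divr_gt0// ltr_wpDr.
have etaN : eta * (\sum_i N i) <= delta / 4.
  rewrite /eta -mulrA ler_piMr ?divr_ge0 ?(ltW delta0)//.
  by rewrite mulrC ler_pdivrMr ?mul1r ?lerDr// ltr_wpDr.
pose L := (Num.truncn (2 * C0 / eta)).+1.
pose gr (k : 'I_L) : R := k%:R * eta - C0.
have C00 : 0 <= C0 by apply: sumr_ge0.
have round r : `|r| <= C0 -> exists k : 'I_L, `|r - gr k| <= eta.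
  rewrite ler_norml => /andP[rl ru].
  have s0 : 0 <= (r + C0) / eta by rewrite divr_ge0 ?(ltW eta0)//; lra.
  have /andP[k1 k2] := truncn_itv s0.
  have kL : (Num.truncn ((r + C0) / eta) < L)%N.
    rewrite ltnS; apply: le_truncn.
    by rewrite ler_pM2r ?invr_gt0//; lra.
  exists (Ordinal kL); rewrite /gr /=.
  rewrite ler_pdivlMr// in k1; rewrite ltr_pdivrMr// -natr1 mulrDl mul1r in k2.
  by rewrite ler_norml; lra.
pose pk (k : {ffun I -> 'I_L}) := \sum_i gr (k i) *: mpolyX R (mu i) - mpolyC n (delta / 2).
have /choice[d dP] k : exists d,
    (forall x, basic_semialg g x -> 0 < peval (pk k) x) -> trunc_quad_module d g (pk k).
  have [kpos|kneg] := pselect (forall x, basic_semialg g x -> 0 < peval (pk k) x).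
    by have [d _ dk] := putinar garch kpos; exists d.
  by exists 0%N.
have upk : forall i, umod (fun=> mpolyC n (N i) + mpolyX R (mu i)).
  by move=> i; apply: umod_cst; case: (NP i).
have upk' : forall i, umod (fun=> mpolyC n (N i) - mpolyX R (mu i)).
  by move=> i; apply: umod_cst; case: (NP i).
have /choice[K KP] : forall t, exists k : {ffun I -> 'I_L},
    (forall i, `|c i t| <= C0) -> forall i, `|c i t - gr (k i)| <= eta.
  move=> t; have [tC|] := pselect (forall i, `|c i t| <= C0); last first.
    by move=> ntC; exists [ffun=> ord0].
  have /choice[k kP] := fun i => round _ (tC i).
  by exists [ffun i => k i] => _ i; rewrite ffunE.
pose r i t := c i t - gr (K t i).
have rP : \forall t \near F, forall i, `|r i t| <= eta.
  by apply: filterS cC => t tC i; exact: KP.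
have SN x i : basic_semialg g x -> `|peval (mpolyX R (mu i)) x| <= N i.
  move=> gx; case: (NP i) => _ /quad_module_ge0/(_ gx) + /quad_module_ge0/(_ gx).
  by rewrite !peval_simp ler_norml => h1 h2; lra.
have u1 : umod (fun t => pk (K t)).
  exists (\max_k d k)%N; apply: filterS2 fpos rP => t ft rt.
  apply: (@trunc_quad_moduleW _ _ _ _ (d (K t))); first exact: leq_bigmax.
  apply: dP => x gx; have := ft _ gx.
  have -> : f t = pk (K t) + (mpolyC n (delta / 2) + \sum_i r i t *: mpolyX R (mu i)).
    rewrite fE /pk addrA subrK -big_split /=; apply: eq_bigr => i _.
    by rewrite -scalerDl /r addrC subrK.
  rewrite !pevalD pevalC pevalN pevalC !peval_sum => H.
  suff S4 : \sum_i peval (r i t *: mpolyX R (mu i)) x <= delta / 4.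
    by lra.
  apply: le_trans etaN; rewrite mulr_sumr; apply: ler_sum => i _.
  rewrite pevalZ (le_trans (ler_norm _))// normrM ler_pM ?rt//; exact: SN.
have u2 : umod (fun t => (mpolyC n (delta / 2) - eta *: \sum_i mpolyC n (N i)) +
   \sum_i (((eta + r i t) / 2) *: (mpolyC n (N i) + mpolyX R (mu i)) +
           ((eta - r i t) / 2) *: (mpolyC n (N i) - mpolyX R (mu i)))).
  apply: umodD.
    apply: umod_eq (umodZ (c := fun=> delta / 2 - eta * \sum_i N i) _ umod1).
      move=> t; rewrite -mul_mpolyC mulr1 mpolyCB -mul_mpolyC. rewrite [X in _ - X]mpolyCM.
      by rewrite (big_morph (@mpolyC n R) (@mpolyCD n R) (@mpolyC0 n R)).
    by apply: nearW => t; lra.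
  apply: umod_sum => i _; apply: umodD; apply: umodZ => //.
    by apply: filterS rP => t /(_ i); rewrite ler_norml; lra.
  by apply: filterS rP => t /(_ i); rewrite ler_norml; lra.
apply: umod_eq (umodD u1 u2) => t.
have -> : \sum_i (((eta + r i t) / 2) *: (mpolyC n (N i) + mpolyX R (mu i)) +
    ((eta - r i t) / 2) *: (mpolyC n (N i) - mpolyX R (mu i))) =
    eta *: (\sum_i mpolyC n (N i)) + \sum_i r i t *: mpolyX R (mu i).
  rewrite scaler_sumr -big_split; apply: eq_bigr => i _ /=.
  rewrite !scalerDr !scalerN addrACA -scalerDl -scalerBl.
  by congr (_ *: _ + _ *: _); lra.
rewrite fE /pk; transitivity (\sum_i gr (K t i) *: mpolyX R (mu i) +
   \sum_i r i t *: mpolyX R (mu i)); first ring.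
rewrite -big_split; apply: eq_bigr => i _ /=.
by rewrite -scalerDl /r addrC subrK.
Qed.

End Archimedean.
End Families.

(** * Taylor expansion of families *)

Section SquaredNorm.
Context {R : realType} {n : nat}.
Implicit Types x v : 'rV[R]_n.

Definition sqn v : R := \sum_i v 0 i ^+ 2.

Lemma coord_le v i : `|v 0 i| <= `|v|.
Proof.
by rewrite [leRHS]/Num.Def.normr /= mx_normrE; apply: (le_bigmax _ (fun ij => `|v ij.1 ij.2|) (0, i)).
Qed.

Lemma norm_le_coord v (C : R) : 0 <= C -> (forall i, `|v 0 i| <= C) -> `|v| <= C.
Proof.
move=> C0 vC; rewrite [leLHS]/Num.Def.normr /= mx_normrE; apply/bigmax_leP; split=> // -[i j] _ /=.
by rewrite (ord1 i).
Qed.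

Lemma sqn_ge0 v : 0 <= sqn v.
Proof. by apply: sumr_ge0 => i _; exact: sqr_ge0. Qed.

Lemma coord_sqr_le v i : v 0 i ^+ 2 <= sqn v.
Proof. by rewrite /sqn (bigD1 i)//= lerDl sumr_ge0// => j _; exact: sqr_ge0. Qed.

Lemma norm_sqr_le v : `|v| ^+ 2 <= sqn v.
Proof.
rewrite -[leRHS]sqr_sqrtr ?sqn_ge0// lerXn2r ?nnegrE ?sqrtr_ge0//.
apply: norm_le_coord; first exact: sqrtr_ge0.
by move=> i; rewrite -sqrtr_sqr ler_sqrt ?sqn_ge0// coord_sqr_le.
Qed.

Lemma sqn_eq0 v : (sqn v == 0) = (v == 0).
Proof.
apply/eqP/eqP => [v0|->]; last first.
  by rewrite /sqn big1// => i _; rewrite mxE expr0n.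
apply/eqP; rewrite -normr_eq0 -sqrf_eq0.
by rewrite eq_le sqr_ge0 andbT -v0 norm_sqr_le.
Qed.

Lemma sqn_gt0 v : (0 < sqn v) = (v != 0).
Proof. by rewrite lt_def sqn_eq0 sqn_ge0 andbT. Qed.

Lemma sqnZ c v : sqn (c *: v) = c ^+ 2 * sqn v.
Proof. by rewrite /sqn mulr_sumr; apply: eq_bigr => i _; rewrite mxE exprMn. Qed.

End SquaredNorm.

Section Taylor.
Context {R : realType} {n : nat}.
Context {T : Type} (F : set_system T) {FF : Filter F}.
Implicit Types (p : {mpoly R[n]}) (f : T -> {mpoly R[n]}) (x : 'rV[R]_n).

Definition dvar (y : 'rV[R]_n) i : {mpoly R[n]} := pvar i - mpolyC n (y 0 i).

Lemma peval_dvar y i x : peval (dvar y i) x = (x - y) 0 i.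
Proof. by rewrite !peval_simp !mxE. Qed.

Lemma peval_dvar0 y i : peval (dvar y i) y = 0.
Proof. by rewrite peval_dvar subrr mxE. Qed.

Lemma mderiv_dvar y i j : mderiv j (dvar y i) = mpolyC n (i == j)%:R.
Proof.
rewrite /dvar mderivB mderivC subr0 mderivX mnmE.
have [->|_] := eqVneq i j; last by rewrite scale0r mpolyC0.
rewrite -mul_mpolyC -[RHS]mulr1; congr (_ * _).
have -> : mnm_sub (mnm1 j) (mnm1 j) = mnm0 :> multinom n; last by rewrite mpolyX0.
by apply/mnmP => k; rewrite mnmBE mnm0E subnn.
Qed.

Variable y : T -> 'rV[R]_n.
Hypothesis y_bounded : forall i, bscal F (fun t => y t 0 i).

Lemma bfam_dvar i : bfam F (fun t => dvar (y t) i).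
Proof. by apply: bfamB; [exact: bfam_var|exact/bfam_scal/y_bounded]. Qed.

(** Division by the X_i - y_i, with quotients that stay bounded when y moves. *)
Lemma hadamard f : bfam F f -> exists B : 'I_n -> T -> {mpoly R[n]},
  (forall i, bfam F (B i)) /\
  forall t, f t = mpolyC n (peval (f t) (y t)) + \sum_i B i t * dvar (y t) i.
Proof.
elim=> [c bc|j|f1 f2 bf1 [B1 [b1 e1]] bf2 [B2 [b2 e2]]|f1 f2 bf1 [B1 [b1 e1]] bf2 [B2 [b2 e2]]].
- exists (fun _ _ => 0); split=> [_|t]; first exact: bfam0.
  by rewrite pevalC big1 ?addr0// => i _; rewrite mul0r.
- exists (fun i _ => (i == j)%:R); split=> [i|t].
    by case: (i == j); [exact: bfam1|exact: bfam0].
  rewrite peval_var (bigD1 j)//= eqxx mul1r big1 ?addr0; first by rewrite /dvar addrC subrK.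
  by move=> i /negPf ->; rewrite mul0r.
- exists (fun i t => B1 i t + B2 i t); split=> [i|t]; first exact: bfamD.
  rewrite pevalD mpolyCD {1}e1 {1}e2 addrACA -big_split; congr (_ + _).
  by apply: eq_bigr => i _; rewrite mulrDl.
- exists (fun i t => B1 i t * f2 t + mpolyC n (peval (f1 t) (y t)) * B2 i t); split=> [i|t].
    apply: bfamD; apply: bfamM => //.
    by apply: bfam_scal; exact: bfam_scal_peval.
  have -> : \sum_i (B1 i t * f2 t + mpolyC n (peval (f1 t) (y t)) * B2 i t) * dvar (y t) i =
      (\sum_i B1 i t * dvar (y t) i) * f2 t +
      mpolyC n (peval (f1 t) (y t)) * \sum_i B2 i t * dvar (y t) i.
    rewrite mulr_suml mulr_sumr -big_split; apply: eq_bigr => i _ /=; ring.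
  have E1 : \sum_i B1 i t * dvar (y t) i = f1 t - mpolyC n (peval (f1 t) (y t)).
    by rewrite {1}(e1 t) addrC addKr.
  have E2 : \sum_i B2 i t * dvar (y t) i = f2 t - mpolyC n (peval (f2 t) (y t)).
    by rewrite {1}(e2 t) addrC addKr.
  by rewrite E1 E2 pevalM mpolyCM; ring.
Qed.

Lemma hadamard_mderiv p c (B : 'I_n -> {mpoly R[n]}) x j :
  p = mpolyC n c + \sum_i B i * dvar x i -> peval (mderiv j p) x = peval (B j) x.
Proof.
move=> ->; rewrite mderivD mderivC add0r.
rewrite (big_morph (mderiv j) (mderivD j) (mderiv0 _ j)) peval_sum.
rewrite (bigD1 j)//= big1 ?addr0.
  by rewrite mderivM mderiv_dvar eqxx pevalD !pevalM pevalC peval_dvar0 mulr0 add0r mulr1.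
move=> i /negPf ij.
by rewrite mderivM mderiv_dvar ij pevalD !pevalM pevalC peval_dvar0 !mulr0 addr0.
Qed.

(** Hadamard's lemma applied twice.  Only the symmetric part of the matrix A at y
is determined by f: it is half the Hessian. *)
Lemma taylor2 f : bfam F f -> exists A : 'I_n -> 'I_n -> T -> {mpoly R[n]},
  [/\ forall i j, bfam F (A i j),
   forall t, f t = mpolyC n (peval (f t) (y t)) +
     \sum_i mpolyC n (peval (mderiv i (f t)) (y t)) * dvar (y t) i +
     \sum_i \sum_j A i j t * dvar (y t) i * dvar (y t) j &
   forall t i j, peval (A i j t) (y t) + peval (A j i t) (y t) =
     peval (mderiv j (mderiv i (f t))) (y t)].
Proof.
move=> bf; have [B [bB eB]] := hadamard bf.
have /choice[A AP] i := hadamard (bB i).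
exists A; split=> [i j|t|t i j]; first by case: (AP i).
  rewrite {1}(eB t) -addrA; congr (_ + _); rewrite -big_split; apply: eq_bigr => i _ /=.
  rewrite (hadamard_mderiv _ (eB t)); have [_ eA] := AP i; rewrite {1}(eA t) mulrDl.
  by congr (_ + _); rewrite mulr_suml; apply: eq_bigr => j _; rewrite mulrAC.
have -> : mderiv i (f t) = B i t + \sum_k mderiv i (B k t) * dvar (y t) k.
  rewrite {1}(eB t) mderivD mderivC add0r.
  rewrite (big_morph (mderiv i) (mderivD i) (mderiv0 _ i)).
  under eq_bigr do rewrite mderivM mderiv_dvar addrC.
  rewrite big_split (bigD1 i)//= eqxx mpolyC1 mulr1 big1 ?addr0// => k /negPf ->.
  by rewrite mpolyC0 mulr0.
rewrite mderivD pevalD; congr (_ + _).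
  by have [_ eA] := AP i; rewrite (hadamard_mderiv _ (eA t)).
have := @hadamard_mderiv (\sum_k mderiv i (B k t) * dvar (y t) k) 0
  (fun k => mderiv i (B k t)) (y t) j; rewrite mpolyC0 add0r => /(_ erefl) ->.
by have [_ eA] := AP j; rewrite (hadamard_mderiv _ (eA t)).
Qed.

Lemma bfam_lipschitz (D : set 'rV[R]_n) (B : R) f : (forall x i, D x -> `|x 0 i| <= B) ->
  bfam F f -> exists2 C : R, 0 < C &
    \forall t \near F, forall x, D x -> `|peval (f t) x - peval (f t) (y t)| <= C * `|x - y t|.
Proof.
move=> DB bf; have [A [bA eA]] := hadamard bf.
have /choice[C CP] i : exists C : R, 0 < C /\
    \forall t \near F, forall x, D x -> `|peval (A i t) x| <= C.
  by have [C C0 CP] := bfam_bounded DB (bA i); exists C.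
exists (1 + \sum_i C i); first by rewrite ltr_wpDr// sumr_ge0// => i _; case: (CP i) => /ltW.
have : \forall t \near F, forall i x, D x -> `|peval (A i t) x| <= C i.
  by apply: filter_forall => i; case: (CP i).
apply: filterS => t At x Dx; rewrite {1}(eA t) pevalD pevalC addrC addKr peval_sum.
rewrite (le_trans (ler_norm_sum _ _ _))// (@le_trans _ _ ((\sum_i C i) * `|x - y t|))//; last first.
  by rewrite ler_wpM2r// lerDr.
rewrite mulr_suml; apply: ler_sum => i _.
by rewrite pevalM peval_dvar normrM ler_pM// ?At// coord_le.
Qed.

End Taylor.

(** * Elementary inequalities and positive semidefinite matrices *)

Section Inequalities.
Context {R : realType}.
Implicit Types (v C eps : R).

(** Combine 1 + k v <= (1 + v)^k with (1 - v^2)^k <= 1.  This one inequality bounds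
the penalty polynomials as well as the cut-off polynomials. *)
Lemma bernoulli_decay k v : -1 <= v <= 1 -> (1 - v) ^+ k * (1 + k%:R * v) <= 1.
Proof.
move=> /andP[vl vu].
have bern : 1 + k%:R * v <= (1 + v) ^+ k.
  elim: k => [|k IH]; first by rewrite mul0r addr0 expr0.
  rewrite exprS; apply: le_trans (ler_wpM2l _ IH); last by lra.
  have : 0 <= k%:R * v ^+ 2 by rewrite mulr_ge0// sqr_ge0.
  by rewrite -natr1 => h; nra.
have h1 : 0 <= (1 - v) ^+ k by apply: exprn_ge0; lra.
apply: le_trans (ler_wpM2l h1 bern) _.
rewrite -exprMn; have -> : (1 - v) * (1 + v) = 1 - v ^+ 2 by ring.
have v2 : v ^+ 2 <= 1 by nra.
by apply: exprn_ile1; have := sqr_ge0 v; lra.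
Qed.

Lemma bernoulli_small v C eps : 0 < v <= 1 -> 0 < eps ->
  exists K, forall k, (K <= k)%N -> C * (1 - v) ^+ k <= eps.
Proof.
move=> /andP[v0 v1] e0; exists (Num.truncn (`|C| / (eps * v))).+1 => k Kk.
have kb : `|C| / (eps * v) < k%:R.
  by apply: lt_le_trans (truncnS_gt _) _; rewrite ler_nat.
rewrite ltr_pdivrMr ?mulr_gt0// in kb.
have hk : 0 <= (1 - v) ^+ k by apply: exprn_ge0; lra.
have hv : -1 <= v <= 1 by lra.
have h := @bernoulli_decay k v hv.
have kv : 0 < 1 + k%:R * v by rewrite ltr_wpDr// mulr_ge0// ltW.
have : (1 - v) ^+ k <= (1 + k%:R * v)^-1 by rewrite -[X in _ <= X]mul1r ler_pdivlMr.
move=> h2; apply: le_trans (_ : `|C| * (1 - v) ^+ k <= _).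
  by rewrite ler_wpM2r// ler_norm.
apply: le_trans (ler_wpM2l (normr_ge0 C) h2) _.
by rewrite ler_pdivrMr//; nra.
Qed.

End Inequalities.

Section Gram.
Context {R : realType}.

Definition psd n (A : 'M[R]_n) := forall v : 'rV[R]_n, 0 <= (v *m A *m v^T) 0 0.

(** Completing the square with pivot a; if a = 0, semidefiniteness forces the rest
b of the first row to vanish. *)
Lemma psd_gram n (A : 'M[R]_n) : A^T = A -> psd A -> exists B : 'M[R]_n, A = B^T *m B.
Proof.
elim: n A => [|n IH] A; first by move=> _ _; exists 0; apply/matrixP => -[].
rewrite -[n.+1]/(1 + n)%N in A *; move=> Asym Apsd.
pose a := ulsubmx A 0 0; pose b := ursubmx A; pose D := drsubmx A.
have AE : A = block_mx a%:M b b^T D.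
  rewrite -[LHS]submxK; congr block_mx; first by rewrite [LHS]mx11_scalar.
  by rewrite /b trmx_ursub Asym.
have Dsym : D^T = D by rewrite /D trmx_drsub Asym.
have quad (s : R) (w : 'rV_n) : 0 <= s ^+ 2 * a + 2 * s * (b *m w^T) 0 0 + (w *m D *m w^T) 0 0.
  have := Apsd (row_mx s%:M w); rewrite AE mul_row_block tr_row_mx mul_row_col.
  rewrite !mulmxDl !mul_scalar_mx tr_scalar_mx !mul_mx_scalar.
  have -> : w *m b^T = ((b *m w^T) 0 0)%:M.
    by rewrite -[LHS]trmxK trmx_mul trmxK [X in X^T]mx11_scalar tr_scalar_mx.
  rewrite -scalemxAl !mxE /= !mulr1n => h; apply: le_trans h _.
  by rewrite le_eqVlt; apply/orP; left; apply/eqP; ring.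
have a0 : 0 <= a.
  by have := quad 1 0; rewrite trmx0 mulmx0 mul0mx mul0mx !mxE; lra.
(* With a = 0 the form is affine in s, so it can only stay nonnegative if its
slope vanishes. *)
have ab (w : 'rV_n) : a = 0 -> (b *m w^T) 0 0 = 0.
  move=> a00; set bw := (b *m w^T) 0 0; set wD := (w *m D *m w^T) 0 0.
  apply/eqP/contraT => bw0; have := quad (- (wD + 1) / (2 * bw)) w.
  rewrite -/bw -/wD a00 mulr0 add0r.
  have -> : 2 * (- (wD + 1) / (2 * bw)) * bw = - (wD + 1) by field.
  by lra.
have b0 : a = 0 -> b = 0.
  move=> a00; apply/rowP => j; have := ab (delta_mx 0 j) a00.
  by rewrite trmx_delta -colE !mxE.
pose D' := D - a^-1 *: (b^T *m b).
have [] := IH D'.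
- by rewrite /D' linearB linearZ /= trmx_mul trmxK Dsym.
- move=> w; rewrite /D' mulmxBr mulmxBl -scalemxAr -scalemxAl (mulmxA w b^T).
  have -> : w *m b^T = ((b *m w^T) 0 0)%:M.
    by rewrite -[LHS]trmxK trmx_mul trmxK [X in X^T]mx11_scalar tr_scalar_mx.
  rewrite mul_scalar_mx -scalemxAl; set bw := (b *m w^T) 0 0.
  set E := (X in 0 <= X).
  have -> : E = (w *m D *m w^T) 0 0 - a^-1 * (bw * bw).
    have mxB (X Y : 'M[R]_1) : (X - Y) 0 0 = X 0 0 - Y 0 0 by rewrite !mxE.
    have mxZ (c : R) (X : 'M[R]_1) : (c *: X) 0 0 = c * X 0 0 by rewrite mxE.
    by rewrite /E mxB mxZ mxZ.
  have [a00|an0] := eqVneq a 0.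
    rewrite a00 invr0 mul0r subr0; have := quad 0 w.
    by rewrite expr0n mul0r mulr0 mul0r !add0r.
  have := quad (- bw / a) w; rewrite -/bw => h; apply: le_trans h _.
  rewrite le_eqVlt; apply/orP; left; apply/eqP; field; exact: an0.
move=> B' B'E; exists (block_mx (Num.sqrt a)%:M ((Num.sqrt a)^-1 *: b) 0 B').
rewrite [LHS]AE tr_block_mx mulmx_block tr_scalar_mx trmx0 !mul0mx !mulmx0 !addr0.
rewrite !mul_mx_scalar.
have [a00|an0] := eqVneq a 0.
  have DE : D = B'^T *m B' by rewrite -B'E /D' a00 invr0 scale0r subr0.
  rewrite (b0 a00) a00 sqrtr0 invr0 -DE !scale0r trmx0 !mul0mx add0r.
  by rewrite raddf0 ?mul0mx ?scaler0.
have sa : Num.sqrt a != 0 by rewrite sqrtr_eq0 -ltNge lt_def an0.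
congr block_mx.
- by rewrite scale_scalar_mx -expr2 sqr_sqrtr.
- by rewrite mul_scalar_mx scalerA divff ?scale1r.
- by rewrite linearZ /= scalerA divff ?scale1r.
- have -> : ((Num.sqrt a)^-1 *: b)^T = (Num.sqrt a)^-1 *: b^T by rewrite linearZ.
  rewrite -B'E /D' -scalemxAl -scalemxAr scalerA -invfM -expr2 sqr_sqrtr//.
  by rewrite addrC subrK.
Qed.

Lemma psd_sos n (A : 'I_n -> 'I_n -> R) :
  (forall v : 'rV[R]_n, 0 <= \sum_i \sum_j A i j * v 0 i * v 0 j) ->
  exists B : 'I_n -> 'I_n -> R, forall (V : comAlgType R) (z : 'I_n -> V),
    \sum_i \sum_j A i j *: (z i * z j) = \sum_s (\sum_i B s i *: z i) ^+ 2.
Proof.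
move=> Apsd; pose M := \matrix_(i, j) ((A i j + A j i) / 2).
have half (V : comAlgType R) (z : 'I_n -> V) :
    \sum_i \sum_j A i j *: (z i * z j) = \sum_i \sum_j M i j *: (z i * z j).
  have sw : \sum_i \sum_j A i j *: (z i * z j) = \sum_i \sum_j A j i *: (z i * z j).
    by rewrite exchange_big; apply: eq_bigr => i _; apply: eq_bigr => j _; rewrite mulrC.
  have -> : \sum_i \sum_j A i j *: (z i * z j) =
     2^-1 *: (\sum_i \sum_j A i j *: (z i * z j) + \sum_i \sum_j A j i *: (z i * z j)).
    by rewrite -sw -mulr2n -[X in _ *: X]scaler_nat scalerA mulVf ?scale1r.
  rewrite -big_split scaler_sumr; apply: eq_bigr => i _ /=.
  rewrite -big_split scaler_sumr; apply: eq_bigr => j _ /=.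
  by rewrite -scalerDl scalerA mxE mulrC.
have [||B BE] := @psd_gram n M.
- by apply/matrixP => i j; rewrite !mxE addrC.
- move=> v; have := Apsd v.
  have := half R^o (fun i => v 0 i) => /= h.
  have -> : \sum_i \sum_j A i j * v 0 i * v 0 j = \sum_i \sum_j M i j *: (v 0 i * v 0 j : R^o).
    rewrite -h; apply: eq_bigr => i _; apply: eq_bigr => j _; exact: esym (mulrA _ _ _).
  move=> h'; apply: le_trans h' _; rewrite le_eqVlt; apply/orP; left; apply/eqP.
  rewrite mxE exchange_big; apply: eq_bigr => j _; rewrite mxE mulr_suml.
  apply: eq_bigr => i _; rewrite [v^T _ _]mxE.
  have rc (a b c : R) : a * (b * c) = b * a * c by ring.
  exact: rc.
exists (fun s i => B s i) => V z; rewrite half.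
under eq_bigr do under eq_bigr do rewrite BE mxE scaler_suml.
under eq_bigr do rewrite exchange_big /=.
rewrite exchange_big /=; apply: eq_bigr => s _.
rewrite expr2 mulr_suml; apply: eq_bigr => i _; rewrite mulr_sumr; apply: eq_bigr => j _.
by rewrite mxE -scalerAl -scalerAr scalerA.
Qed.

End Gram.

(** * Certificates for quadratic forms centred at a moving point *)

Section LocalGlobal.
Context {R : realType} {n m : nat} (g : 'I_m -> {mpoly R[n]}).
Hypothesis garch : quad_archimedean g.
Context {T : Type} (F : set_system T) {FF : Filter F}.
Implicit Types (f z b : T -> {mpoly R[n]}).
Local Notation S := (basic_semialg g).
Local Notation umod := (umod g F).
Local Notation bfam := (bfam F).

Lemma basic_semialg_bounded : exists B : R, forall (x : 'rV[R]_n) i, S x -> `|x 0 i| <= B.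
Proof.
have /choice[N NP] i : exists N : nat, forall x, S x -> `|x 0 i| <= N%:R.
  have [N [_ H1 H2]] := garch (pvar i); exists N => x Sx.
  move: (quad_module_ge0 H1 Sx) (quad_module_ge0 H2 Sx).
  by rewrite -mpolyC_nat !peval_simp ler_norml; lra.
exists (\sum_i (N i)%:R) => x i Sx; apply: le_trans (NP i x Sx) _.
by rewrite (bigD1 i)//= lerDl sumr_ge0.
Qed.

Lemma bfam_boundedS f : bfam f -> exists2 C : R, 0 < C &
  \forall t \near F, forall x, S x -> `|peval (f t) x| <= C.
Proof.
have [B SB] := basic_semialg_bounded; apply: bfam_bounded => // x i; exact: SB.
Qed.

Lemma umod_upper_bound b : bfam b -> exists2 C : R, 0 < C & umod (fun t => mpolyC n C - b t).
Proof.
move=> bb; have [C C0 bC] := bfam_boundedS bb.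
exists (C + 1); first by lra.
apply: (umod_pos garch (delta := 1)) => //.
  by apply: bfamB => //; exact: bfam_cst.
apply: filterS bC => t bt x Sx; have := bt x Sx.
by rewrite !peval_simp ler_norml; lra.
Qed.

Definition sqdist (y : 'rV[R]_n) : {mpoly R[n]} := \sum_i dvar y i ^+ 2.

Lemma peval_sqdist y x : peval (sqdist y) x = sqn (x - y).
Proof. by rewrite peval_sum; apply: eq_bigr => i _; rewrite pevalXn peval_dvar. Qed.

Section Point.
Variable y : T -> 'rV[R]_n.
Hypothesis y_bounded : forall i, bscal F (fun t => y t 0 i).

Lemma bfam_sqdist : bfam (fun t => sqdist (y t)).
Proof. by apply: bfam_sum => i _; apply: bfamX; exact: bfam_dvar. Qed.

Lemma umod_sqdistM f : umod f -> umod (fun t => sqdist (y t) * f t).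
Proof.
move=> uf; have : umod (fun t => \sum_i dvar (y t) i ^+ 2 * f t); last first.
  by apply: umod_eq => t; rewrite /sqdist mulr_suml.
apply: umod_sum => i _; apply: umod_sqrM => //; apply: bfam_bdeg; exact: bfam_dvar.
Qed.

Lemma umod_sqdist : umod (fun t => sqdist (y t)).
Proof.
by apply: umod_sum => i _; apply: umod_sqr; apply: bfam_bdeg; exact: bfam_dvar.
Qed.

(** Write z = sum_i w_i with w_i = B_i (X_i - y_i).  The Cauchy-Schwarz inequality
n sum_i w_i^2 - z^2 = 1/2 sum_ij (w_i - w_j)^2 is an identity of sums of
squares, and C - B_i^2 is positive on S for large C. *)
Lemma vanishing_dominated z : bfam z -> (\forall t \near F, peval (z t) (y t) = 0) ->
  exists2 C : R, 0 < C & umod (fun t => C *: sqdist (y t) - z t ^+ 2).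
Proof.
move=> bz z0; have [B [bB eB]] := hadamard y_bounded bz.
have /choice[C CP] i : exists C : R, 0 < C /\ umod (fun t => mpolyC n C - B i t ^+ 2).
  have [C C0 uC] := umod_upper_bound (bfamX 2 (bB i)).
  by exists C.
pose C1 := \sum_i C i.
have C10 : 0 <= C1 by apply: sumr_ge0 => i _; case: (CP i) => /ltW.
exists (n%:R * C1 + 1); first by rewrite ltr_wpDl// mulr_ge0.
pose w i t := B i t * dvar (y t) i.
have bw i : bdeg F (w i) by apply: bfam_bdeg; apply: bfamM => //; exact: bfam_dvar.
have u1 : umod (fun t => n%:R *: (\sum_i dvar (y t) i ^+ 2 * (mpolyC n C1 - B i t ^+ 2))).
  apply: (umodZ (c := fun=> n%:R)); first exact: nearW.
  apply: umod_sum => i _; apply: umod_sqrM; first by apply: bfam_bdeg; exact: bfam_dvar.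
  have [_ uC] := CP i; have uC1 : umod (fun=> (C1 - C i) *: 1).
    apply: (umodZ (c := fun=> C1 - C i)); last exact: umod1.
    apply: nearW => t; rewrite subr_ge0 /C1 (bigD1 i)//= lerDl sumr_ge0// => j _.
    by case: (CP j) => /ltW.
  apply: umod_eq (umodD uC uC1) => t.
  by rewrite -mul_mpolyC mulr1 mpolyCB; ring.
have u2 : umod (fun t => 2^-1 *: \sum_i \sum_j (w i t - w j t) ^+ 2).
  apply: (umodZ (c := fun=> 2^-1)); first by apply: nearW => t; rewrite invr_ge0.
  apply: umod_sum => i _; apply: umod_sum => j _; apply: umod_sqr.
  by apply: bfam_bdeg; apply: bfamB; apply: bfamM => //; exact: bfam_dvar.
have u3 := umod_sqdist.
apply: umod_near (umodD (umodD u1 u2) u3).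
apply: filterS z0 => t z0.
have -> : z t = \sum_i w i t by rewrite {1}(eB t) z0 mpolyC0 add0r.
have -> : 2^-1 *: \sum_i \sum_j (w i t - w j t) ^+ 2 =
    n%:R *: (\sum_i w i t ^+ 2) - (\sum_i w i t) ^+ 2.
  have -> : \sum_i \sum_j (w i t - w j t) ^+ 2 =
     2%:R *: (n%:R *: (\sum_i w i t ^+ 2) - (\sum_i w i t) ^+ 2).
    transitivity (\sum_i \sum_j (w i t ^+ 2 + w j t ^+ 2 - 2%:R *: (w i t * w j t))).
      apply: eq_bigr => i _; apply: eq_bigr => j _; rewrite scaler_nat; ring.
    have -> : \sum_i \sum_j (w i t ^+ 2 + w j t ^+ 2 - 2%:R *: (w i t * w j t)) =
      \sum_(i < n) (n%:R *: w i t ^+ 2) + \sum_(i < n) (\sum_j w j t ^+ 2) -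
      2%:R *: (\sum_i \sum_j w i t * w j t).
      rewrite scaler_sumr -big_split -sumrB; apply: eq_bigr => i _ /=.
      rewrite scaler_sumr -sumrN.
      have -> : n%:R *: w i t ^+ 2 = \sum_(j < n) w i t ^+ 2.
        by rewrite sumr_const card_ord scaler_nat.
      by rewrite -!big_split.
    rewrite -scaler_sumr sumr_const card_ord expr2 big_distrlr /= !scaler_nat; ring.
  by rewrite scalerA mulVf ?scale1r.
have -> : \sum_i dvar (y t) i ^+ 2 * (mpolyC n C1 - B i t ^+ 2) =
   C1 *: sqdist (y t) - \sum_i w i t ^+ 2.
  rewrite /sqdist scaler_sumr -sumrB; apply: eq_bigr => i _.
  by rewrite /w -mul_mpolyC; ring.
rewrite scalerDl scale1r scalerBr scalerA; ring.
Qed.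

End Point.

Lemma bdeg_linear (y : T -> 'rV[R]_n) (c : 'I_n -> T -> R) : (forall i, bscal F (fun t => y t 0 i)) ->
  bdeg F (fun t => \sum_i c i t *: dvar (y t) i).
Proof.
move=> y_bounded; exists 1%N; apply: nearW => t; rewrite /deg_le.
elim/big_ind: _ => [|p q dp dq|i _]; first by rewrite msize0.
  by rewrite (leq_trans (msizeD_le _ _))// geq_max dp.
rewrite (leq_trans (msizeZ_le _ _))// /dvar (leq_trans (msizeD_le _ _))// geq_max.
by rewrite msizeX mdeg1 msizeN msizeC; case: (_ != _).
Qed.

(** Let h = X - y and e = (1 - |h|^2 / beta)^K, which is 1 at y, lies between 0 and
1 on S, and is small on S away from y if K is large.  In
q = e^2 h^T A(y) h + e^2 h^T (A - A(y)) h + (1 - e^2) q the first term is a sum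
of squares.  The entries of e^2 (A - A(y)) are uniformly small on S, so that
the second term plus a small multiple of |h|^2 is in the module.  Finally
1 - e^2 = |h|^2 G / beta with G >= 0 on S, and |h|^2 (G q + const) is in the
module because G q + const is positive. *)
Lemma quadratic_form_umod (y : T -> 'rV[R]_n) (A : 'I_n -> 'I_n -> T -> {mpoly R[n]}) (tau : R) :
  (forall i, bscal F (fun t => y t 0 i)) -> (forall i j, bfam (A i j)) ->
  (\forall t \near F, forall v : 'rV[R]_n,
     0 <= \sum_i \sum_j peval (A i j t) (y t) * v 0 i * v 0 j) ->
  (\forall t \near F, forall x, S x ->
     0 <= peval (\sum_i \sum_j A i j t * (dvar (y t) i * dvar (y t) j)) x) ->
  0 < tau ->
  umod (fun t => \sum_i \sum_j A i j t * (dvar (y t) i * dvar (y t) j) + tau *: sqdist (y t)).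
Proof.
move=> y_bounded bA Apsd qS tau0; pose q t := \sum_i \sum_j A i j t * (dvar (y t) i * dvar (y t) j).
have bq : bfam q.
  by apply: bfam_sum => i _; apply: bfam_sum => j _; apply: bfamM => //;
    apply: bfamM; exact: bfam_dvar.
have [beta beta0 betaP] := bfam_boundedS (bfam_sqdist y_bounded).
pose A0 i j t := peval (A i j t) (y t).
pose D i j t := A i j t - mpolyC n (A0 i j t).
have bD i j : bfam (D i j).
  by apply: bfamB => //; apply: bfam_scal; exact: bfam_scal_peval.
have [B SB] := basic_semialg_bounded.
have /choice[CL CLP] (ij : 'I_n * 'I_n) : exists C : R, 0 < C /\
    \forall t \near F, forall x, S x -> `|peval (D ij.1 ij.2 t) x| <= C * `|x - y t|.
  have [|C C0 CP] := @bfam_lipschitz _ _ _ _ FF y y_bounded S B _ _ (bD ij.1 ij.2).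
    by move=> x i; exact: SB.
  exists C; split=> //; apply: filterS CP => t CP x Sx; have := CP x Sx.
  by rewrite /D pevalB pevalC [X in X - _ - _]/= pevalB pevalC subrr subr0.
have /choice[CA CAP] (ij : 'I_n * 'I_n) : exists C : R, 0 < C /\
    \forall t \near F, forall x, S x -> `|peval (D ij.1 ij.2 t) x| <= C.
  by have [C C0 CP] := bfam_boundedS (bD ij.1 ij.2); exists C.
pose L := 1 + \sum_ij CL ij; pose M := 1 + \sum_ij CA ij.
have Lge ij : CL ij <= L.
  rewrite /L (bigD1 ij)//= addrCA lerDl addr_ge0// sumr_ge0// => k _; by case: (CLP k) => /ltW.
have Mge ij : CA ij <= M.
  rewrite /M (bigD1 ij)//= addrCA lerDl addr_ge0// sumr_ge0// => k _; by case: (CAP k) => /ltW.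
have L0 : 0 < L by rewrite /L ltr_wpDr// sumr_ge0// => k _; case: (CLP k) => /ltW.
have M0 : 0 < M by rewrite /M ltr_wpDr// sumr_ge0// => k _; case: (CAP k) => /ltW.
pose tau1 := tau / 2 / (n%:R + 1).
have n1 : 0 < n%:R + 1 :> R by rewrite ltr_wpDl.
have tau10 : 0 < tau1 by rewrite !divr_gt0.
(* On S, A differs from A(y) by at most tau1 / 2 where |X - y| <= tau1 / 2 / L, and
elsewhere 1 - |X - y|^2 / beta <= 1 - r2. *)
pose r2 := Num.min 1 ((tau1 / 2 / L) ^+ 2 / beta).
have r20 : 0 < r2 <= 1.
  by rewrite ge_min lexx lt_min ltr01 !divr_gt0 ?exprn_gt0 ?divr_gt0.
have [|K KP] := @bernoulli_small R r2 M (tau1 / 2) r20; first by rewrite divr_gt0.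
pose e t : {mpoly R[n]} := (1 - beta^-1 *: sqdist (y t)) ^+ K.
have bbase : bfam (fun t => 1 - beta^-1 *: sqdist (y t)).
  apply: bfamB; first exact: bfam1.
  by apply: (@bfamZ _ _ _ _ _ (fun=> _)); [exact: bscal_cst|exact: bfam_sqdist].
have be : bfam e by apply: bfamX.
have baseP : \forall t \near F, forall x, S x ->
    0 <= peval (1 - beta^-1 *: sqdist (y t)) x <= 1.
  apply: filterS betaP => t bt x Sx; rewrite !peval_simp.
  have := bt x Sx; rewrite ger0_norm; last by rewrite peval_sqdist sqn_ge0.
  have s0 : 0 <= peval (sqdist (y t)) x by rewrite peval_sqdist sqn_ge0.
  move=> sb; rewrite lerBlDr lerDl mulr_ge0 ?invr_ge0 ?(ltW beta0)// subr_ge0.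
  by rewrite mulrC ler_pdivrMr// mul1r sb.
pose E i j t := e t ^+ 2 * D i j t.
have EP i j : \forall t \near F, forall x, S x -> `|peval (E i j t) x| <= tau1 / 2.
  have [_ CL1] := CLP (i, j); have [_ CA1] := CAP (i, j).
  apply: filterS3 (filterI CL1 CA1) baseP betaP => t [/= c1 c2] bt bt' x Sx.
  have /andP[b0 b1] := bt x Sx.
  rewrite pevalM !pevalXn -exprM normrM ger0_norm ?exprn_ge0//.
  set s := `|x - y t|; have s0 : 0 <= s by exact: normr_ge0.
  have [sr|sr] := leP s (tau1 / 2 / L).
    apply: (@le_trans _ _ (1 * (L * (tau1 / 2 / L)))); last first.
      by rewrite mul1r mulrCA divff ?mulr1// gt_eqF.
    rewrite ler_pM ?exprn_ge0 ?exprn_ile1//.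
    by rewrite (le_trans (c1 x Sx))// ler_pM ?(ltW (CLP _).1).
  rewrite mulrC; apply: (@le_trans _ _ (M * (1 - r2) ^+ (K * 2))); last first.
    by apply: KP; rewrite leq_pmulr.
  rewrite ler_pM ?exprn_ge0 ?(le_trans (c2 x Sx))//.
  rewrite lerXn2r ?nnegrE//; first by lra.
  rewrite !peval_simp lerD2l lerN2 peval_sqdist.
  rewrite ge_min; apply/orP; right; rewrite mulrC ler_wpM2l ?invr_ge0 ?(ltW beta0)//.
  apply: le_trans (norm_sqr_le _); rewrite lerXn2r ?nnegrE//; last exact: ltW.
  by rewrite !divr_ge0 ?ltW.
have u1 : umod (fun t => e t ^+ 2 * \sum_i \sum_j mpolyC n (A0 i j t) * (dvar (y t) i * dvar (y t) j)).
  apply: umod_sqrM; first exact: bfam_bdeg.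
  have /choice[Bt BtP] t : exists Bt : 'I_n -> 'I_n -> R,
      (forall v : 'rV[R]_n, 0 <= \sum_i \sum_j A0 i j t * v 0 i * v 0 j) ->
      \sum_i \sum_j mpolyC n (A0 i j t) * (dvar (y t) i * dvar (y t) j) =
      \sum_s (\sum_i Bt s i *: dvar (y t) i) ^+ 2.
    have [Ap|] := pselect (forall v : 'rV[R]_n, 0 <= \sum_i \sum_j A0 i j t * v 0 i * v 0 j).
      have [Bt BtP] := psd_sos Ap; exists Bt => _; rewrite -BtP.
      by apply: eq_bigr => i _; apply: eq_bigr => j _; rewrite mul_mpolyC.
    by exists (fun _ _ => 0).
  apply: umod_near (_ : umod (fun t => \sum_s (\sum_i Bt t s i *: dvar (y t) i) ^+ 2)).
    by apply: filterS Apsd => t /BtP ->.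
  by apply: umod_sum => s _; apply: umod_sqr; apply: bdeg_linear.
(* E h_i h_j + tau1 / 2 (h_i^2 + h_j^2)
= 1/4 (h_i + h_j)^2 (tau1 + E) + 1/4 (h_i - h_j)^2 (tau1 - E) *)
have u2 : umod (fun t => \sum_i \sum_j (4^-1 *: ((dvar (y t) i + dvar (y t) j) ^+ 2 * (mpolyC n tau1 + E i j t)) +
    4^-1 *: ((dvar (y t) i - dvar (y t) j) ^+ 2 * (mpolyC n tau1 - E i j t)))).
  have bE i j : bfam (E i j) by apply: bfamM => //; exact: bfamX.
  have q4 : \forall t \near F, 0 <= 4^-1 :> R by apply: nearW => t; rewrite invr_ge0.
  apply: umod_sum => i _; apply: umod_sum => j _; apply: umodD; apply: (umodZ q4);
    apply: umod_sqrM.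
  - by apply: bfam_bdeg; apply: bfamD; exact: bfam_dvar.
  - apply: (umod_pos garch (delta := tau1 / 2)); [|by rewrite divr_gt0|].
      by apply: bfamD => //; exact: bfam_cst.
    apply: filterS (EP i j) => t Et x Sx; have := Et x Sx.
    by rewrite !peval_simp ler_norml; lra.
  - by apply: bfam_bdeg; apply: bfamB; exact: bfam_dvar.
  - apply: (umod_pos garch (delta := tau1 / 2)); [|by rewrite divr_gt0|].
      by apply: bfamB => //; exact: bfam_cst.
    apply: filterS (EP i j) => t Et x Sx; have := Et x Sx.
    by rewrite !peval_simp ler_norml; lra.
pose G t := \sum_(i < K * 2) (1 - beta^-1 *: sqdist (y t)) ^+ i : {mpoly R[n]}.
have bG : bfam G by apply: bfam_sum => i _; apply: bfamX.
have u3 : umod (fun t => beta^-1 *: (sqdist (y t) * (G t * q t + mpolyC n (beta * (tau / 2))))).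
  apply: (umodZ (c := fun=> beta^-1)); first by apply: nearW => t; rewrite invr_ge0 ltW.
  apply: umod_sqdistM => //.
  apply: (umod_pos garch (delta := beta * (tau / 2))).
  - by apply: bfamD; [exact: bfamM|exact: bfam_cst].
  - by rewrite mulr_gt0// divr_gt0.
  - apply: filterS2 baseP qS => t bt qt x Sx; rewrite !pevalD pevalM pevalC lerDr.
    rewrite mulr_ge0 ?qt// peval_sum sumr_ge0// => i _.
    by rewrite pevalXn exprn_ge0//; case/andP: (bt x Sx).
have u4 : umod (fun t => (tau / 2 - n%:R * tau1) *: sqdist (y t)).
  apply: (umodZ (c := fun=> _)).
    apply: nearW => t; rewrite subr_ge0 /tau1 mulrCA ler_piMr ?divr_ge0 ?(ltW tau0)//.
    by rewrite ler_pdivrMr// mul1r lerDl.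
  exact: umod_sqdist.
apply: umod_eq (umodD (umodD u1 u2) (umodD u3 u4)) => t; rewrite -/(q t).
have Ge : beta^-1 *: (sqdist (y t) * (G t * q t)) = (1 - e t ^+ 2) * q t.
  have -> : 1 - e t ^+ 2 = (1 - (1 - beta^-1 *: sqdist (y t))) * G t.
    by rewrite /e -exprM -[LHS]opprB subrX1 -mulNr opprB.
  by rewrite subKr -mulrA scalerAl.
have -> : \sum_i \sum_j (4^-1 *: ((dvar (y t) i + dvar (y t) j) ^+ 2 * (mpolyC n tau1 + E i j t)) +
    4^-1 *: ((dvar (y t) i - dvar (y t) j) ^+ 2 * (mpolyC n tau1 - E i j t))) =
    e t ^+ 2 * (\sum_i \sum_j D i j t * (dvar (y t) i * dvar (y t) j)) +
    (n%:R * tau1) *: sqdist (y t).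
  have -> : (n%:R * tau1) *: sqdist (y t) =
     \sum_i \sum_j (tau1 / 2) *: (dvar (y t) i ^+ 2 + dvar (y t) j ^+ 2).
    have -> : \sum_i \sum_j (tau1 / 2) *: (dvar (y t) i ^+ 2 + dvar (y t) j ^+ 2) =
       \sum_i (tau1 / 2) *: (n%:R *: dvar (y t) i ^+ 2 + sqdist (y t)).
      apply: eq_bigr => i _; rewrite -scaler_sumr big_split /=; congr (_ *: (_ + _)).
      by rewrite sumr_const card_ord scaler_nat.
    rewrite -scaler_sumr big_split /= -scaler_sumr -/(sqdist _) sumr_const card_ord.
    rewrite -[sqdist (y t) *+ n]scaler_nat -scalerDl scalerA; congr (_ *: _); lra.
  rewrite mulr_sumr -big_split; apply: eq_bigr => i _ /=.
  rewrite mulr_sumr -big_split; apply: eq_bigr => j _ /=.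
  rewrite -scalerDr /E; apply: (@scalerI _ _ (4 : R)); first by [].
  rewrite scalerA divff// scale1r scalerDr scalerA.
  have -> : 4 * (tau1 / 2) = 2 * tau1 by lra.
  have -> : (2 * tau1) *: (dvar (y t) i ^+ 2 + dvar (y t) j ^+ 2) =
     2%:R * (mpolyC n tau1 * (dvar (y t) i ^+ 2 + dvar (y t) j ^+ 2)).
    by rewrite mul_mpolyC [RHS]mulr_natl -[RHS]scaler_nat scalerA.
  have -> : 4 *: (e t ^+ 2 * (D i j t * (dvar (y t) i * dvar (y t) j))) =
     4%:R * (e t ^+ 2 * (D i j t * (dvar (y t) i * dvar (y t) j))).
    by rewrite [RHS]mulr_natl -[RHS]scaler_nat.
  ring.
have qE : q t = \sum_i \sum_j mpolyC n (A0 i j t) * (dvar (y t) i * dvar (y t) j) +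
   \sum_i \sum_j D i j t * (dvar (y t) i * dvar (y t) j).
  rewrite -big_split; apply: eq_bigr => i _ /=; rewrite -big_split.
  by apply: eq_bigr => j _ /=; rewrite -mulrDl addrC subrK.
have Hc : beta^-1 *: (sqdist (y t) * mpolyC n (beta * (tau / 2))) = (tau / 2) *: sqdist (y t).
  by rewrite mulrC mul_mpolyC scalerA mulKf ?gt_eqF.
rewrite [sqdist (y t) * (_ + _)]mulrDr [beta^-1 *: (_ + _)]scalerDr Ge Hc.
rewrite scalerBl; set Q1 := (\sum_i \sum_j mpolyC n _ * _) in qE *.
set Q2 := (\sum_i \sum_j D _ _ _ * _) in qE *; rewrite qE.
have -> : tau *: sqdist (y t) = (tau / 2) *: sqdist (y t) + (tau / 2) *: sqdist (y t).
  by rewrite -scalerDl -splitr.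
ring.
Qed.

End LocalGlobal.

(** * Certificates for products of squared distances *)

Section Merge.
Context {R : realType} {n m : nat} (g : 'I_m -> {mpoly R[n]}).
Hypothesis garch : quad_archimedean g.
Context {T : Type} (F : set_system T) {FF : Filter F}.
Local Notation S := (basic_semialg g).
Local Notation umod := (umod g F).
Local Notation bfam := (bfam F).

Variables (I : eqType) (y : I -> T -> 'rV[R]_n) (f : T -> {mpoly R[n]}).
Hypothesis y_bounded : forall k i, bscal F (fun t => y k t 0 i).
Hypothesis bf : bfam f.
Hypothesis f_ge0 : \forall t \near F, forall x, S x -> 0 <= peval (f t) x.

Definition sqdists (s : seq I) t : {mpoly R[n]} := \prod_(k <- s) sqdist (y k t).

Lemma bfam_sqdists s : bfam (sqdists s).
Proof. by apply: bfam_prod => k _; exact: bfam_sqdist. Qed.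

Lemma umod_sqdistsM s h : umod h -> umod (fun t => sqdists s t * h t).
Proof.
move=> uh; elim: s => [|k s IH].
  by apply: umod_eq uh => t; rewrite /sqdists big_nil mul1r.
apply: umod_eq (umod_sqdistM (y_bounded k) IH) => t.
by rewrite /sqdists big_cons mulrA.
Qed.

Lemma sqdists_ge0 s t x : 0 <= peval (sqdists s t) x.
Proof. by rewrite peval_prod prodr_ge0// => k _; rewrite peval_sqdist sqn_ge0. Qed.

(** Let om be the product over s and t = om / om(y_k).  The polynomial
H = t (1 - (t - 1) / N)^N takes values in [0, 1] on S, is divisible by om and
equals 1 at y_k.  Hence z = 1 - H vanishes at y_k, c = 1 - z^2 = H (2 - H) is
divisible by om, and f = z^2 f + c^2 f + z^2 c f.  The hypotheses treat
z^2 (f + tau om) and c^2 (f + tau |X - y_k|^2).  In z^2 c f = z^2 om (b f), with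
b >= 0 on S, positivity of b f + tau is enough. *)
Lemma merge_certificates s k (om0 : R) : 0 < om0 ->
  (\forall t \near F, om0 <= peval (sqdists s t) (y k t)) ->
  (forall tau : R, 0 < tau -> umod (fun t => f t + tau *: sqdists s t)) ->
  (forall tau : R, 0 < tau -> umod (fun t => f t + tau *: sqdist (y k t))) ->
  forall tau : R, 0 < tau -> umod (fun t => f t + tau *: sqdists (k :: s) t).
Proof.
move=> om00 omk us uk tau' tau'0; pose om := sqdists s.
have bom : bfam om := bfam_sqdists s.
have [beta beta0 betaP] := bfam_boundedS garch bom.
pose ck t := (peval (om t) (y k t))^-1.
have bck : bscal F ck.
  exists (om0^-1); apply: filterS omk => t ot.
  by rewrite ger0_norm ?invr_ge0 ?sqdists_ge0// lef_pV2 ?posrE// (lt_le_trans om00).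
pose N := (Num.truncn (beta / om0)).+1.
have N0 : 0 < N%:R :> R by rewrite ltr0n.
have Nb : beta / om0 <= N%:R by rewrite ltW// truncnS_gt.
pose u t := ck t *: om t - 1.
pose phi t := (1 - N%:R^-1 *: u t) ^+ N.
pose H t := ck t *: om t * phi t.
pose z t := 1 - H t.
pose b t := ck t *: (phi t * (2 - H t)).
have bu : bfam u by apply: bfamB; [exact: bfamZ|exact: bfam1].
have bphi : bfam phi.
  apply: bfamX; apply: bfamB; first exact: bfam1.
  by apply: (@bfamZ _ _ _ _ _ (fun=> _)) => //; exact: bscal_cst.
have bH : bfam H by apply: bfamM => //; exact: bfamZ.
have bz : bfam z by apply: bfamB => //; exact: bfam1.
have b2H : bfam (fun t => 2 - H t) by apply: bfamB => //; exact: bfam_cst.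
have bb : bfam b by apply: bfamZ => //; exact: bfamM.
have omb t : om t * b t = H t * (2 - H t).
  by rewrite /b /H -!mul_mpolyC; ring.
have bc : bfam (fun t => om t * b t) by exact: bfamM.
have Hbd : \forall t \near F, forall x, S x ->
    0 <= peval (phi t) x /\ 0 <= peval (H t) x <= 1.
  apply: filterS2 omk betaP => t ot bt x Sx.
  have omx0 : 0 <= peval (om t) x by exact: sqdists_ge0.
  have omxb : peval (om t) x <= beta by rewrite (le_trans (ler_norm _))// bt.
  have ok0 : 0 < peval (om t) (y k t) by rewrite (lt_le_trans om00).
  have ck0 : 0 <= ck t by rewrite invr_ge0 ltW.
  set v := N%:R^-1 * (ck t * peval (om t) x - 1).
  have cko : 0 <= ck t * peval (om t) x <= N%:R.
    rewrite mulr_ge0//= (le_trans _ Nb)// mulrC ler_pM// lef_pV2 ?posrE//.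
  have vb : -1 <= v <= 1.
    rewrite /v mulrC ler_pdivlMr// ler_pdivrMr//.
    have : 1 <= N%:R :> R by rewrite ler1n.
    by move: cko => /andP[]; lra.
  have phiE : peval (phi t) x = (1 - v) ^+ N by rewrite /phi /u !peval_simp.
  have phi0 : 0 <= peval (phi t) x by rewrite phiE exprn_ge0//; move: vb => /andP[]; lra.
  split=> //; rewrite /H pevalM pevalZ mulr_ge0 ?mulr_ge0//=.
  have := bernoulli_decay N vb; rewrite -phiE /v mulrA divff ?gt_eqF// mul1r.
  by rewrite addrCA subrr addr0 mulrC.
have zk : \forall t \near F, peval (z t) (y k t) = 0.
  apply: filterS omk => t ot; have ok0 : 0 < peval (om t) (y k t) by rewrite (lt_le_trans om00).
  rewrite /z /H /phi /u !peval_simp /ck mulVf ?gt_eqF//.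
  by rewrite subrr mulr0 subr0 expr1n mulr1 subrr.
(* z^2 is dominated by |X - y_k|^2, and c^2 = om^2 b^2 by om. *)
have [C1 C10 uC1] := vanishing_dominated garch (y_bounded k) bz zk.
have [C2 C20 uC2] := umod_upper_bound garch (bfamM bom (bfamX 2 bb)).
pose tau := tau' / (2 * C1 + C2).
have C0 : 0 < 2 * C1 + C2 by rewrite addr_gt0// mulr_gt0.
have tau0 : 0 < tau by rewrite divr_gt0.
have p1 : umod (fun t => z t ^+ 2 * (f t + tau *: om t)).
  by apply: umod_sqrM; [exact: bfam_bdeg|exact: us].
have p2 : umod (fun t => (om t * b t) ^+ 2 * (f t + tau *: sqdist (y k t))).
  by apply: umod_sqrM; [exact: bfam_bdeg|exact: uk].
have p3 : umod (fun t => z t ^+ 2 * (om t * (b t * f t + mpolyC n tau))).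
  apply: umod_sqrM; first exact: bfam_bdeg.
  apply: umod_sqdistsM; apply: (umod_pos garch (delta := tau)) => //.
    by apply: bfamD; [exact: bfamM|exact: bfam_cst].
  apply: filterS3 f_ge0 Hbd omk => t ft Ht ot x Sx; have [phi0 /andP[H0 H1]] := Ht x Sx.
  rewrite pevalD pevalC lerDr pevalM mulr_ge0 ?ft// /b pevalZ mulr_ge0//.
    by rewrite invr_ge0 sqdists_ge0.
  rewrite pevalM mulr_ge0// pevalB -[2]/(2%:R) -mpolyC_nat pevalC; lra.
have p4 : umod (fun t => (2 * tau) *: (om t * (C1 *: sqdist (y k t) - z t ^+ 2))).
  apply: (umodZ (c := fun=> _)); first by apply: nearW => t; rewrite mulr_ge0 ?ltW.
  exact: umod_sqdistsM.
have p5 : umod (fun t => tau *: (om t * (sqdist (y k t) * (mpolyC n C2 - om t * b t ^+ 2)))).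
  apply: (umodZ (c := fun=> _)); first by apply: nearW => t; rewrite ltW.
  by apply: umod_sqdistsM; exact: umod_sqdistM.
apply: umod_eq (umodD (umodD p1 p2) (umodD p3 (umodD p4 p5))) => t.
have -> : tau' = tau * (2 * C1 + C2) by rewrite /tau mulfVK ?gt_eqF.
rewrite /sqdists big_cons -/(sqdists s t) -/(om t) -!mul_mpolyC.
have zE : z t = 1 - H t by [].
rewrite !(mpolyCM, mpolyCD).
rewrite mpolyC1.
set B := b t in omb *; set O := om t; set Q := sqdist _.
have E : 1 = z t ^+ 2 + (O * B) ^+ 2 + z t ^+ 2 * (O * B).
  by rewrite /O /B omb /z; ring.
have Ef : f t * (z t ^+ 2 + (O * B) ^+ 2 + z t ^+ 2 * (O * B)) = f t by rewrite -E mulr1.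
rewrite -[X in _ = X + _]Ef.
ring.
Qed.

Lemma umod_add_sqdists (rho : R) : 0 < rho ->
  (forall k j, k != j -> \forall t \near F, rho <= sqn (y k t - y j t)) ->
  (forall k (tau : R), 0 < tau -> umod (fun t => f t + tau *: sqdist (y k t))) ->
  forall (s : seq I) (tau : R), uniq s -> 0 < tau -> umod (fun t => f t + tau *: sqdists s t).
Proof.
move=> rho0 ysep uk s; elim: s => [|k s IH] tau /=.
  move=> _ tau0; apply: (umod_pos garch (delta := tau)) => //.
    by apply: bfamD => //; apply: (@bfamZ _ _ _ _ _ (fun=> _)); [exact: bscal_cst|exact: bfam_sqdists].
  apply: filterS f_ge0 => t ft x Sx.
  by rewrite /sqdists big_nil !peval_simp mulr1 lerDr ft.
move=> /andP[ks us]; apply: (@merge_certificates s k (rho ^+ size s)) => //.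
- exact: exprn_gt0.
- elim: s ks {us IH} => [|j s IH].
    by move=> _; apply: nearW => t; rewrite /sqdists big_nil peval1.
  rewrite inE negb_or => /andP[kj /IH IHs].
  apply: filterS2 (ysep _ _ kj) IHs => t jt st.
  rewrite /sqdists big_cons pevalM exprS ler_pM ?exprn_ge0 ?(ltW rho0)//.
  by rewrite peval_sqdist.
- by move=> tau1 tau10; exact: IH.
- by move=> tau1; exact: uk.
Qed.

End Merge.

(** * Strict quasiconcavity near a point *)

Section Continuity.
Context {R : realType} {n : nat}.
Implicit Types (p : {mpoly R[n]}) (x y : 'rV[R]_n).

Lemma peval_continuous p : continuous (peval p : 'rV[R]_n -> R).
Proof.
rewrite (mpolyE p).
elim/big_ind: _ => [|q1 q2 c1 c2|mu _].
- rewrite (_ : peval 0 = cst 0); last by apply/funext => x; rewrite peval0.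
  by move=> x; exact: cst_continuous.
- rewrite (_ : peval (q1 + q2) = peval q1 \+ peval q2); last by apply/funext => x; rewrite pevalD.
  by move=> x; apply: continuousD; [exact: c1|exact: c2].
- rewrite (_ : peval _ = cst (mcoeff mu p) \* peval (mpolyX R mu)); last first.
    by apply/funext => x; rewrite pevalZ.
  move=> x; apply: continuousM; first exact: cst_continuous.
  move: x; rewrite mpolyXE_id; elim/big_ind: _ => [|q1 q2 c1 c2|i _].
  + rewrite (_ : peval 1 = cst 1); last by apply/funext => x; rewrite peval1.
    by move=> x; exact: cst_continuous.
  + rewrite (_ : peval (q1 * q2) = peval q1 \* peval q2); last by apply/funext => x; rewrite pevalM.
    by move=> x; apply: continuousM; [exact: c1|exact: c2].
  + rewrite -/(pvar i) (_ : peval _ = (fun x => x 0 i ^+ mu i)); last first.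
      by apply/funext => x; rewrite pevalXn peval_var.
    elim: (mu i) => [|k IH] x; first exact: cst_continuous.
    rewrite (_ : (fun x => _) = (fun x : 'rV[R]_n => x 0 i) \* (fun x => x 0 i ^+ k)).
      by apply: continuousM; [exact: coord_continuous|exact: IH].
    by apply/funext => z; rewrite exprS.
Qed.

Lemma near_norm (x : 'rV[R]_n) (P : set 'rV[R]_n) : (\forall y \near x, P y) ->
  exists2 r : R, 0 < r & forall y, `|y - x| < r -> P y.
Proof.
move=> /nbhs_ballP[r r0 xr]; exists r => // y yx; apply: xr.
by rewrite -ball_normE /= distrC.
Qed.

Lemma norm_near (x : 'rV[R]_n) (r : R) : 0 < r -> \forall y \near x, `|y - x| < r.
Proof.
move=> r0; apply/nbhs_ballP; exists r => // y.
by rewrite -ball_normE /= distrC.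
Qed.

Lemma near_peval_gt0 p x : 0 < peval p x -> \forall y \near x, 0 < peval p y.
Proof.
move=> px; apply: (@peval_continuous p x [set z | 0 < z]).
by apply: open_nbhs_nbhs; split => //; exact: open_gt.
Qed.

Lemma near_peval_dist p x (e : R) : 0 < e -> \forall y \near x, `|peval p y - peval p x| < e.
Proof.
move=> e0; have := @peval_continuous p x => /cvgrPdist_lt/(_ _ e0).
by apply: filterS => y; rewrite distrC.
Qed.

End Continuity.

Section Compactness.
Context {R : realType} {n m : nat} (g : 'I_m -> {mpoly R[n]}).
Hypothesis garch : quad_archimedean g.

Lemma basic_semialg_closed : closed (basic_semialg g).
Proof.
have -> : basic_semialg g = \bigcap_i ((peval (g i)) @^-1` [set z | 0 <= z]).
  by apply/seteqP; split=> [x gx i _|x gx i]; [exact: gx|exact: gx i I].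
apply: closed_bigI => i _; apply: closed_comp; last exact: closed_ge.
by move=> x _; exact: peval_continuous.
Qed.

Lemma basic_semialg_compact : compact (basic_semialg g).
Proof.
apply: bounded_closed_compact; last exact: basic_semialg_closed.
have [B BP] := basic_semialg_bounded garch.
exists `|B|; split; first exact: num_real.
move=> M BM x Sx /=; rewrite (le_trans _ (ltW BM))//.
by apply: norm_le_coord => // i; rewrite (le_trans (BP _ _ Sx))// ler_norm.
Qed.

End Compactness.

Section StrictQuasiconcavity.
Context {R : realType} {n : nat}.
Implicit Types (p : {mpoly R[n]}) (x y v : 'rV[R]_n).

Definition hess p x v : R := \sum_i \sum_j peval (mderiv j (mderiv i p)) x * v 0 i * v 0 j.
Definition dird p x v : R := \sum_i peval (mderiv i p) x * v 0 i.

Lemma gradientE p x v : (gradient p x *m v^T) = (dird p x v)%:M.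
Proof.
rewrite [LHS]mx11_scalar; congr (_%:M); rewrite mxE; apply: eq_bigr => i _.
by rewrite !mxE.
Qed.

Lemma hessianE p x v : (v *m hessian p x *m v^T) 0 0 = hess p x v.
Proof.
rewrite mxE /hess exchange_big; apply: eq_bigr => j _; rewrite mxE mulr_suml.
by apply: eq_bigr => i _; rewrite !mxE [v 0 i * _]mulrC.
Qed.

Lemma quadratic_continuous (M : 'I_n -> 'I_n -> R) :
  continuous (fun v : 'rV[R]_n => \sum_i \sum_j M i j * v 0 i * v 0 j).
Proof.
pose p : {mpoly R[n]} := \sum_i \sum_j mpolyC n (M i j) * pvar i * pvar j.
rewrite (_ : (fun _ => _) = peval p); first exact: peval_continuous.
apply/funext => v; rewrite peval_sum; apply: eq_bigr => i _; rewrite peval_sum.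
by apply: eq_bigr => j _; rewrite !peval_simp.
Qed.

Lemma sqn_continuous : continuous (@sqn R n).
Proof.
pose p : {mpoly R[n]} := \sum_i pvar i ^+ 2.
rewrite (_ : @sqn R n = peval p); first exact: peval_continuous.
by apply/funext => v; rewrite peval_sum; apply: eq_bigr => i _; rewrite !peval_simp.
Qed.

Lemma sphere_compact : compact [set v : 'rV[R]_n | sqn v = 1].
Proof.
apply: bounded_closed_compact.
  exists 1; split; first exact: num_real.
  move=> M M1 v /= v1; apply: le_trans (ltW M1).
  by rewrite -(@expr_le1 _ 2)// -v1 norm_sqr_le.
rewrite (_ : [set _ | _] = @sqn R n @^-1` [set 1]) //.
apply: closed_comp; last exact: closed_eq.
by move=> v _; exact: sqn_continuous.
Qed.

(** Finsler's lemma: a form that is negative on the zeros of D becomes negative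
after subtraction of a large multiple of D^2, by compactness of the sphere.  The
bound - 1 / (k + 1) lets one parameter k play both parts. *)
Lemma finsler_sphere (Q D : 'rV[R]_n -> R) : continuous Q -> continuous D ->
  (forall v, v != 0 -> D v = 0 -> Q v < 0) ->
  exists k : nat, forall v, sqn v = 1 -> Q v - k%:R * D v ^+ 2 <= - k.+1%:R^-1.
Proof.
move=> cQ cD QD.
suff : \forall k \near \oo, [set v : 'rV[R]_n | sqn v = 1] `<=`
    [set v | Q v - k%:R * D v ^+ 2 <= - k.+1%:R^-1].
  by case=> k _ /(_ k (leqnn k)) H; exists k => v; exact: H.
apply: (iffLR (compact_near_coveringP _) sphere_compact) => v v1.
have v0 : v != 0 by rewrite -sqn_gt0 v1.
have inv_small (e : R) : 0 < e -> \forall k \near \oo, k.+1%:R^-1 <= e.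
  move=> e0; near=> k; rewrite -(invrK e) lef_pV2 ?posrE ?invr_gt0//.
  apply: le_trans (ltW (truncnS_gt _)) _; rewrite ler_nat ltnS.
  by near: k; exact: nbhs_infty_ge.
have [Dv0|Dvn0] := eqVneq (D v) 0.
  have Qv := QD v v0 Dv0.
  have near1 : \forall w \near v, Q w < Q v / 2.
    apply: (@cQ v [set z | z < Q v / 2]); apply: open_nbhs_nbhs.
    by split; [exact: open_lt|rewrite /=; lra].
  have near2 : \forall k \near \oo, k.+1%:R^-1 <= - Q v / 2 by apply: inv_small; lra.
  near=> w k; rewrite /=.
  have h1 : Q w < Q v / 2 by near: w.
  have h2 : k.+1%:R^-1 <= - Q v / 2 by near: k.
  have h3 : 0 <= k%:R * D w ^+ 2 by rewrite mulr_ge0// sqr_ge0.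
  move: h1 h2 h3; move: (k.+1%:R^-1 : R) (k%:R * D w ^+ 2) (Q w) (Q v) => a b q q'.
  by lra.
have Dv2 : 0 < D v ^+ 2 by rewrite exprn_even_gt0.
have near1 : \forall w \near v, Q w < Q v + 1.
  apply: (@cQ v [set z | z < Q v + 1]); apply: open_nbhs_nbhs.
  by split; [exact: open_lt|rewrite /=; lra].
have near2 : \forall w \near v, D v ^+ 2 / 2 < D w ^+ 2.
  have cD2 : continuous (fun w => D w ^+ 2) by move=> w; apply: continuousM; exact: cD.
  apply: (@cD2 v [set z | D v ^+ 2 / 2 < z]); apply: open_nbhs_nbhs.
  by split; [exact: open_gt|rewrite /=; lra].
have near3 : \forall k \near \oo, (`|Q v| + 2) / (D v ^+ 2 / 2) <= k%:R.
  near=> k; apply: le_trans (ltW (truncnS_gt _)) _; rewrite ler_nat.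
  by near: k; exact: nbhs_infty_ge.
near=> w k; rewrite /=.
have h1 : Q w < Q v + 1 by near: w.
have h2 : D v ^+ 2 / 2 < D w ^+ 2 by near: w.
have h3 : (`|Q v| + 2) / (D v ^+ 2 / 2) <= k%:R by near: k.
have h4 : k.+1%:R^-1 <= 1 :> R by rewrite invf_le1// ler1n.
rewrite ler_pdivrMr in h3; last by rewrite divr_gt0.
have h5 : k%:R * (D v ^+ 2 / 2) <= k%:R * D w ^+ 2 by rewrite ler_wpM2l// ltW.
move: h1 h3 h4 h5 (ler_norm (Q v)).
move: (k.+1%:R^-1 : R) (k%:R * D w ^+ 2) (k%:R * _) (Q w) (Q v) `|Q v| => a b d q q' q''.
by lra.
Unshelve. all: by end_near.
Qed.

(** By Finsler's lemma the condition at x is an open one, so it holds near x with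
common constants. *)
Lemma strictly_quasiconcave_near p x : strictly_quasiconcave_at p x ->
  exists k c : R, [/\ 0 <= k, 0 < c & \forall y \near x, forall v,
    hess p y v - k * dird p y v ^+ 2 <= - c * sqn v].
Proof.
move=> qc.
pose M (k : R) i j := mderiv j (mderiv i p) - k *: (mderiv i p * mderiv j p).
have ME k y v : hess p y v - k * dird p y v ^+ 2 = \sum_i \sum_j peval (M k i j) y * v 0 i * v 0 j.
  rewrite /hess /dird expr2 big_distrlr /= mulr_sumr -sumrB; apply: eq_bigr => i _.
  rewrite mulr_sumr -sumrB; apply: eq_bigr => j _.
  by rewrite /M !peval_simp; ring.
have cD : continuous (fun v : 'rV[R]_n => dird p x v).
  pose q : {mpoly R[n]} := \sum_i mpolyC n (peval (mderiv i p) x) * pvar i.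
  rewrite (_ : (fun _ => _) = peval q); first exact: peval_continuous.
  by apply/funext => v; rewrite peval_sum; apply: eq_bigr => i _; rewrite !peval_simp.
have cQ : continuous (fun v => hess p x v) by move=> v; exact: quadratic_continuous.
have [|k kP] := finsler_sphere cQ cD.
  move=> v v0 Dv; have := qc v v0; rewrite gradientE Dv hessianE => H.
  by apply: H; rewrite raddf0.
exists k%:R, (k.+1%:R^-1 / 2); split=> //.
set c := k.+1%:R^-1 : R; have c0 : 0 < c by rewrite invr_gt0.
have hx v : hess p x v - k%:R * dird p x v ^+ 2 <= - c * sqn v.
  have [->|v0] := eqVneq v 0.
    rewrite /hess /dird /sqn !big1 ?expr0n ?mulr0 ?subr0//; try by move=> i _; rewrite mxE ?mulr0 ?expr0n.
    by move=> i _; rewrite big1// => j _; rewrite !mxE mulr0.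
  have s0 : 0 < Num.sqrt (sqn v) by rewrite sqrtr_gt0 sqn_gt0.
  pose w := (Num.sqrt (sqn v))^-1 *: v.
  have w1 : sqn w = 1 by rewrite sqnZ exprVn sqr_sqrtr ?sqn_ge0// mulVf// gt_eqF// sqn_gt0.
  have -> : v = Num.sqrt (sqn v) *: w by rewrite scalerA divff ?scale1r// gt_eqF.
  rewrite sqnZ w1 mulr1 ME.
  have := kP w w1; rewrite -/(hess p x w) ME -/c => H.
  have -> : \sum_i \sum_j peval (M k%:R i j) x * (Num.sqrt (sqn v) *: w) 0 i * (Num.sqrt (sqn v) *: w) 0 j =
     Num.sqrt (sqn v) ^+ 2 * \sum_i \sum_j peval (M k%:R i j) x * w 0 i * w 0 j.
    rewrite mulr_sumr; apply: eq_bigr => i _; rewrite mulr_sumr; apply: eq_bigr => j _.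
    by rewrite ![(_ *: w) _ _]mxE; ring.
  by rewrite mulrC ler_wpM2r ?sqr_ge0.
pose e := c / 2 / (n%:R ^+ 2 + 1).
have n1 : 0 < n%:R ^+ 2 + 1 :> R by rewrite ltr_wpDl// sqr_ge0.
have e0 : 0 < e by rewrite !divr_gt0.
have nearM : \forall y \near x, forall i j, `|peval (M k%:R i j) y - peval (M k%:R i j) x| < e.
  have nearMi i : \forall y \near x, forall j, `|peval (M k%:R i j) y - peval (M k%:R i j) x| < e.
    pose P (j : 'I_n) (y : 'rV[R]_n) := `|peval (M k%:R i j) y - peval (M k%:R i j) x| < e.
    have := @filter_forall _ _ P (nbhs x) (nbhs_filter x); apply => j; exact: near_peval_dist.
  pose P (i : 'I_n) (y : 'rV[R]_n) := forall j, `|peval (M k%:R i j) y - peval (M k%:R i j) x| < e.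
  by have := @filter_forall _ _ P (nbhs x) (nbhs_filter x); apply.
apply: filterS nearM => y yM v.
have := hx v; rewrite !ME => H.
have H2 : \sum_i \sum_j peval (M k%:R i j) y * v 0 i * v 0 j -
    \sum_i \sum_j peval (M k%:R i j) x * v 0 i * v 0 j <= n%:R ^+ 2 * (e * sqn v).
  rewrite -sumrB; apply: le_trans (_ : \sum_(i < n) \sum_(j < n) e * sqn v <= _).
    apply: ler_sum => i _; rewrite -sumrB; apply: ler_sum => j _.
    rewrite -mulrBl -mulrBl -mulrA (le_trans (ler_norm _))// normrM ler_pM//; first exact: ltW (yM i j).
    rewrite normrM; have vi := coord_sqr_le v i; have vj := coord_sqr_le v j.
    have := sqr_ge0 (`|v 0 i| - `|v 0 j|); move: vi vj.
    rewrite -(real_normK (num_real (v 0 i))) -(real_normK (num_real (v 0 j))).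
    move: `|v 0 i| `|v 0 j| (sqn v) => a b s. nra.
  by rewrite !sumr_const !card_ord -mulrnA -natrX mulr_natl.
have H3 : n%:R ^+ 2 * (e * sqn v) <= c / 2 * sqn v.
  rewrite mulrA ler_wpM2r ?sqn_ge0// /e mulrCA ler_piMr ?divr_ge0 ?(ltW c0)//.
  by rewrite ler_pdivrMr// mul1r lerDl.
by move: H H2 H3; lra.
Qed.

End StrictQuasiconcavity.

(** * Penalty polynomials *)

Section Penalty.
Context {R : realType} {n : nat}.
Implicit Types (p q : {mpoly R[n]}) (x y v : 'rV[R]_n) (beta : R).

(** For 0 <= p <= beta the factor decays quickly in p: the product agrees with p to
first order at the zeros of p, is more concave there, and is small throughout. *)
Definition penalty beta N p := p * (1 - beta^-1 *: p) ^+ (N * 2).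

Lemma mderiv_exp_at q y i K : peval q y = 1 ->
  peval (mderiv i (q ^+ K)) y = K%:R * peval (mderiv i q) y.
Proof.
move=> q1; elim: K => [|K IH]; first by rewrite expr0 -mpolyC1 mderivC peval0 mul0r.
by rewrite exprS mderivM pevalD !pevalM pevalXn IH q1 expr1n mulr1 mul1r -natr1; ring.
Qed.

Lemma mderiv_penalty beta N p y i : peval p y = 0 ->
  peval (mderiv i (penalty beta N p)) y = peval (mderiv i p) y.
Proof.
move=> p0; rewrite mderivM pevalD !pevalM p0 mul0r addr0 !peval_simp p0.
by rewrite mulr0 subr0 expr1n mulr1.
Qed.

Lemma mderiv2_penalty beta N p y i j : peval p y = 0 ->
  peval (mderiv j (mderiv i (penalty beta N p))) y = peval (mderiv j (mderiv i p)) y -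
    (4 * N%:R / beta) * (peval (mderiv i p) y * peval (mderiv j p) y).
Proof.
move=> p0; set q := 1 - beta^-1 *: p.
have q1 : peval q y = 1 by rewrite !peval_simp p0 mulr0 subr0.
have dq k : peval (mderiv k (q ^+ (N * 2))) y = - (2 * N%:R / beta) * peval (mderiv k p) y.
  rewrite mderiv_exp_at// natrM mderivB -mpolyC1 mderivC sub0r mderivZ !peval_simp; ring.
rewrite /penalty -/q mderivM mderivD !mderivM !pevalD !pevalM !pevalXn.
rewrite !dq q1 p0 expr1n; ring.
Qed.

Lemma hess_penalty beta N p y v : peval p y = 0 ->
  hess (penalty beta N p) y v = hess p y v - (4 * N%:R / beta) * dird p y v ^+ 2.
Proof.
move=> p0; rewrite /hess /dird expr2 big_distrlr /= mulr_sumr -sumrB; apply: eq_bigr => i _.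
rewrite mulr_sumr -sumrB; apply: eq_bigr => j _.
by rewrite mderiv2_penalty//; ring.
Qed.

Lemma penalty_ge0 beta N p x : 0 <= peval p x -> 0 <= peval (penalty beta N p) x.
Proof. by move=> px; rewrite /penalty pevalM pevalXn exprM mulr_ge0// sqr_ge0. Qed.

Lemma penalty_anti beta N N' p x : 0 < beta -> 0 <= peval p x <= beta -> (N <= N')%N ->
  peval (penalty beta N' p) x <= peval (penalty beta N p) x.
Proof.
move=> b0 /andP[p0 pb] NN'; rewrite /penalty !pevalM !pevalXn ler_wpM2l//.
have h : 0 <= peval (1 - beta^-1 *: p) x <= 1.
  rewrite !peval_simp subr_ge0 mulrC ler_pdivrMr// mul1r pb /=.
  by rewrite gerBl divr_ge0// ltW.
by case/andP: h => h0 h1; apply: ler_wiXn2l => //; rewrite leq_mul2r NN' orbT.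
Qed.

Lemma penalty_small beta N p x : 0 < beta -> 0 <= peval p x <= beta -> (0 < N)%N ->
  peval (penalty beta N p) x <= beta / N%:R.
Proof.
move=> b0 /andP[p0 pb] N0; rewrite /penalty pevalM !peval_simp.
set s := peval p x; have s0 : 0 <= beta^-1 * s by rewrite mulr_ge0// invr_ge0 ltW.
have s1 : beta^-1 * s <= 1 by rewrite mulrC ler_pdivrMr// mul1r.
have sE : s = beta * (beta^-1 * s) by rewrite mulrA divff ?mul1r// gt_eqF.
rewrite {1}sE; set v := beta^-1 * s in s0 s1 *.
have h : -1 <= v <= 1 by lra.
have N1 : 1 <= N%:R :> R by rewrite ler1n.
have := bernoulli_decay (N * 2) h; set a := (1 - v) ^+ _ => ha.
have a0 : 0 <= a by apply: exprn_ge0; lra.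
rewrite ler_pdivlMr ?ltr0n// -mulrA -[X in _ <= X]mulr1 -mulrA ler_pM2l//.
by move: ha; rewrite natrM; nra.
Qed.

Lemma bscal_near x i : bscal (nbhs x) (fun y : 'rV[R]_n => y 0 i).
Proof.
exists (`|x| + 1); apply: filterS (norm_near x ltr01) => y yx.
rewrite (le_trans (coord_le _ _))// -[y](subrK x) addrC.
by rewrite (le_trans (ler_normD _ _))// lerD2l ltW.
Qed.

Lemma sum_coord_le (C : 'I_n -> 'I_n -> R) (e : R) v :
  (forall i j, C i j <= e) -> (forall i j, 0 <= C i j) -> 0 <= e ->
  \sum_i \sum_j C i j * `|v 0 i| * `|v 0 j| <= n%:R ^+ 2 * e * sqn v.
Proof.
move=> Ce C0 e0; apply: le_trans (_ : \sum_(i < n) \sum_(j < n) e * sqn v <= _).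
  apply: ler_sum => i _; apply: ler_sum => j _; rewrite -mulrA ler_pM//.
  have vi := coord_sqr_le v i; have vj := coord_sqr_le v j.
  have := sqr_ge0 (`|v 0 i| - `|v 0 j|); move: vi vj.
  rewrite -(real_normK (num_real (v 0 i))) -(real_normK (num_real (v 0 j))).
  by move: `|v 0 i| `|v 0 j| => a b; nra.
by rewrite !sumr_const !card_ord -mulrnA -natrX -mulrA mulr_natl.
Qed.

Lemma taylor_upper p x (c : R) : 0 < c ->
  exists2 rho : R, 0 < rho & forall y z, `|y - x| < rho -> `|z - x| < rho ->
    (forall v, hess p y v <= - c * sqn v) ->
    peval p z <= peval p y + dird p y (z - y) - (c / 4) * sqn (z - y).
Proof.
move=> c0.
have [A [bA eA hA]] := taylor2 (@bscal_near x) (bfam_cst (F := nbhs x) p).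
pose D := [set z : 'rV[R]_n | `|z - x| < 1].
have DB z i : D z -> `|z 0 i| <= `|x| + 1.
  move=> zx; rewrite (le_trans (coord_le _ _))// -[z](subrK x) addrC.
  by rewrite (le_trans (ler_normD _ _))// lerD2l ltW.
have /choice[C CP] (ij : 'I_n * 'I_n) : exists C : R, 0 < C /\
    \forall y \near x, forall z, D z ->
    `|peval (A ij.1 ij.2 y) z - peval (A ij.1 ij.2 y) y| <= C * `|z - y|.
  have [C C0 CC] := bfam_lipschitz (@bscal_near x) DB (bA ij.1 ij.2).
  by exists C.
pose C1 := 1 + \sum_ij C ij.
have Cge ij : C ij <= C1.
  rewrite /C1 (bigD1 ij)//= addrCA lerDl addr_ge0// sumr_ge0// => k _; by case: (CP k) => /ltW.
have C10 : 0 < C1 by rewrite /C1 ltr_wpDr// sumr_ge0// => k _; case: (CP k) => /ltW.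
have nearC : \forall y \near x, forall ij z, D z ->
    `|peval (A ij.1 ij.2 y) z - peval (A ij.1 ij.2 y) y| <= C1 * `|z - y|.
  pose P (ij : 'I_n * 'I_n) (y : 'rV[R]_n) := forall z, D z ->
    `|peval (A ij.1 ij.2 y) z - peval (A ij.1 ij.2 y) y| <= C1 * `|z - y|.
  have := @filter_forall _ _ P (nbhs x) (nbhs_filter x); apply => ij.
  case: (CP ij) => _; apply: filterS => y H z Dz.
  by rewrite (le_trans (H z Dz))// ler_wpM2r.
have [r0 r00 r0P] := near_norm nearC.
pose r1 := c / 8 / C1 / (n%:R ^+ 2 + 1).
have n1 : 0 < n%:R ^+ 2 + 1 :> R by rewrite ltr_wpDl// sqr_ge0.
have r10 : 0 < r1 by rewrite !divr_gt0.
exists (Num.min (Num.min 1 r0) r1); first by rewrite !lt_min ltr01 r00 r10.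
move=> y z; rewrite !lt_min => /andP[/andP[_ y0] y1] /andP[/andP[z1 _] z2] hy.
have Az ij := r0P y y0 ij z z1.
pose h := z - y.
have hn : `|h| <= 2 * r1.
  rewrite /h -(subrKA x) (le_trans (ler_normD _ _))// [`|x - y|]distrC; lra.
have pzE : peval p z = peval p y + dird p y h + \sum_i \sum_j peval (A i j y) z * h 0 i * h 0 j.
  rewrite {1}(eA y) !pevalD pevalC !peval_sum; congr (_ + _ + _).
    by apply: eq_bigr => i _; rewrite pevalM pevalC peval_dvar.
  apply: eq_bigr => i _; rewrite peval_sum; apply: eq_bigr => j _.
  by rewrite !pevalM !peval_dvar.
have hessE : hess p y h = 2 * \sum_i \sum_j peval (A i j y) y * h 0 i * h 0 j.
  have sw : \sum_i \sum_j peval (A i j y) y * h 0 i * h 0 j =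
      \sum_i \sum_j peval (A j i y) y * h 0 i * h 0 j.
    by rewrite exchange_big; apply: eq_bigr => i _; apply: eq_bigr => j _; rewrite mulrAC.
  rewrite mulr_natl mulr2n {2}sw -big_split; apply: eq_bigr => i _ /=.
  rewrite -big_split; apply: eq_bigr => j _ /=.
  by rewrite -hA !mulrDl.
have diff : \sum_i \sum_j peval (A i j y) z * h 0 i * h 0 j -
    \sum_i \sum_j peval (A i j y) y * h 0 i * h 0 j <= (c / 4) * sqn h.
  apply: le_trans (_ : \sum_i \sum_j `|peval (A i j y) z - peval (A i j y) y| * `|h 0 i| * `|h 0 j| <= _).
    rewrite -sumrB; apply: ler_sum => i _; rewrite -sumrB; apply: ler_sum => j _.
    by rewrite -!mulrBl (le_trans (ler_norm _))// !normrM.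
  apply: le_trans (@sum_coord_le _ (C1 * (2 * r1)) _ _ _ _) _.
  - move=> i j; apply: le_trans (Az (i, j)) _.
    by rewrite ler_wpM2l// ltW.
  - by [].
  - by apply: mulr_ge0; [exact: ltW|apply: mulr_ge0 => //; exact: ltW].
  - rewrite ler_wpM2r ?sqn_ge0//.
    have -> : n%:R ^+ 2 * (C1 * (2 * r1)) = (c / 4) * (n%:R ^+ 2 / (n%:R ^+ 2 + 1)).
      by rewrite /r1; field; rewrite (gt_eqF C10) (gt_eqF n1).
    by rewrite ler_piMr ?divr_ge0 ?(ltW c0)// ler_pdivrMr// mul1r lerDl.
have := hy h; rewrite hessE pzE; move: diff; rewrite -/h.
set s1 := \sum_i \sum_j _ * _ * _; set s2 := \sum_i \sum_j _ * _ * _.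
by move: (sqn h) (peval p y) (dird p y h) s1 s2 => s a b s1 s2; lra.
Qed.

(** Passing from p to its penalty subtracts (4 N / beta) (grad p)^T (grad p) from the
Hessian, which is what Finsler's lemma asks for. *)
Lemma local_penalty beta p x : 0 < beta ->
  (peval p x = 0 -> strictly_quasiconcave_at p x) ->
  exists N0 c, [/\ 0 < c,
    \forall y \near x, peval p y = 0 -> forall N, (N0 <= N)%N ->
      forall v, hess (penalty beta N p) y v <= - c * sqn v &
    forall N, (N0 <= N)%N -> exists2 rho : R, 0 < rho & forall y z,
      `|y - x| < rho -> `|z - x| < rho -> peval p y = 0 ->
      peval (penalty beta N p) z <= dird p y (z - y) - c * sqn (z - y)].
Proof.
move=> b0; have [px0 /(_ px0) qc|pxn0 _] := eqVneq (peval p x) 0; last first.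
  have near0 : \forall y \near x, peval p y != 0.
    have e0 : 0 < `|peval p x| by rewrite normr_gt0.
    apply: filterS (near_peval_dist p x e0) => y; apply: contraTneq => ->.
    by rewrite sub0r normrN ltxx.
  exists 0%N, 1; split=> //.
    by apply: filterS near0 => y /eqP.
  have [r r0 rP] := near_norm near0.
  by move=> N _; exists r => // y z /rP /eqP.
have [k [c [k0 c0 kc]]] := strictly_quasiconcave_near qc.
pose N0 := (Num.truncn (k * beta / 4)).+1.
have hN : \forall y \near x, peval p y = 0 -> forall N, (N0 <= N)%N ->
      forall v, hess (penalty beta N p) y v <= - c * sqn v.
  apply: filterS kc => y H py0 N NN0 v; rewrite hess_penalty//.
  apply: le_trans (H v); rewrite lerD2l lerN2 ler_wpM2r ?sqr_ge0//.
  have : k * beta / 4 <= N%:R.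
    by apply: le_trans (ltW (truncnS_gt _)) _; rewrite ler_nat.
  by rewrite ler_pdivlMr//; lra.
exists N0, (c / 4); split; first by rewrite divr_gt0.
  apply: filterS hN => y H py0 N NN0 v; apply: le_trans (H py0 N NN0 v) _.
  by rewrite ler_wpM2r ?sqn_ge0//; lra.
move=> N NN0; have [r1 r10 r1P] := near_norm hN.
have [r2 r20 r2P] := taylor_upper (penalty beta N p) x c0.
exists (Num.min r1 r2); first by rewrite lt_min r10 r20.
move=> y z; rewrite !lt_min => /andP[y1 y2] /andP[z1 z2] py0.
have pen0 : peval (penalty beta N p) y = 0 by rewrite /penalty pevalM py0 mul0r.
have := r2P y z y2 z2 (r1P y y1 py0 N NN0); rewrite pen0 add0r.
rewrite (_ : dird (penalty beta N p) y (z - y) = dird p y (z - y))//.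
by apply: eq_bigr => i _; rewrite mderiv_penalty.
Qed.

End Penalty.

(** * Optimality conditions for affine forms *)

Section Farkas.
Context {R : realType} {n : nat}.
Implicit Types (a b d : 'rV[R]_n).

Definition dotv a d : R := \sum_j a 0 j * d 0 j.

Lemma dotvDl a b d : dotv (a + b) d = dotv a d + dotv b d.
Proof. by rewrite /dotv -big_split; apply: eq_bigr => j _; rewrite mxE mulrDl. Qed.
Lemma dotvDr a b d : dotv d (a + b) = dotv d a + dotv d b.
Proof. by rewrite /dotv -big_split; apply: eq_bigr => j _; rewrite mxE mulrDr. Qed.
Lemma dotvZl c a d : dotv (c *: a) d = c * dotv a d.
Proof. by rewrite /dotv mulr_sumr; apply: eq_bigr => j _; rewrite mxE mulrA. Qed.
Lemma dotvZr c a d : dotv a (c *: d) = c * dotv a d.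
Proof. by rewrite /dotv mulr_sumr; apply: eq_bigr => j _; rewrite mxE mulrCA. Qed.
Lemma dotvv a : dotv a a = sqn a.
Proof. by apply: eq_bigr => j _; rewrite expr2. Qed.
Lemma dotv0l d : dotv 0 d = 0.
Proof. by rewrite /dotv big1// => j _; rewrite mxE mul0r. Qed.
Lemma dotv_sum (I : finType) (F : I -> 'rV[R]_n) d : dotv (\sum_i F i) d = \sum_i dotv (F i) d.
Proof. exact: (big_morph (fun a => dotv a d) (fun a b => dotvDl a b d) (dotv0l d)). Qed.

(** Induction on m.  If a_1, ..., a_m do not suffice, some d0 is nonnegative on them
and negative on b, hence negative on a_0.  Projecting along d0 onto the kernel of
a_0 reduces to m vectors, and the coefficient of a_0 comes out nonnegative. *)
Lemma farkas m (a : 'I_m -> 'rV[R]_n) b :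
  (forall d, (forall i, 0 <= dotv (a i) d) -> 0 <= dotv b d) ->
  exists lam : 'I_m -> R, (forall i, 0 <= lam i) /\ b = \sum_i lam i *: a i.
Proof.
elim: m a b => [|m IH] a b ab.
  exists (fun=> 0); split=> //; rewrite big_ord0.
  have := ab (- b); rewrite -scaleN1r dotvZr dotvv => /(_ _)/[!mulN1r] h.
  apply/eqP; rewrite -sqn_eq0 eq_le sqn_ge0 andbT -oppr_ge0.
  by apply: h => -[].
pose a' i := a (lift ord0 i).
have [H|/existsNP[d0 /not_implyP[a'd0 bd0]]] :=
    pselect (forall d, (forall i, 0 <= dotv (a' i) d) -> 0 <= dotv b d).
  have [lam [lam0 bE]] := IH a' b H.
  exists (fun i => oapp lam 0 (unlift ord0 i)); split=> [i|].
    by case: unliftP => [j|] _ //=; exact: lam0.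
  rewrite big_ord_recl unlift_none /= scale0r add0r bE.
  by apply: eq_bigr => i _; rewrite liftK.
have a0d0 : dotv (a ord0) d0 < 0.
  rewrite ltNge; apply/negP => h; apply: bd0; apply: ab => i.
  by case: (unliftP ord0 i) => [j|] ->//; exact: a'd0.
have {}bd0 : dotv b d0 < 0 by rewrite ltNge; apply/negP.
pose d1 := (- dotv (a ord0) d0)^-1 *: d0.
have a0d1 : dotv (a ord0) d1 = -1.
  by rewrite dotvZr invrN mulNr mulVf// lt_eqF.
have a'd1 i : 0 <= dotv (a' i) d1.
  by rewrite dotvZr mulr_ge0 ?a'd0// invr_ge0 oppr_ge0 ltW.
have bd1 : dotv b d1 < 0.
  by rewrite dotvZr pmulr_rlt0// invr_gt0 oppr_gt0.
have [|mu [mu0 muE]] := IH (fun i => a' i + dotv (a' i) d1 *: a ord0) (b + dotv b d1 *: a ord0).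
  move=> d ad; have := ab (d + dotv (a ord0) d *: d1).
  rewrite dotvDl dotvDr !dotvZl dotvZr mulrC; apply => i.
  rewrite dotvDr dotvZr; case: (unliftP ord0 i) => [j ->|->].
    by have := ad j; rewrite dotvDl dotvZl /a' mulrC.
  by rewrite a0d1 mulrN1 subrr.
exists (fun i => oapp mu (\sum_i mu i * dotv (a' i) d1 - dotv b d1) (unlift ord0 i)).
split=> [i|].
  case: unliftP => [j|] _ /=; first exact: mu0.
  by rewrite subr_ge0 (le_trans (ltW bd1))// sumr_ge0// => j _; rewrite mulr_ge0.
rewrite big_ord_recl unlift_none /=.
rewrite [X in _ = _ + X](_ : _ = \sum_i mu i *: a' i); last first.
  by apply: eq_bigr => i _; rewrite liftK.
rewrite [LHS](_ : b = \sum_i mu i *: (a' i + dotv (a' i) d1 *: a ord0) - dotv b d1 *: a ord0);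
  last by rewrite -muE addrK.
rewrite (_ : \sum_i mu i *: _ = \sum_i mu i *: a' i + (\sum_i mu i * dotv (a' i) d1) *: a ord0).
  by rewrite scalerBl -addrA addrC.
rewrite scaler_suml -big_split; apply: eq_bigr => i _ /=.
by rewrite scalerDr scalerA.
Qed.

End Farkas.

Section AffineForms.
Context {R : realType} {n : nat}.
Implicit Types (u : 'rV[R]_n.+1) (x y d : 'rV[R]_n).

(** A vector with n + 1 entries encodes an affine form: its constant term followed by
the coefficients of its linear part. *)
Definition linp u : 'rV[R]_n := \row_i u 0 (lift ord0 i).
Definition aff u : {mpoly R[n]} := mpolyC n (u 0 ord0) + \sum_i linp u 0 i *: pvar i.

Lemma peval_aff u x : peval (aff u) x = u 0 ord0 + dotv (linp u) x.
Proof.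
rewrite pevalD pevalC peval_sum; congr (_ + _); apply: eq_bigr => i _.
by rewrite pevalZ peval_var.
Qed.

Lemma peval_affD u x d : peval (aff u) (x + d) = peval (aff u) x + dotv (linp u) d.
Proof. by rewrite !peval_aff dotvDr addrA. Qed.

Lemma aff_expand u y : aff u = mpolyC n (peval (aff u) y) + \sum_i linp u 0 i *: dvar y i.
Proof.
rewrite peval_aff mpolyCD -addrA; congr (_ + _).
rewrite (big_morph (@mpolyC n R) (@mpolyCD n R) (@mpolyC0 n R)) -big_split.
apply: eq_bigr => i _ /=; rewrite /dvar scalerBr mpolyCM mul_mpolyC addrC subrK//.
Qed.

Lemma deg_le1_aff (l : {mpoly R[n]}) : deg_le 1 l ->
  l = aff (\row_i oapp (fun j => mcoeff (mnm1 j) l) (mcoeff mnm0 l) (unlift ord0 i)).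
Proof.
rewrite /deg_le => dl; apply/mpolyP => mu; rewrite mcoeffD mcoeffC mxE unlift_none /=.
rewrite (big_morph (mcoeff mu) (mcoeffD mu) (mcoeff0 _ mu)).
under eq_bigr do rewrite mcoeffZ !mxE liftK /= mcoeffX.
have [->|mu0] := eqVneq mu mnm0.
  rewrite mulr1 big1 ?addr0// => i _.
  have /negPf -> : mnm1 i != mnm0 by rewrite -mdeg_eq0 mdeg1.
  by rewrite mulr0.
rewrite mulr0 add0r; have [/mdeg1P[i /eqP ->]|mu1] := boolP (mdeg mu == 1%N).
  rewrite (bigD1 i)//= eqxx mulr1 big1 ?addr0// => j ji.
  have /negPf -> : mnm1 j != mnm1 i.
    apply: contra ji => /eqP /(congr1 (fun m : multinom n => m i)).
    by rewrite !mnmE eqxx; case: eqP.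
  by rewrite mulr0.
rewrite big1; last first.
  move=> j _; have /negPf -> : mnm1 j != mu by apply: contra mu1 => /eqP <-; rewrite mdeg1.
  by rewrite mulr0.
apply/eqP; rewrite mcoeff_eq0; apply: contra mu1 => /msize_mdeg_lt mul.
have := leq_trans mul dl; rewrite ltnS leq_eqVlt => /orP[//|].
by rewrite ltnS leqn0 mdeg_eq0 (negPf mu0).
Qed.

End AffineForms.

Lemma addrDK (V : zmodType) (x d : V) : x + d - x = d.
Proof. by rewrite addrC addKr. Qed.

Section OptimalityConditions.
Context {R : realType} {n m : nat} (g : 'I_m -> {mpoly R[n]}).
Implicit Types (u : 'rV[R]_n.+1) (x y d v : 'rV[R]_n).
Local Notation S := (basic_semialg g).

Lemma dird_dotv (p : {mpoly R[n]}) x v : dird p x v = dotv (\row_i peval (mderiv i p) x) v.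
Proof. by apply: eq_bigr => i _; rewrite mxE. Qed.

Lemma norm_scale_small (r : R) d : 0 < r ->
  exists2 s0 : R, 0 < s0 & forall s, 0 < s < s0 -> `|s *: d| < r.
Proof.
move=> r0; have d1 : 0 < `|d| + 1 by rewrite ltr_wpDl.
exists (r / (`|d| + 1)); first by rewrite divr_gt0.
move=> s /andP[sp ss]; rewrite normrZ gtr0_norm//.
rewrite ltr_pdivlMr// in ss; apply: le_lt_trans ss.
by rewrite ler_pM2l// lerDl.
Qed.

(** Along a direction of strict increase, g_i (y + s d) is s times a polynomial that
is positive at y. *)
Lemma feasible_direction y d (r : R) : S y -> 0 < r ->
  (forall i, peval (g i) y = 0 -> 0 < dird (g i) y d) ->
  exists s : R, [/\ 0 < s, S (y + s *: d) & `|s *: d| < r].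
Proof.
move=> Sy r0 yd.
have step i : exists s0 : R, 0 < s0 /\ forall s, 0 < s < s0 -> 0 <= peval (g i) (y + s *: d).
  have [gi0|gin0] := eqVneq (peval (g i) y) 0; last first.
    have gip : 0 < peval (g i) y by rewrite lt_def gin0 Sy.
    have [r1 r10 r1P] := near_norm (near_peval_gt0 gip).
    have [s0 s00 s0P] := norm_scale_small d r10.
    by exists s0; split=> // s /s0P ss; apply/ltW/r1P; rewrite addrDK.
  have [|B [bB eB]] := @hadamard _ _ _ (nbhs y) _ (fun=> y) _ _ (bfam_cst (F := nbhs y) (g i)).
    by move=> j; exact: bscal_cst.
  have {}eB := eB y; rewrite gi0 mpolyC0 add0r in eB.
  pose P := \sum_j d 0 j *: B j y.
  have P0 : 0 < peval P y.
    rewrite peval_sum; have := yd i gi0; congr (_ < _); apply: eq_bigr => j _.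
    by rewrite pevalZ mulrC (@hadamard_mderiv _ _ (g i) 0 (fun j => B j y))// mpolyC0 add0r.
  have [r1 r10 r1P] := near_norm (near_peval_gt0 P0).
  have [s0 s00 s0P] := norm_scale_small d r10.
  exists s0; split=> // s ss; have /andP[sp _] := ss.
  have -> : peval (g i) (y + s *: d) = s * peval P (y + s *: d).
    rewrite {1}eB !peval_sum mulr_sumr; apply: eq_bigr => j _.
    by rewrite pevalM pevalZ peval_dvar addrDK mxE; ring.
  by rewrite mulr_ge0 ?(ltW sp)// ltW// r1P// addrDK s0P.
have /choice[s0 s0P] := step.
have [s1 s10 s1P] := norm_scale_small d r0.
pose s2 := \big[Num.min/s1]_i s0 i.
have s20 : 0 < s2 by rewrite /s2; elim/big_ind: _ => // [a b a0 b0|i _]; [rewrite lt_min a0|case: (s0P i)].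
exists (s2 / 2); split; first by rewrite divr_gt0.
  move=> i; apply: (s0P i).2; rewrite divr_gt0//=.
  by apply: lt_le_trans (_ : s2 <= _); [lra|exact: bigmin_le_cond].
apply: s1P; rewrite divr_gt0//=.
by apply: lt_le_trans (_ : s2 <= _); [lra|exact: bigmin_le_id].
Qed.

(** If d is nonnegative on the active gradients and decreases the form, then so does
d + e v0, along which one can move inside S.  Hence Farkas' lemma applies. *)
Lemma kkt y v0 u (r : R) : S y -> 0 < r ->
  (forall i, peval (g i) y = 0 -> 0 < dird (g i) y v0) ->
  (forall z, S z -> `|z - y| < r -> peval (aff u) y <= peval (aff u) z) ->
  exists lam : 'I_m -> R, [/\ forall i, 0 <= lam i,
    forall i, lam i != 0 -> peval (g i) y = 0 &
    linp u = \sum_i lam i *: \row_j peval (mderiv j (g i)) y].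
Proof.
move=> Sy r0 yv0 ymin.
(* Inactive constraints are discarded by giving them the zero vector. *)
pose a i := if peval (g i) y == 0 then \row_j peval (mderiv j (g i)) y else 0.
have [|lam [lam0 lamE]] := @farkas _ _ m a (linp u).
  move=> d ad; rewrite leNgt; apply/negP => ud.
  pose e := - dotv (linp u) d / (2 * (`|dotv (linp u) v0| + 1)).
  have n0 : 0 < `|dotv (linp u) v0| + 1 by rewrite ltr_wpDl.
  have e0 : 0 < e by rewrite divr_gt0 ?oppr_gt0// mulr_gt0.
  have d'u : dotv (linp u) (d + e *: v0) < 0.
    rewrite dotvDr dotvZr.
    have : e * dotv (linp u) v0 <= - dotv (linp u) d / 2.
      rewrite /e invfM mulrA -mulrA ler_piMr ?divr_ge0 ?oppr_ge0 ?(ltW ud)//.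
      rewrite mulrC ler_pdivrMr// mul1r (le_trans (ler_norm _))// lerDl//.
    by move: ud; move: (dotv (linp u) d) => t; lra.
  have [|s [s0 Ss sr]] := @feasible_direction y (d + e *: v0) r Sy r0.
    move=> i gi0; have := ad i; rewrite /a gi0 eqxx => h.
    by rewrite dird_dotv dotvDr dotvZr ltr_wpDl// mulr_gt0// -dird_dotv yv0.
  have := ymin _ Ss; rewrite addrDK => /(_ sr).
  by rewrite peval_affD lerDl dotvZr pmulr_rge0// leNgt d'u.
exists (fun i => if peval (g i) y == 0 then lam i else 0); split.
- by move=> i; case: ifP.
- by move=> i; case: (eqVneq (peval (g i) y) 0) => // _; rewrite eqxx.
- rewrite lamE; apply: eq_bigr => i _; rewrite /a; case: ifP => // _.
  by rewrite scaler0 scale0r.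
Qed.

Lemma not_isolated x (r : R) (i0 : 'I_n) : closure S° x -> 0 < r ->
  exists z, [/\ S z, z != x & `|z - x| < r].
Proof.
move=> clx r0; have [p [/= Sp px]] := clx _ (norm_near x r0).
have [px0|pn] := eqVneq p x; last first.
  by exists p; split=> //; exact: interior_subset Sp.
have [r1 r10 r1P] := near_norm Sp.
have m0 : 0 < Num.min r r1 by rewrite lt_min r0.
pose s := Num.min r r1 / 2.
have s0 : 0 < s by rewrite divr_gt0.
have ns : `|s *: (delta_mx 0 i0 : 'rV[R]_n)| < Num.min r r1.
  rewrite normrZ gtr0_norm//; apply: le_lt_trans (_ : s < _); last by rewrite /s; lra.
  rewrite ler_piMr ?(ltW s0)//; apply: norm_le_coord => // j.
  by rewrite mxE /=; case: (_ == _); rewrite ?normr1 ?normr0.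
move: ns; rewrite lt_min => /andP[ns1 ns2].
exists (x + s *: delta_mx 0 i0); split.
- by apply: r1P; rewrite px0 addrDK.
- rewrite -subr_eq0 addrDK; apply/eqP => /rowP/(_ i0).
  by rewrite !mxE !eqxx mulr1 => /eqP; rewrite gt_eqF.
- by rewrite addrDK.
Qed.

Lemma halfspace_convex u : @convex_set R 'rV[R]_n [set x | 0 <= peval (aff u) x].
Proof.
move=> x y lambda /set_mem /= x0 /set_mem /= y0; apply/mem_set => /=.
rewrite /conv /= peval_aff; move: x0 y0; rewrite !peval_aff => x0 y0.
have -> : u 0 ord0 + dotv (linp u) (lambda%:num *: x + (1 - lambda%:num) *: y) =
   lambda%:num * (u 0 ord0 + dotv (linp u) x) + (1 - lambda%:num) * (u 0 ord0 + dotv (linp u) y).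
  by rewrite dotvDr !dotvZr; ring.
by rewrite addr_ge0 ?mulr_ge0// subr_ge0.
Qed.

(** Moving from x against the gradient of the form leaves a half-space that contains
the convex hull. *)
Lemma supporting_point_convbd u x : S x -> peval (aff u) x = 0 ->
  (forall z, S z -> 0 <= peval (aff u) z) -> linp u != 0 -> convbd S x.
Proof.
move=> Sx ux0 uS u0; split=> //; split.
  by apply: subset_closure; exact: sub_gen_smallest.
move=> /near_norm[r r0 rP].
have hull z : conv_hull S z -> 0 <= peval (aff u) z.
  have : conv_hull S `<=` [set x | 0 <= peval (aff u) x].
    by apply: smallest_sub => //; exact: halfspace_convex.
  by apply.
have [s0 s00 s0P] := norm_scale_small (- linp u) r0.
have ss : 0 < s0 / 2 < s0 by rewrite divr_gt0//=; lra.
have := hull (x + (s0 / 2) *: (- linp u)) (rP _ _).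
rewrite addrDK => /(_ (s0P _ ss)).
rewrite peval_affD ux0 add0r dotvZr -scaleN1r dotvZr dotvv.
have : 0 < sqn (linp u) by rewrite sqn_gt0.
by move: (sqn _) => q q0; rewrite pmulr_rge0 ?divr_gt0//; lra.
Qed.

End OptimalityConditions.

(** * Multipliers near a zero of a nonnegative form *)

Section LocalMultipliers.
Context {R : realType} {n m : nat} (g : 'I_m -> {mpoly R[n]}).
Hypothesis garch : quad_archimedean g.
Local Notation S := (basic_semialg g).
Variable beta : R.
Hypotheses (beta0 : 0 < beta).
Implicit Types (u : 'rV[R]_n.+1) (x y z v : 'rV[R]_n).

Lemma local_penalties x :
  (forall i, peval (g i) x = 0 -> strictly_quasiconcave_at (g i) x) ->
  exists N0 c rho, [/\ 0 < c, 0 < rho,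
    forall y, `|y - x| < rho -> forall i, peval (g i) y = 0 -> forall N, (N0 <= N)%N ->
      forall v, hess (penalty beta N (g i)) y v <= - c * sqn v &
    forall y z, `|y - x| < rho -> `|z - x| < rho -> forall i, peval (g i) y = 0 ->
      peval (penalty beta N0 (g i)) z <= dird (g i) y (z - y) - c * sqn (z - y)].
Proof.
move=> qc.
have /choice[Nc NcP] i : exists Nc : nat * R, [/\ 0 < Nc.2,
    \forall y \near x, peval (g i) y = 0 -> forall N, (Nc.1 <= N)%N ->
      forall v, hess (penalty beta N (g i)) y v <= - Nc.2 * sqn v &
    forall N, (Nc.1 <= N)%N -> exists2 rho : R, 0 < rho & forall y z,
      `|y - x| < rho -> `|z - x| < rho -> peval (g i) y = 0 ->
      peval (penalty beta N (g i)) z <= dird (g i) y (z - y) - Nc.2 * sqn (z - y)].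
  by have [N [c H]] := local_penalty beta0 (qc i); exists (N, c).
pose N0 := \max_i (Nc i).1; pose c := \big[Num.min/1]_i (Nc i).2.
have N0i i : ((Nc i).1 <= N0)%N by exact: leq_bigmax.
have c0 : 0 < c.
  rewrite /c; elim/big_ind: _ => // [a b a0 b0|i _]; first by rewrite lt_min a0.
  by case: (NcP i).
have ci i : c <= (Nc i).2 by exact: bigmin_le_cond.
have /choice[r rP] i : exists r : R, 0 < r /\
    (forall y, `|y - x| < r -> peval (g i) y = 0 -> forall N, (N0 <= N)%N ->
      forall v, hess (penalty beta N (g i)) y v <= - c * sqn v) /\
    (forall y z, `|y - x| < r -> `|z - x| < r -> peval (g i) y = 0 ->
      peval (penalty beta N0 (g i)) z <= dird (g i) y (z - y) - c * sqn (z - y)).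
  have [_ /near_norm[r1 r10 r1P] /(_ N0 (N0i i))[r2 r20 r2P]] := NcP i.
  exists (Num.min r1 r2); split; first by rewrite lt_min r10.
  split=> [y|y z]; rewrite !lt_min.
    move=> /andP[/r1P H _] gy0 N NN v; apply: le_trans (H gy0 N _ v) _.
      exact: leq_trans (N0i i) NN.
    by rewrite ler_wpM2r ?sqn_ge0// lerN2 ci.
  move=> /andP[_ y2] /andP[_ z2] gy0; apply: le_trans (r2P y z y2 z2 gy0) _.
  by rewrite lerD2l lerN2 ler_wpM2r ?sqn_ge0// ci.
pose rho := \big[Num.min/1]_i r i.
have rhoi i : rho <= r i by exact: bigmin_le_cond.
exists N0, c, rho; split=> //.
- rewrite /rho; elim/big_ind: _ => // [a b a0 b0|i _]; first by rewrite lt_min a0.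
  by case: (rP i).
- by move=> y yr i; case: (rP i) => _ [H _]; apply: H; exact: lt_le_trans (rhoi i).
- move=> y z yr zr i; case: (rP i) => _ [_ H].
  by apply: H; [exact: lt_le_trans (rhoi i)|exact: lt_le_trans (rhoi i)].
Qed.

Lemma near_uniform_aff u0 (e : R) : 0 < e ->
  \forall u \near u0, forall x, S x -> `|peval (aff u) x - peval (aff u0) x| < e.
Proof.
move=> e0; have [B BP] := basic_semialg_bounded garch.
pose C := 1 + n%:R * `|B|.
have C0 : 0 < C by rewrite ltr_wpDr// mulr_ge0.
have eC : 0 < e / C by rewrite divr_gt0.
apply: filterS (norm_near u0 eC) => u uu x Sx.
have -> : peval (aff u) x - peval (aff u0) x =
    (u - u0) 0 ord0 + \sum_i (u - u0) 0 (lift ord0 i) * x 0 i.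
  rewrite !peval_aff opprD addrACA !mxE; congr (_ + _).
  by rewrite -sumrB; apply: eq_bigr => i _; rewrite !mxE mulrBl.
rewrite ltr_pdivlMr// in uu; apply: le_lt_trans uu.
rewrite /C mulrDr mulr1 (le_trans (ler_normD _ _))// lerD ?coord_le//.
rewrite (le_trans (ler_norm_sum _ _ _))// mulrCA.
apply: le_trans (_ : \sum_(i < n) `|u - u0| * `|B| <= _).
  apply: ler_sum => i _; rewrite normrM ler_pM ?coord_le//.
  by rewrite (le_trans (BP _ _ Sx))// ler_norm.
by rewrite sumr_const card_ord mulr_natl.
Qed.

Lemma linp_near u0 j (e : R) : 0 < e -> \forall u \near u0, `|linp u 0 j - linp u0 0 j| < e.
Proof.
move=> e0; apply: filterS (norm_near u0 e0) => u; apply: le_lt_trans.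
by have := coord_le (u - u0) (lift ord0 j); rewrite !mxE.
Qed.

(** Second-order sufficient conditions at y for the Lagrangian built from the penalty
polynomials, with constants that depend on x only and so serve all y near x. *)
Definition good_multipliers N0 c rho Lam x u y (lam : 'I_m -> R) := [/\
  forall i, 0 <= lam i <= Lam,
  forall i, lam i != 0 -> peval (g i) y = 0,
  linp u = \sum_i lam i *: \row_j peval (mderiv j (g i)) y,
  forall z, S z -> `|z - x| < rho ->
    c * sqn (z - y) <= peval (aff u) z - peval (aff u) y -
      \sum_i lam i * peval (penalty beta N0 (g i)) z &
  forall N, (N0 <= N)%N -> forall v,
    \sum_i lam i * hess (penalty beta N (g i)) y v <= - (2 * c) * sqn v].

(** A point of S near x gives a direction v0 along which all active constraints
increase at a definite rate.  Pairing the multiplier rule with v0 bounds the sum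
of the multipliers from above; it is bounded from below because the linear part
of l stays away from 0. *)
Lemma local_multipliers x u0 : linp u0 != 0 ->
  (forall i, peval (g i) x = 0 -> strictly_quasiconcave_at (g i) x) ->
  (forall r : R, 0 < r -> exists z, [/\ S z, z != x & `|z - x| < r]) ->
  exists N0 c rho Lam, [/\ 0 < c, 0 < rho, 0 < Lam &
    \forall u \near u0, forall y (r : R), S y -> `|y - x| < rho -> 0 < r ->
      (forall z, S z -> `|z - y| < r -> peval (aff u) y <= peval (aff u) z) ->
      exists lam, good_multipliers N0 c rho Lam x u y lam].
Proof.
move=> u0n0 qc iso; have [N0 [c1 [rho0 [c10 rho00 hP pP]]]] := local_penalties qc.
have [z0 [Sz0 z0x z0r]] := iso _ rho00; pose v0 := z0 - x.
have v00 : 0 < sqn v0 by rewrite sqn_gt0 subr_eq0.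
pose th := c1 * sqn v0; have th0 : 0 < th by rewrite mulr_gt0.
have xv0 i : peval (g i) x = 0 -> th <= dird (g i) x v0.
  move=> gx0; have := pP x z0 _ z0r i gx0; rewrite subrr normr0 => /(_ rho00).
  have := penalty_ge0 beta N0 (Sz0 i); rewrite -/v0 /th; lra.
have near1 : \forall y \near x, forall i, peval (g i) y = 0 -> th / 2 <= dird (g i) y v0.
  pose P i (y : 'rV[R]_n) := peval (g i) y = 0 -> th / 2 <= dird (g i) y v0.
  have := @filter_forall _ _ P (nbhs x) (nbhs_filter x); apply => i.
  have [gx0|gxn0] := eqVneq (peval (g i) x) 0; last first.
    have e0 : 0 < `|peval (g i) x| by rewrite normr_gt0.
    apply: filterS (near_peval_dist (g i) x e0) => y + gy0.
    by rewrite gy0 sub0r normrN ltxx.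
  pose q := \sum_j v0 0 j *: mderiv j (g i).
  have qE y : peval q y = dird (g i) y v0.
    by rewrite peval_sum; apply: eq_bigr => j _; rewrite pevalZ mulrC.
  have th2 : 0 < th / 2 by rewrite divr_gt0.
  apply: filterS (near_peval_dist q x th2) => y; rewrite !qE => H _.
  by have := xv0 i gx0; move: H; rewrite ltr_norml; lra.
pose G0 := \sum_i \sum_j (`|peval (mderiv j (g i)) x| + 1).
pose G := G0 + 1.
have near2 : \forall y \near x, forall ij, `|peval (mderiv ij.2 (g ij.1)) y| <= G.
  pose P (ij : 'I_m * 'I_n) (y : 'rV[R]_n) := `|peval (mderiv ij.2 (g ij.1)) y| <= G.
  have := @filter_forall _ _ P (nbhs x) (nbhs_filter x); apply => -[i j].
  apply: filterS (near_peval_dist (mderiv j (g i)) x ltr01) => y H.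
  apply: (@le_trans _ _ (`|peval (mderiv j (g i)) x| + 1)).
    by have := ler_normB (peval (mderiv j (g i)) y - peval (mderiv j (g i)) x)
       (- peval (mderiv j (g i)) x); rewrite opprK subrK normrN; lra.
  have sge (I : finType) (E : I -> R) (k : I) : (forall k, 0 <= E k) -> E k <= \sum_k E k.
    by move=> E0; rewrite (bigD1 k)//= lerDl sumr_ge0.
  have D0 k l : 0 <= `|peval (mderiv l (g k)) x| + 1 by rewrite addr_ge0.
  rewrite ler_wpDr//; apply: le_trans (sge _ _ j (D0 i)) _.
  by apply: (sge _ (fun k => \sum_l (`|peval (mderiv l (g k)) x| + 1))) => k; exact: sumr_ge0.
have G0' : 0 < G.
  by rewrite ltr_wpDl// sumr_ge0// => i _; rewrite sumr_ge0// => j _; rewrite addr_ge0.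
have [rho1 rho10 rho1P] := near_norm (filterI near1 near2).
have [j0 j0P] : exists j0, linp u0 0 j0 != 0.
  by apply/existsP; apply: contraNT u0n0 => /existsPn H; apply/eqP/rowP => j;
    rewrite [RHS]mxE; apply/eqP; rewrite -[_ == _]negbK H.
pose eta := `|linp u0 0 j0| / 2.
have eta0 : 0 < eta by rewrite divr_gt0// normr_gt0.
pose V := `|dotv (linp u0) v0| + n%:R * `|v0| .
have V0 : 0 <= V by rewrite addr_ge0// mulr_ge0.
exists N0, (c1 * (eta / G) / 2), (Num.min rho0 rho1), (V / (th / 2) + 1).
split; [by apply: divr_gt0 => //; apply: mulr_gt0 => //; exact: divr_gt0|by rewrite lt_min rho00|
  by rewrite ltr_wpDl// divr_ge0// ltW ?divr_gt0|].
have near3 : \forall u \near u0, `|u - u0| < 1 by exact: norm_near.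
apply: filterS2 near3 (linp_near u0 j0 eta0) => u uu uj y r Sy.
rewrite lt_min => /andP[y0 y1] r0 ymin.
have [/= yv ydG] := rho1P y y1.
have [|lam [lam0 lamA lamE]] := @kkt _ _ _ g y v0 u r Sy r0 _ ymin.
  by move=> i gy0; apply: lt_le_trans (yv i gy0); rewrite divr_gt0.
exists lam; pose L := \sum_i lam i.
have lamL i : lam i <= L by rewrite /L (bigD1 i)//= lerDl sumr_ge0.
have dotE v : dotv (linp u) v = \sum_i lam i * dird (g i) y v.
  rewrite lamE dotv_sum; apply: eq_bigr => i _; by rewrite dotvZl dird_dotv.
have LV : L * (th / 2) <= V.
  apply: le_trans (_ : dotv (linp u) v0 <= _).
    rewrite dotE mulr_suml; apply: ler_sum => i _.
    have [->|li] := eqVneq (lam i) 0; first by rewrite !mul0r.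
    by rewrite ler_wpM2l// yv// lamA.
  have -> : linp u = linp u0 + linp (u - u0).
    by apply/rowP => j; rewrite !mxE; ring.
  rewrite dotvDl lerD ?ler_norm//; apply: le_trans (ler_norm _) _.
  rewrite (le_trans (ler_norm_sum _ _ _))//.
  apply: le_trans (_ : \sum_(i < n) `|v0| <= _); last by rewrite sumr_const card_ord mulr_natl.
  apply: ler_sum => i _; rewrite normrM -[leRHS]mul1r ler_pM ?coord_le//.
  apply: le_trans (ltW uu); rewrite mxE; exact: coord_le.
have Leta : eta / G <= L.
  rewrite ler_pdivrMr//; apply: le_trans (_ : `|linp u 0 j0| <= _).
    have := ler_normB (linp u0 0 j0 - linp u 0 j0) (- linp u 0 j0).
    by rewrite opprK subrK normrN; move: uj; rewrite distrC /eta; lra.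
  rewrite lamE summxE mulr_suml (le_trans (ler_norm_sum _ _ _))//; apply: ler_sum => i _.
  rewrite !mxE normrM ger0_norm// ler_wpM2l//; exact: (ydG (i, j0)).
have Lth : L <= V / (th / 2) by rewrite ler_pdivlMr// divr_gt0.
split=> //.
- by move=> i; rewrite lam0 (le_trans (lamL i))// (le_trans Lth)// lerDl.
- move=> z Sz; rewrite lt_min => /andP[z0' _].
  have -> : peval (aff u) z - peval (aff u) y = \sum_i lam i * dird (g i) y (z - y).
    by rewrite -dotE -{1}[z](subrK y) addrC [z - y + y]addrC peval_affD addrC addrDK.
  have H : L * (c1 * sqn (z - y)) <= \sum_i lam i * dird (g i) y (z - y) -
      \sum_i lam i * peval (penalty beta N0 (g i)) z.
    rewrite mulr_suml -sumrB; apply: ler_sum => i _; rewrite -mulrBr.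
    have [->|li] := eqVneq (lam i) 0; first by rewrite !mul0r.
    rewrite ler_wpM2l//; have := pP y z y0 z0' i (lamA i li); lra.
  apply: le_trans H; rewrite [leRHS]mulrA ler_wpM2r ?sqn_ge0//.
  have : 0 <= c1 * (eta / G) by rewrite mulr_ge0 ?divr_ge0 ?(ltW c10) ?(ltW eta0) ?(ltW G0').
  have : eta / G * c1 <= L * c1 by rewrite ler_pM2r.
  by lra.
- move=> N NN v; have -> : - (2 * (c1 * (eta / G) / 2)) * sqn v = - (eta / G * (c1 * sqn v)).
    by field; rewrite gt_eqF.
  apply: le_trans (_ : - (L * (c1 * sqn v)) <= _); last first.
    by rewrite lerN2 ler_wpM2r// mulr_ge0 ?sqn_ge0// ltW.
  rewrite mulr_suml -sumrN; apply: ler_sum => i _; rewrite -mulrN.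
  have [->|li] := eqVneq (lam i) 0; first by rewrite !mul0r.
  rewrite ler_wpM2l// -mulNr; exact: hP y y0 i (lamA i li) N NN v.
Qed.

End LocalMultipliers.

(** * Certificates at one zero *)

Section LocalData.
Context {R : realType} {n m : nat} (g : 'I_m -> {mpoly R[n]}).
Hypothesis garch : quad_archimedean g.
Local Notation S := (basic_semialg g).
Variable beta : R.
Hypotheses (beta0 : 0 < beta).
Implicit Types (u : 'rV[R]_n.+1) (x y z v : 'rV[R]_n).

Definition nonneg_forms : set 'rV[R]_n.+1 := [set u | forall x, S x -> 0 <= peval (aff u) x].

(** Only forms that are nonnegative on S need a certificate, so limits are taken
among them. *)
Definition forms_near u0 : set_system 'rV[R]_n.+1 := within nonneg_forms (nbhs u0).

Global Instance forms_near_filter u0 : Filter (forms_near u0).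
Proof. exact: within_filter. Qed.

Lemma forms_nearW u0 (P : set 'rV[R]_n.+1) : (\forall u \near u0, P u) ->
  \forall u \near forms_near u0, P u.
Proof. by apply: filterS => u Pu _. Qed.

Lemma forms_near_nonneg u0 : \forall u \near forms_near u0, nonneg_forms u.
Proof. by apply: (@nearW _ (nbhs u0) (fun u => nonneg_forms u -> nonneg_forms u)). Qed.

Lemma compact_pos u0 (K : set 'rV[R]_n) : compact K -> (forall z, K z -> 0 < peval (aff u0) z) ->
  exists2 e : R, 0 < e & forall z, K z -> e <= peval (aff u0) z.
Proof.
move=> cK Kpos; have [[z0 Kz0]|K0] := pselect (exists z, K z); last first.
  by exists 1 => // z Kz; exfalso; apply: K0; exists z.
have [||c Kc cmin] := @EVT_min_rV R n (peval (aff u0)) K _ cK.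
- by exists z0.
- by apply: continuous_subspaceT => x; exact: peval_continuous.
exists (peval (aff u0) c); first by apply: Kpos; exact: set_mem.
by move=> z Kz; apply: cmin; exact: mem_set.
Qed.

Lemma closed_norm_le x (r : R) : closed [set z : 'rV[R]_n | `|z - x| <= r].
Proof.
rewrite (_ : [set _ | _] = (fun z => `|z - x|) @^-1` [set t | t <= r])//.
apply: closed_comp; last exact: closed_le.
move=> z _; apply: (@continuous_comp _ _ _ (fun z : 'rV[R]_n => z - x) (fun t => `|t|)).
  by apply: continuousB; [exact: cvg_id|exact: cst_continuous].
exact: norm_continuous.
Qed.

Lemma closed_norm_ge x (r : R) : closed [set z : 'rV[R]_n | r <= `|z - x|].
Proof.
rewrite (_ : [set _ | _] = (fun z => `|z - x|) @^-1` [set t | r <= t])//.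
apply: closed_comp; last exact: closed_ge.
move=> z _; apply: (@continuous_comp _ _ _ (fun z : 'rV[R]_n => z - x) (fun t => `|t|)).
  by apply: continuousB; [exact: cvg_id|exact: cst_continuous].
exact: norm_continuous.
Qed.

(** For the form u0 itself, x is a minimiser, so quadratic growth isolates x
among the zeros.  For that reason the minimisers Y u over a fixed closed ball
converge to x. *)
Lemma local_data x u0 : nonneg_forms u0 -> S x -> peval (aff u0) x = 0 -> linp u0 != 0 ->
  (forall i, peval (g i) x = 0 -> strictly_quasiconcave_at (g i) x) ->
  (forall r : R, 0 < r -> exists z, [/\ S z, z != x & `|z - x| < r]) ->
  exists N0 c rho Lam (Y : 'rV[R]_n.+1 -> 'rV[R]_n) (lam : 'rV[R]_n.+1 -> 'I_m -> R),
  [/\ 0 < c, 0 < rho,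
    forall z, S z -> `|z - x| < rho -> z != x -> 0 < peval (aff u0) z,
    forall r : R, 0 < r -> \forall u \near forms_near u0, `|Y u - x| < r &
    \forall u \near forms_near u0, [/\ S (Y u), 0 <= peval (aff u) (Y u) <= peval (aff u) x &
       good_multipliers g beta N0 c rho Lam x u (Y u) (lam u)]].
Proof.
move=> u0S Sx ux0 u0n0 qc iso.
have [N0 [c [rho [Lam [c0 rho0 Lam0 H]]]]] := local_multipliers beta0 u0n0 qc iso.
have posx z : S z -> `|z - x| < rho -> z != x -> 0 < peval (aff u0) z.
  move=> Sz zr zx.
  have [||lam [lamP lamA _ lb _]] := nbhs_singleton H x rho Sx _ rho0.
  - by rewrite subrr normr0.
  - by move=> w Sw _; rewrite ux0 u0S.
  have := lb z Sz zr; rewrite ux0 subr0 => h.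
  have p1 : 0 < c * sqn (z - x) by rewrite mulr_gt0// sqn_gt0 subr_eq0.
  have p2 : 0 <= \sum_i lam i * peval (penalty beta N0 (g i)) z.
    by apply: sumr_ge0 => i _; rewrite mulr_ge0 ?penalty_ge0//; case/andP: (lamP i).
  lra.
pose K := S `&` [set z | `|z - x| <= rho / 2].
have rho2 : 0 < rho / 2 by rewrite divr_gt0.
have cK : compact K.
  by apply: compact_closedI; [exact: basic_semialg_compact|exact: closed_norm_le].
have Kx : K x by split=> //=; rewrite subrr normr0 ltW.
have /choice[Y YP] u : exists y, K y /\ forall z, K z -> peval (aff u) y <= peval (aff u) z.
  have [||y Ky ymin] := @EVT_min_rV R n (peval (aff u)) K _ cK.
  - by exists x.
  - by apply: continuous_subspaceT => z; exact: peval_continuous.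
  exists y; split; first exact: set_mem.
  by move=> z Kz; apply: ymin; exact: mem_set.
have Ynear r : 0 < r -> \forall u \near u0, `|Y u - x| < r.
  move=> r0; pose K' := K `&` [set z | r <= `|z - x|].
  have cK' : compact K' by apply: compact_closedI => //; exact: closed_norm_ge.
  have [z [[Sz zr] rz]|e e0 eP] := @compact_pos u0 K' cK'.
    apply: posx => //; first by apply: le_lt_trans zr _; lra.
    by apply: contraTneq rz => ->; rewrite /= subrr normr0 -ltNge.
  have e3 : 0 < e / 3 by rewrite divr_gt0.
  apply: filterS (near_uniform_aff garch u0 e3) => u uu.
  have [[SY Yr] Ymin] := YP u; rewrite ltNge; apply/negP => rY.
  have := eP (Y u) (conj (conj SY Yr) rY); have := Ymin x Kx.
  have := uu _ SY; have := uu _ Sx; rewrite ux0 !ltr_norml => /andP[_ a1] /andP[a2 _]; lra.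
have /choice[lam lamP] u : exists lam, (exists lam, good_multipliers g beta N0 c rho Lam x u (Y u) lam) ->
    good_multipliers g beta N0 c rho Lam x u (Y u) lam.
  have [[lam lamP]|] := pselect (exists lam, good_multipliers g beta N0 c rho Lam x u (Y u) lam).
    by exists lam.
  by move=> nlam; exists (fun=> 0).
exists N0, c, rho, Lam, Y, lam; split=> //.
  by move=> r r0; apply: forms_nearW; exact: Ynear.
have rho4 : 0 < rho / 4 by rewrite divr_gt0.
apply: filterS3 (forms_nearW H) (forms_nearW (Ynear _ rho4)) (forms_near_nonneg u0) => u Hu Yu uS.
have [[SY Yr] Ymin] := YP u.
split=> //; first by rewrite uS//= Ymin.
apply: lamP; apply: (Hu (Y u) (rho / 4)) => //.
  by apply: lt_trans Yu _; lra.
move=> z Sz zY; apply: Ymin; split=> //=.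
rewrite -(subrKA (Y u)) (le_trans (ler_normD _ _))//; lra.
Qed.

End LocalData.

Section Assembly.
Context {R : realType} {n m : nat} (g : 'I_m -> {mpoly R[n]}).
Hypothesis garch : quad_archimedean g.
Local Notation S := (basic_semialg g).
Variable beta : R.
Hypotheses (beta0 : 0 < beta) (betaP : forall i x, S x -> peval (g i) x <= beta).
Variable u0 : 'rV[R]_n.+1.
Implicit Types (u : 'rV[R]_n.+1) (x y z v : 'rV[R]_n).
Local Notation F := (forms_near g u0).

Lemma bscal_coord k : bscal F (fun u => u 0 k).
Proof.
exists (`|u0| + 1); apply: forms_nearW; apply: filterS (norm_near u0 ltr01) => u uu.
rewrite (le_trans (coord_le _ _))// -[u](subrK u0) addrC.
by rewrite (le_trans (ler_normD _ _))// lerD2l ltW.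
Qed.

Lemma bfam_aff : bfam F (fun u : 'rV[R]_n.+1 => aff u).
Proof.
apply: bfamD; first by apply: bfam_scal; exact: bscal_coord.
apply: bfam_sum => i _; apply: bfamZ; last exact: bfam_var.
by under eq_fun do rewrite mxE; exact: bscal_coord.
Qed.

Lemma bscal_converging (Y : 'rV[R]_n.+1 -> 'rV[R]_n) x i :
  (forall r : R, 0 < r -> \forall u \near F, `|Y u - x| < r) -> bscal F (fun u => Y u 0 i).
Proof.
move=> Yx; exists (`|x| + 1); apply: filterS (Yx 1 ltr01) => u uu.
rewrite (le_trans (coord_le _ _))// -[Y u](subrK x) addrC.
by rewrite (le_trans (ler_normD _ _))// lerD2l ltW.
Qed.

(** The term (tau / 2) |X - Y|^2 makes q nonnegative on S: near x by quadratic
growth, and elsewhere because N is chosen so large that the penalty terms, and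
the value of the form at Y, are below e1. *)
Lemma point_certificate x N0 c rho Lam (Y : 'rV[R]_n.+1 -> 'rV[R]_n) (lam : 'rV[R]_n.+1 -> 'I_m -> R)
    (rest : 'rV[R]_n.+1 -> {mpoly R[n]}) (delta W tau : R) :
  S x -> peval (aff u0) x = 0 -> 0 < c -> 0 < rho ->
  (forall r : R, 0 < r -> \forall u \near F, `|Y u - x| < r) ->
  (\forall u \near F, [/\ S (Y u), 0 <= peval (aff u) (Y u) <= peval (aff u) x &
       good_multipliers g beta N0 c rho Lam x u (Y u) (lam u)]) ->
  bfam F rest -> 0 <= delta -> delta * W <= c ->
  (\forall u \near F, forall z, S z -> `|peval (rest u) z| <= W) ->
  (\forall u \near F, forall z, S z ->
     0 <= peval (aff u - delta *: (sqdist (Y u) * rest u)) z) ->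
  0 < tau ->
  umod g F (fun u => (aff u - delta *: (sqdist (Y u) * rest u)) + tau *: sqdist (Y u)).
Proof.
move=> Sx ux0 c0 rho0 Yx data brest delta0 dW restW fpos tau0.
have bY i : bscal F (fun u => Y u 0 i) by exact: (bscal_converging i Yx).
pose e1 := tau / 4 * (rho / 2) ^+ 2.
have e10 : 0 < e1 by rewrite mulr_gt0 ?exprn_gt0 ?divr_gt0.
have Lam0 : \forall u \near F, forall i, 0 <= lam u i <= Lam.
  by apply: filterS data => u [_ _ [H]].
pose N := (N0 + (Num.truncn (m%:R * `|Lam| * beta / e1)).+1)%N.
have NN0 : (N0 <= N)%N by rewrite leq_addr.
have Npos : (0 < N)%N by rewrite /N addnS.
have NR : m%:R * `|Lam| * beta / e1 <= N%:R.
  by apply: le_trans (ltW (truncnS_gt _)) _; rewrite ler_nat leq_addl.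
pose pen i := penalty beta N (g i).
have [B BP] := choice (fun i => taylor2 bY (bfam_cst (F := F) (pen i))).
have bB i j k : bfam F (B i j k) by case: (BP i).
have blam i : bscal F (fun u => lam u i).
  exists `|Lam|; apply: filterS Lam0 => u /(_ i) /andP[l0 lL].
  by rewrite ger0_norm// (le_trans lL)// ler_norm.
pose A j k u : {mpoly R[n]} := (if j == k then mpolyC n (tau / 2) - delta *: rest u else 0) -
   \sum_i lam u i *: B i j k u.
have bA j k : bfam F (A j k).
  apply: bfamB; last by apply: bfam_sum => i _; exact: bfamZ.
  case: (j == k); last exact: bfam0.
  apply: bfamB; first exact: bfam_cst.
  by apply: (@bfamZ _ _ _ _ _ (fun=> _)) => //; exact: bscal_cst.
pose q u := aff u - delta *: (sqdist (Y u) * rest u) + (tau / 2) *: sqdist (Y u) -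
   mpolyC n (peval (aff u) (Y u)) - \sum_i lam u i *: pen i.
have qE : \forall u \near F, q u = \sum_j \sum_k A j k u * (dvar (Y u) j * dvar (Y u) k).
  apply: filterS data => u [SY _ [_ lamA lamE _ _]].
  have -> : \sum_j \sum_k A j k u * (dvar (Y u) j * dvar (Y u) k) =
     (mpolyC n (tau / 2) - delta *: rest u) * sqdist (Y u) -
     \sum_i lam u i *: (\sum_j \sum_k B i j k u * dvar (Y u) j * dvar (Y u) k).
    have -> : \sum_i lam u i *: (\sum_j \sum_k B i j k u * dvar (Y u) j * dvar (Y u) k) =
      \sum_j \sum_k (\sum_i lam u i *: B i j k u) * (dvar (Y u) j * dvar (Y u) k).
      under eq_bigr do rewrite scaler_sumr.
      rewrite exchange_big; apply: eq_bigr => j _ /=.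
      under eq_bigr do rewrite scaler_sumr.
      rewrite exchange_big; apply: eq_bigr => k _ /=.
      by rewrite mulr_suml; apply: eq_bigr => i _; rewrite -scalerAl mulrA.
    rewrite /sqdist mulr_sumr -sumrB; apply: eq_bigr => j _.
    transitivity (\sum_k ((if j == k then mpolyC n (tau / 2) - delta *: rest u else 0) *
        (dvar (Y u) j * dvar (Y u) k)) -
      \sum_k (\sum_i lam u i *: B i j k u) * (dvar (Y u) j * dvar (Y u) k)).
      by rewrite -sumrB; apply: eq_bigr => k _; rewrite -mulrBl.
    congr (_ - _); rewrite (bigD1 j)//= eqxx big1 ?addr0 ?expr2// => k.
    by rewrite eq_sym => /negPf ->; rewrite mul0r.
  have -> : \sum_i lam u i *: (\sum_j \sum_k B i j k u * dvar (Y u) j * dvar (Y u) k) =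
     \sum_i lam u i *: pen i - (aff u - mpolyC n (peval (aff u) (Y u))).
    rewrite {1}(aff_expand u (Y u)) addrDK lamE.
    transitivity (\sum_i lam u i *: pen i - \sum_i lam u i *: \sum_j mpolyC n (peval (mderiv j (g i)) (Y u)) * dvar (Y u) j).
      rewrite -sumrB; apply: eq_bigr => i _; rewrite -scalerBr.
      have [->|li] := eqVneq (lam u i) 0; first by rewrite !scale0r.
      congr (_ *: _); have [_ eB _] := BP i; have := eB u.
      have gY0 := lamA i li.
      have -> : peval (pen i) (Y u) = 0 by rewrite /pen /penalty pevalM gY0 mul0r.
      rewrite mpolyC0 add0r => E; rewrite {1}E.
      under [X in _ = X + _ - _]eq_bigr do rewrite mderiv_penalty//.
      by rewrite addrDK.
    congr (_ - _); under eq_bigr do rewrite scaler_sumr.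
    rewrite exchange_big; apply: eq_bigr => j _ /=.
    rewrite summxE scaler_suml; apply: eq_bigr => i _.
    by rewrite !mxE mul_mpolyC scalerA.
  rewrite /q -!mul_mpolyC; ring.
have psdA : \forall u \near F, forall v : 'rV[R]_n,
    0 <= \sum_j \sum_k peval (A j k u) (Y u) * v 0 j * v 0 k.
  apply: filterS2 data restW => u [SY _ [lam0 lamA _ _ hN]] rW v.
  have hE i : hess (pen i) (Y u) v = 2 * \sum_j \sum_k peval (B i j k u) (Y u) * v 0 j * v 0 k.
    have sw : \sum_j \sum_k peval (B i j k u) (Y u) * v 0 j * v 0 k =
        \sum_j \sum_k peval (B i k j u) (Y u) * v 0 j * v 0 k.
      by rewrite exchange_big; apply: eq_bigr => j _; apply: eq_bigr => k _; rewrite mulrAC.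
    rewrite mulr_natl mulr2n {2}sw -big_split; apply: eq_bigr => j _ /=.
    rewrite -big_split; apply: eq_bigr => k _ /=.
    by have [_ _ hA] := BP i; rewrite -hA !mulrDl.
  have -> : \sum_j \sum_k peval (A j k u) (Y u) * v 0 j * v 0 k =
     (tau / 2 - delta * peval (rest u) (Y u)) * sqn v -
     \sum_i lam u i * \sum_j \sum_k peval (B i j k u) (Y u) * v 0 j * v 0 k.
    have -> : \sum_i lam u i * (\sum_j \sum_k peval (B i j k u) (Y u) * v 0 j * v 0 k) =
      \sum_j \sum_k (\sum_i lam u i * peval (B i j k u) (Y u)) * v 0 j * v 0 k.
      under eq_bigr do rewrite mulr_sumr.
      rewrite exchange_big; apply: eq_bigr => j _ /=.
      under eq_bigr do rewrite mulr_sumr.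
      rewrite exchange_big; apply: eq_bigr => k _ /=.
      by rewrite !mulr_suml; apply: eq_bigr => i _; rewrite !mulrA.
    rewrite /sqn mulr_sumr -sumrB; apply: eq_bigr => j _.
    transitivity (\sum_k ((if j == k then tau / 2 - delta * peval (rest u) (Y u) else 0) *
        v 0 j * v 0 k) -
      \sum_k (\sum_i lam u i * peval (B i j k u) (Y u)) * v 0 j * v 0 k).
      rewrite -sumrB; apply: eq_bigr => k _; rewrite -!mulrBl; congr (_ * _ * _).
      rewrite /A pevalB peval_sum; congr (_ - _).
        by case: ifP; rewrite !peval_simp.
      by apply: eq_bigr => i _; rewrite pevalZ.
    congr (_ - _); rewrite (bigD1 j)//= eqxx big1 ?addr0 ?expr2 ?mulrA// => k.
    by rewrite eq_sym => /negPf ->; rewrite !mul0r.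
  have := hN N NN0 v; under eq_bigr do rewrite -/(pen _) hE mulrCA.
  rewrite -mulr_sumr; set Q := \sum_i _ => hQ.
  have s0 := sqn_ge0 v.
  have dr : delta * peval (rest u) (Y u) <= c.
    apply: le_trans dW; rewrite ler_wpM2l//.
    by rewrite (le_trans (ler_norm _))// rW.
  have h1 : delta * peval (rest u) (Y u) * sqn v <= c * sqn v by rewrite ler_wpM2r.
  have h2 : 0 <= tau / 2 * sqn v by rewrite mulr_ge0// ltW// divr_gt0.
  by rewrite mulrBl; lra.
have epsN : \forall u \near F, peval (aff u) x < e1.
  have := forms_nearW g (near_uniform_aff garch u0 e10).
  by apply: filterS => u /(_ x Sx); rewrite ux0 subr0 ltr_norml => /andP[].
have rho2 : 0 < rho / 2 by rewrite divr_gt0.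
have qS : \forall u \near F, forall z, S z -> 0 <= peval (q u) z.
  apply: filterS3 data (filterI fpos restW) (filterI epsN (Yx _ rho2)) =>
    u [SY /andP[eps0 epsx] [lam0 lamA _ low _]] [fu rW] [ex Yr] z Sz.
  have penz i : 0 <= peval (pen i) z by exact: penalty_ge0.
  have gz i : 0 <= peval (g i) z <= beta by rewrite Sz betaP.
  have sq0 := sqn_ge0 (z - Y u).
  have := fu z Sz; rewrite /q !pevalB pevalD pevalB !pevalZ pevalM !peval_sqdist pevalC peval_sum.
  rewrite (_ : \sum_i peval (lam u i *: pen i) z = \sum_i lam u i * peval (pen i) z); last first.
    by apply: eq_bigr => i _; rewrite pevalZ.
  set Sg := \sum_i _; move=> fuz.
  have [zr|zr] := ltP `|z - x| rho.
    have h1 := low z Sz zr.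
    have h2 : Sg <= \sum_i lam u i * peval (penalty beta N0 (g i)) z.
      apply: ler_sum => i _; rewrite ler_wpM2l//; first by case/andP: (lam0 i).
      exact: penalty_anti.
    have h3 : delta * (sqn (z - Y u) * peval (rest u) z) <= c * sqn (z - Y u).
      rewrite mulrCA mulrC ler_wpM2r// (le_trans _ dW)// ler_wpM2l//.
      by rewrite (le_trans (ler_norm _))// rW.
    have h4 : 0 <= tau / 2 * sqn (z - Y u) by rewrite mulr_ge0// ltW// divr_gt0.
    by lra.
  have h1 : Sg <= e1.
    apply: le_trans (_ : \sum_(i < m) `|Lam| * (beta / N%:R) <= _).
      apply: ler_sum => i _; have /andP[l0 lL] := lam0 i.
      by rewrite ler_pM// ?(le_trans lL) ?ler_norm// penalty_small.
    rewrite sumr_const card_ord -[_ *+ m]mulr_natl mulrA mulrA ler_pdivrMr ?ltr0n//.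
    by move: NR; rewrite ler_pdivrMr// [N%:R * _]mulrC.
  have h2 : (rho / 2) ^+ 2 <= sqn (z - Y u).
    apply: le_trans (norm_sqr_le _); rewrite lerXn2r ?nnegrE ?(ltW rho2)//.
    have := ler_normD (z - Y u) (Y u - x); rewrite addrA subrK; lra.
  have h3 : e1 * 2 <= tau / 2 * sqn (z - Y u).
    rewrite /e1; have : tau / 2 * (rho / 2) ^+ 2 <= tau / 2 * sqn (z - Y u).
      by rewrite ler_wpM2l// ltW// divr_gt0.
    lra.
  by lra.
have umq : umod g F (fun u => q u + (tau / 2) *: sqdist (Y u)).
  have t2 : 0 < tau / 2 by rewrite divr_gt0.
  apply: umod_near (quadratic_form_umod garch bY bA psdA _ t2).
    by apply: filterS qE => u ->.
  by apply: filterS2 qE qS => u <-.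
have umeps : umod g F (fun u => peval (aff u) (Y u) *: 1).
  apply: umodZ; last exact: umod1.
  by apply: filterS data => u [_ /andP[]].
have umpen : umod g F (fun u => \sum_i lam u i *: pen i).
  apply: umod_sum => i _; apply: umodZ.
    by apply: filterS Lam0 => u /(_ i) /andP[].
  have ugi : umod g F (fun=> g i) by apply: umod_cst; exact: quad_module_gen.
  have : umod g F (fun=> ((1 - beta^-1 *: g i) ^+ N) ^+ 2 * g i).
    apply: (@umod_sqrM _ _ _ _ _ _ _ (fun=> (1 - beta^-1 *: g i) ^+ N)) => //.
    by apply: bfam_bdeg; exact: bfam_cst.
  by apply: umod_eq => u; rewrite /pen /penalty exprM mulrC.
apply: umod_eq (umodD umq (umodD umeps umpen)) => u.
rewrite /q -[peval _ _ *: 1]mul_mpolyC mulr1.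
have -> : tau *: sqdist (Y u) = (tau / 2) *: sqdist (Y u) + (tau / 2) *: sqdist (Y u).
  by rewrite -scalerDl -splitr.
ring.
Qed.

End Assembly.

(** * Uniform certificates and the degree bound *)

Section LocalUniform.
Context {R : realType} {n m : nat} (g : 'I_m -> {mpoly R[n]}).
Hypothesis garch : quad_archimedean g.
Local Notation S := (basic_semialg g).
Hypothesis g_int : interior_near_convbd S.
Hypothesis g_sqc : forall i : 'I_m, strictly_quasiconcave_on (g i) (convbd S `&` zero_set (g i)).
Implicit Types (u : 'rV[R]_n.+1) (x y z v : 'rV[R]_n).

Lemma semialg_upper_bound : exists2 beta : R, 0 < beta & forall i x, S x -> peval (g i) x <= beta.
Proof.
have /choice[N NP] : forall i : 'I_m, exists N : nat, forall x, S x -> peval (g i) x <= N%:R.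
  move=> i; have [N [_ _ H]] := garch (g i); exists N => x Sx.
  by have := quad_module_ge0 H Sx; rewrite -mpolyC_nat !peval_simp subr_ge0.
exists (1 + \sum_i (N i)%:R); first by rewrite ltr_wpDr// sumr_ge0.
move=> i x Sx; apply: le_trans (NP i x Sx) _.
by rewrite (bigD1 i)//= addrCA lerDl addr_ge0// sumr_ge0.
Qed.

(** The zeros of u0 on S are covered by finitely many of the balls of [local_data];
away from them u0 is bounded below by some eta > 0.  The constant delta is small
against eta and against the quadratic growth at each zero. *)
Lemma uniform_certificate_near u0 : nonneg_forms g u0 -> `|u0| = 1 ->
  umod g (forms_near g u0) (fun u : 'rV[R]_n.+1 => aff u).
Proof.
move=> u0S u01; have [beta beta0 betaP] := semialg_upper_bound.
pose Z := [set x | S x /\ peval (aff u0) x = 0].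
have Zlin x : Z x -> linp u0 != 0.
  move=> [Sx ux0]; apply/eqP => l0; move: ux0; rewrite peval_aff l0 dotv0l addr0 => c0.
  suff u00 : u0 = 0 by move: u01; rewrite u00 normr0 => /eqP; rewrite eq_sym oner_eq0.
  apply/rowP => k; rewrite mxE; case: (unliftP ord0 k) => [j ->|->//].
  by have /rowP/(_ j) := l0; rewrite !mxE.
pose datum := (nat * R * R * R * ('rV[R]_n.+1 -> 'rV[R]_n) * ('rV[R]_n.+1 -> 'I_m -> R))%type.
have /choice[dat datP] : forall x, exists d : datum, let: (N0, c, rho, Lam, Y, lam) := d in
  Z x -> [/\ 0 < c, 0 < rho,
    forall z, S z -> `|z - x| < rho -> z != x -> 0 < peval (aff u0) z,
    forall r : R, 0 < r -> \forall u \near forms_near g u0, `|Y u - x| < r &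
    \forall u \near forms_near g u0, [/\ S (Y u), 0 <= peval (aff u) (Y u) <= peval (aff u) x &
       good_multipliers g beta N0 c rho Lam x u (Y u) (lam u)]].
  move=> x; have [Zx|nZx] := pselect (Z x); last first.
    by exists (0%N, 0, 0, 0, (fun=> 0), (fun _ _ => 0)).
  have [Sx ux0] := Zx; have lin0 := Zlin x Zx.
  have cbx : convbd S x by exact: supporting_point_convbd ux0 u0S lin0.
  have [|r r0|N0 [c [rho [Lam [Y [lam H]]]]]] := local_data garch beta0 u0S Sx ux0 lin0.
  - by move=> i gx0; exact: g_sqc.
  - have [i0 _] : exists i0, linp u0 0 i0 != 0.
      by apply/existsP; apply: contraNT lin0 => /existsPn H; apply/eqP/rowP => j;
        rewrite [RHS]mxE; apply/eqP; rewrite -[_ == _]negbK H.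
    exact: not_isolated i0 (g_int cbx) r0.
  - by exists (N0, c, rho, Lam, Y, lam) => _.
pose N0 x := (dat x).1.1.1.1.1; pose cc x := (dat x).1.1.1.1.2; pose rr x := (dat x).1.1.1.2.
pose LL x := (dat x).1.1.2; pose YY x := (dat x).1.2; pose ll x := (dat x).2.
have {}datP x : Z x -> [/\ 0 < cc x, 0 < rr x,
    forall z, S z -> `|z - x| < rr x -> z != x -> 0 < peval (aff u0) z,
    forall r : R, 0 < r -> \forall u \near forms_near g u0, `|YY x u - x| < r &
    \forall u \near forms_near g u0, [/\ S (YY x u), 0 <= peval (aff u) (YY x u) <= peval (aff u) x &
       good_multipliers g beta (N0 x) (cc x) (rr x) (LL x) x u (YY x u) (ll x u)]].
  move=> Zx; move: (datP x); rewrite /N0 /cc /rr /LL /YY /ll.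
  by case: (dat x) => [[[[[? ?] ?] ?] ?] ?] /= /(_ Zx).
have cZ : compact Z.
  rewrite (_ : Z = S `&` (peval (aff u0) @^-1` [set 0])) //.
  apply: compact_closedI; first exact: basic_semialg_compact.
  apply: closed_comp; last exact: closed_eq.
  by move=> z _; exact: peval_continuous.
have [D0 DZ Dcov] : finite_subset_cover Z (fun x => [set z | `|z - x| < rr x]) Z.
  move: cZ; rewrite compact_cover; apply.
    move=> x _; rewrite (_ : [set _ | _] = ball x (rr x)); first exact: ball_open.
    by apply/seteqP; split=> z; rewrite -ball_normE /= distrC.
  move=> x Zx; exists x => //=; rewrite subrr normr0.
  by case: (datP x Zx).
pose D := seq_sub (finmap.enum_fset D0).
have DP (k : D) : Z (val k) by apply: set_mem; apply: DZ; exact: ssvalP.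
have cc0 (k : D) : 0 < cc (val k) by case: (datP _ (DP k)).
have rr0 (k : D) : 0 < rr (val k) by case: (datP _ (DP k)).
pose K := S `&` \bigcap_(k : D) [set z | rr (val k) <= `|z - val k|].
have cK : compact K.
  apply: compact_closedI; first exact: basic_semialg_compact.
  by apply: closed_bigI => k _; exact: closed_norm_ge.
have [z [Sz zK]|eta eta0 etaP] := @compact_pos R n u0 K cK.
  rewrite lt_def u0S// andbT; apply/eqP => uz0.
  have [x Dx /= zx] := Dcov z (conj Sz uz0).
  by have := zK (SeqSub Dx) I; rewrite /= leNgt zx.
pose y (k : D) u := YY (val k) u.
have bY (k : D) i : bscal (forms_near g u0) (fun u => y k u 0 i).
  by apply: (@bscal_converging _ _ _ g u0 (YY (val k)) (val k)); case: (datP _ (DP k)).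
pose s := enum {: D}.
pose w u := sqdists y s u.
pose rest (k : D) u := \prod_(j <- s | j != k) sqdist (y j u).
have wE k u : w u = sqdist (y k u) * rest k u.
  by rewrite /w /sqdists (bigD1_seq k) ?mem_enum ?enum_uniq.
have bw : bfam (forms_near g u0) w by exact: bfam_sqdists.
have brest k : bfam (forms_near g u0) (rest k).
  by apply: bfam_prod => j _; exact: bfam_sqdist.
have [W0 W00 W0P] := bfam_boundedS garch bw.
have /choice[W WP] : forall k, exists W : R, 0 < W /\
    \forall u \near forms_near g u0, forall z, S z -> `|peval (rest k u) z| <= W.
  by move=> k; have [W W0' WP] := bfam_boundedS garch (brest k); exists W.
pose delta := \big[Num.min/(eta / 2 / W0)]_(k : D) (cc (val k) / W k).
have delta0 : 0 < delta.
  rewrite /delta; elim/big_ind: _ => [|a b a0 b0|k _]; first by rewrite !divr_gt0.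
    by rewrite lt_min a0.
  by rewrite divr_gt0//; case: (WP k).
have deltaW k : delta * W k <= cc (val k).
  rewrite -ler_pdivlMr; last by case: (WP k).
  exact: bigmin_le_cond.
have deltaW0 : delta * W0 <= eta / 2.
  by rewrite -ler_pdivlMr//; exact: bigmin_le_id.
pose f u := aff u - delta *: w u.
have bf : bfam (forms_near g u0) f.
  apply: bfamB; first exact: bfam_aff.
  by apply: (@bfamZ _ _ _ _ _ (fun=> _)) => //; exact: bscal_cst.
have allk : \forall u \near forms_near g u0, forall k : D, (forall z, S z -> `|peval (rest k u) z| <= W k) /\
   [/\ S (y k u), 0 <= peval (aff u) (y k u) <= peval (aff u) (val k) &
       good_multipliers g beta (N0 (val k)) (cc (val k)) (rr (val k)) (LL (val k)) (val k) u (y k u) (ll (val k) u)].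
  pose P (k : D) u := (forall z, S z -> `|peval (rest k u) z| <= W k) /\
   [/\ S (y k u), 0 <= peval (aff u) (y k u) <= peval (aff u) (val k) &
       good_multipliers g beta (N0 (val k)) (cc (val k)) (rr (val k)) (LL (val k)) (val k) u (y k u) (ll (val k) u)].
  have := @filter_forall _ _ P (forms_near g u0) (forms_near_filter g u0); apply => k.
  apply: filterI; first by case: (WP k).
  by case: (datP _ (DP k)).
have eta2 : 0 < eta / 2 by rewrite divr_gt0.
have f_ge0 : \forall u \near forms_near g u0, forall z, S z -> 0 <= peval (f u) z.
  apply: filterS3 allk W0P (forms_nearW g (near_uniform_aff garch u0 eta2)) => u uk uW uu z Sz.
  rewrite /f pevalB pevalZ subr_ge0.
  have [[k zk]|nk] := pselect (exists k : D, `|z - val k| < rr (val k)).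
    have [rW [_ /andP[eps0 _] [lam0 _ _ low _]]] := uk k.
    have h1 := low z Sz zk.
    have h2 : 0 <= \sum_i ll (val k) u i * peval (penalty beta (N0 (val k)) (g i)) z.
      by apply: sumr_ge0 => i _; rewrite mulr_ge0 ?penalty_ge0//; case/andP: (lam0 i).
    have h3 : delta * peval (w u) z <= cc (val k) * sqn (z - y k u).
      rewrite (wE k) pevalM peval_sqdist mulrCA mulrC ler_wpM2r ?sqn_ge0//.
      apply: le_trans (deltaW k); rewrite ler_wpM2l ?(ltW delta0)//.
      by rewrite (le_trans (ler_norm _))// rW.
    lra.
  have Kz : K z.
    by split=> // k _ /=; rewrite leNgt; apply/negP => zk; apply: nk; exists k.
  have h1 : delta * peval (w u) z <= eta / 2.
    apply: le_trans deltaW0; rewrite ler_wpM2l ?(ltW delta0)//.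
    by rewrite (le_trans (ler_norm _))// uW.
  by have := uu z Sz; have := etaP z Kz; rewrite ltr_norml => h2 /andP[h3 _]; lra.
have claimk (k : D) (tau : R) : 0 < tau ->
    umod g (forms_near g u0) (fun u => f u + tau *: sqdist (y k u)).
  move=> tau0; have [Sx ux0] := DP k; have [_ _ _ Yx data] := datP _ (DP k).
  have [_ rW] := WP k.
  have fE u : f u = aff u - delta *: (sqdist (y k u) * rest k u) by rewrite /f (wE k).
  have : umod g (forms_near g u0) (fun u => aff u - delta *: (sqdist (y k u) * rest k u) + tau *: sqdist (y k u)).
    apply: (@point_certificate _ _ _ _ garch _ beta0 betaP u0 (val k) _ _ _ _ _ _ _ _ (W k)) data _ _ _ _ _ _ => //.
    - exact: ltW.
    - by apply: filterS f_ge0 => u fu z Sz; rewrite -fE fu.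
  by apply: umod_eq => u; rewrite fE.
have [d0 d00 d0P] : exists2 d0 : R, 0 < d0 & forall k j : D, k != j -> d0 <= `|val k - val j|.
  exists (\big[Num.min/1]_(p : D * D | p.1 != p.2) `|val p.1 - val p.2|).
    elim/big_ind: _ => // [a b a0 b0|p pp]; first by rewrite lt_min a0.
    by rewrite normr_gt0 subr_eq0 (inj_eq val_inj).
  by move=> k j kj; apply: (@bigmin_le_cond _ _ _ _ (k, j)).
have d04 : 0 < d0 / 4 by rewrite divr_gt0.
have sep (k j : D) : k != j -> \forall u \near forms_near g u0, (d0 / 2) ^+ 2 <= sqn (y k u - y j u).
  move=> kj; have [_ _ _ Yk _] := datP _ (DP k); have [_ _ _ Yj _] := datP _ (DP j).
  apply: filterS2 (Yk _ d04) (Yj _ d04) => u uk uj.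
  apply: le_trans (norm_sqr_le _); rewrite lerXn2r ?nnegrE ?divr_ge0 ?(ltW d00)//.
  have := d0P k j kj.
  have -> : val k - val j = (y k u - y j u) - (y k u - val k) + (y j u - val j).
    by apply/rowP => i; rewrite !mxE; ring.
  move=> h; have := le_trans h (ler_normD _ _).
  have := ler_normB (y k u - y j u) (y k u - val k).
  by rewrite /y in uk uj *; lra.
have d02 : 0 < (d0 / 2) ^+ 2 by rewrite exprn_gt0// divr_gt0.
have : umod g (forms_near g u0) (fun u => f u + delta *: sqdists y s u).
  by apply: (umod_add_sqdists garch bY bf f_ge0 d02 sep claimk) => //; exact: enum_uniq.
by apply: umod_eq => u; rewrite /f subrK.
Qed.

End LocalUniform.

Lemma trunc_quad_moduleZ (R : realType) (n m : nat) (g : 'I_m -> {mpoly R[n]}) d c f :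
  0 <= c -> trunc_quad_module d g f -> trunc_quad_module d g (c *: f).
Proof.
move=> c0 df; rewrite -(sqr_sqrtr c0) -mul_mpolyC rmorphXn -[d]addn0.
by apply: (@trunc_quad_module_sqrM _ _ _ _ _ 0) => //; exact: deg_leC.
Qed.

Theorem corollary55 (R : realType) (n m : nat) (g : 'I_m -> {mpoly R[n]})
    (g_arch : quad_archimedean g)
    (g_int : interior_near_convbd (basic_semialg g))
    (g_sqc : forall i : 'I_m,
       strictly_quasiconcave_on (g i)
         (convbd (basic_semialg g) `&` zero_set (g i))) :
  exists d : nat, (0 < d)%N /\
    forall l : {mpoly R[n]}, deg_le 1 l ->
      (forall x : 'rV[R]_n, basic_semialg g x -> 0 <= peval l x) ->
      trunc_quad_module d g l.
Proof.
pose sphere : set 'rV[R]_n.+1 := [set u | `|u| = 1].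
have csphere : compact sphere.
  apply: bounded_closed_compact.
    by exists 1; split; [exact: num_real|move=> M M1 u /= ->; exact: ltW].
  rewrite (_ : sphere = (fun u => `|u|) @^-1` [set 1])//.
  by apply: closed_comp; [move=> u _; exact: norm_continuous|exact: closed_eq].
have : \forall d \near \oo, sphere `<=`
    [set u | nonneg_forms g u -> trunc_quad_module d g (aff u)].
  apply: (iffLR (compact_near_coveringP _) csphere) => u0 u01.
  have [u0S|u0S] := pselect (nonneg_forms g u0).
    have [d dP] := uniform_certificate_near g_arch g_int g_sqc u0S u01.
    have dP' : \forall u \near u0, nonneg_forms g u -> trunc_quad_module d g (aff u) by [].
    near=> u e => /= uS; apply: (@trunc_quad_moduleW _ _ _ _ d).
      by near: e; exact: nbhs_infty_ge.
    by move: uS; near: u.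
  have [x [Sx ux]] : exists x, basic_semialg g x /\ peval (aff u0) x < 0.
    move/existsNP: u0S => [x /not_implyP[Sx ux]]; exists x; split=> //.
    by rewrite ltNge; apply/negP.
  have ux2 : 0 < - peval (aff u0) x by rewrite oppr_gt0.
  have nearu : \forall u \near u0, peval (aff u) x < 0.
    apply: filterS (near_uniform_aff g_arch u0 ux2) => u /(_ x Sx).
    by rewrite ltr_norml; lra.
  near=> u e => /= uS; exfalso; have : peval (aff u) x < 0 by near: u.
  by rewrite ltNge uS.
case=> d _ dP; exists d.+1; split=> // l dl lS.
have dP' u : `|u| = 1 -> nonneg_forms g u -> trunc_quad_module d.+1 g (aff u).
  by move=> u1; apply: (dP d.+1 (leqnSn d)).
rewrite (deg_le1_aff dl); rewrite (deg_le1_aff dl) in lS; move: (\row_i _) lS => u uS.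
have [u0|u0] := eqVneq u 0.
  have -> : aff u = 0 *: 1.
    rewrite scale0r u0 /aff mxE mpolyC0 add0r big1// => i _.
    by rewrite !mxE scale0r.
  apply: trunc_quad_moduleZ => //.
  exact: trunc_quad_moduleW (leq0n _) (trunc_quad_module1 g).
have nu : 0 < `|u| by rewrite normr_gt0.
have scaleE x : peval (aff (`|u|^-1 *: u)) x = `|u|^-1 * peval (aff u) x.
  rewrite !peval_aff mxE mulrDr; congr (_ + _).
  by rewrite -dotvZl; congr dotv; apply/rowP => j; rewrite !mxE.
have -> : aff u = `|u| *: aff (`|u|^-1 *: u).
  rewrite /aff scalerDr -mul_mpolyC -mpolyCM mxE mulVKf ?gt_eqF//; congr (_ + _).
  rewrite scaler_sumr; apply: eq_bigr => i _; rewrite scalerA !mxE mulVKf ?gt_eqF//.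
apply: trunc_quad_moduleZ => //; apply: dP'.
  by rewrite normrZ normfV normr_id mulVf ?gt_eqF.
by move=> x Sx; rewrite scaleE mulr_ge0 ?invr_ge0// uS.
Unshelve. all: by end_near.
Qed.
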